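(* Let $m,r,n$ be positive integers with $r\mid m$, put $q=m/r$, and let $K$ be a field of characteristic $p>0$ with $p\nmid m$ containing a primitive $m$th root of unity. Let $G=G(m,r,n)$ and $G'=G(r,r,n)$, let $\tau'$ be an irreducible representation of $G'$ over $K$, and let $\tau$ be the representation of $G$ obtained by pulling back $\tau'$ along the surjection $G\to G'$ that raises every matrix entry to the $q$th power. Take $\hbar=0$ and generic parameters, and let $M=M(\tau)=A\otimes_K\tau$ be the Verma module for the Cherednik algebra $\mathbf{H}(G)$, where $A=K[x_1,\dots,x_n]$. Let $J^1\subset A\otimes_K\tau'$ be the kernel of the contravariant form on the Verma module of the Cherednik algebra $\mathbf{H}(G')$ (equivalently, its unique maximal proper graded submodule), and let $J^q\subset M$ be the $A$-submodule generated by the elements obtained from the elements of $J^1$ by the substitution $x_i\mapsto x_i^q$ for $i=1,\dots,n$. Then $J^q$ is such that $M/J^q$ is an irreducible representation of $\mathbf{H}(G)$.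
   Context: Groups. For positive integers $m,r,n$ with $r\mid m$, $G(m,1,n)$ is the group of $n\times n$ matrices over $K$ having exactly one nonzero entry in each row and column, each nonzero entry being an $m$th root of unity; $G(m,r,n)$ is the subgroup in which the product of the nonzero entries is an $(m/r)$th root of unity. It acts on $\mathfrak{h}=K^n$ and on $\mathfrak{h}^*$; let $x_1,\dots,x_n\in\mathfrak{h}^*$ and $y_1,\dots,y_n\in\mathfrak{h}$ be the dual coordinate bases. Fix a primitive $m$th root of unity $\xi$. The reflections of $G=G(m,r,n)$ (finite-order elements $s$ with $\operatorname{rank}(1-s)=1$) are $s_{ij}^k$ ($0\le k<m$, $1\le i<j\le n$): $x_i\mapsto\xi^kx_j$, $x_j\mapsto\xi^{-k}x_i$, $x_\ell\mapsto x_\ell$ otherwise; and $t_i^k$ ($1\le k<q$, $1\le i\le n$, $q=m/r$): $x_i\mapsto\xi^{rk}x_i$, $x_\ell\mapsto x_\ell$ otherwise. The reflections of $G'=G(r,r,n)$ are the $s_{ij}^k$ with $0\le k<r$ and $\xi$ replaced by $\xi^q$. Cherednik algebra ($\hbar=0$). For each reflection $s$ choose $\alpha_s\in\mathfrak{h}^*$ spanning the image of $1-s$ on $\mathfrak{h}^*$ and $\alpha_s^\vee\in\mathfrak{h}$ with $(1-s)x=(\alpha_s^\vee,x)\alpha_s$. Let $c_s\in K$ depend only on the conjugacy class of $s$. $\mathbf{H}(G)$ is the quotient of $K[G]\ltimes T(\mathfrak{h}\oplus\mathfrak{h}^* )$ by $[x,x']=0$, $[y,y']=0$, $[y,x]=-\sum_s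 c_s(y,\alpha_s)(x,\alpha_s^\vee)s$ for $x,x'\in\mathfrak{h}^*$, $y,y'\in\mathfrak{h}$. It is graded with $\deg x=1$, $\deg y=-1$, $\deg g=0$. The Verma module of a representation $\tau$ of $G$ is $M(\tau)=\mathbf{H}(G)\otimes_{K[G]\ltimes\mathrm{Sym}(\mathfrak{h})}\tau$ ($\mathfrak{h}$ acting by $0$ on $\tau$), identified with $A\otimes_K\tau$, $A=\mathrm{Sym}(\mathfrak{h}^* )$: $A$ acts by multiplication, $G$ diagonally, and $y\in\mathfrak{h}$ by the Dunkl operator $D_y(f\otimes v)=-\sum_s c_s\frac{(y,\alpha_s)}{\alpha_s}(1-s)f\otimes sv$. For $\tau$ irreducible, $M(\tau)$ has a unique maximal proper graded submodule, which is the kernel of the contravariant form. Parameters. All $s_{ij}^k$ of $G$ share one parameter $c_0$ if $n>2$, or $n=2$ and $r$ is odd; if $n=2$ and $r$ is even they have two parameters, $c_0^+$ for $k$ even and $c_0^-$ for $k$ odd. The $t_i^k$ have parameters $c_k$ ($1\le k\le q-1$). Generic means that these parameters are algebraically independent over the prime field. For $\mathbf{H}(G')$ one uses the same $c_0$ (resp. $c_0^\pm$). *)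

(* Defs.v *)
From HB Require Import structures.
From mathcomp Require Import all_boot all_order all_algebra.
From mathcomp Require Import boolp.
From mathcomp Require Import mpoly.

Set Implicit Arguments.
Unset Strict Implicit.
Unset Printing Implicit Defensive.

Import GRing.Theory.
Local Open Scope ring_scope.
Local Open Scope quotient_scope.

(* Conventions.  Over the field K, h = K^n is 'cV[K]_n with coordinate basis
   y_1, ..., y_n, its dual h^* is 'rV[K]_n with coordinate basis x_1, ..., x_n,
   and (y, x) = (x, y) is the entry of x *m y.  A matrix g acts on h by
   y |-> g *m y and on h^* by the contragredient x |-> x *m invmx g.
   Indices are shifted to start at 0. *)

Section QuotientModule.
Variables (R : pzRingType) (V : lmodType R) (N : submodClosed V).

Fact submod_oppr_closed : oppr_closed N.
Proof. by move=> v Nv; rewrite -scaleN1r rpredZ. Qed.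

Definition submod_zmod : zmodClosed V :=
  HB.pack (GRing.SubmodClosed.sort N)
    (GRing.isOppClosed.Build V N submod_oppr_closed).

Definition qmod : Type := Quotient.quot submod_zmod.

HB.instance Definition _ := GRing.Zmodule.on qmod.
HB.instance Definition _ := ZmodQuotient.on qmod.

Definition qmod_pi : V -> qmod := \pi_(Quotient.quot submod_zmod).

Definition qmod_scale (a : R) (u : qmod) : qmod := qmod_pi (a *: repr u).

Lemma qmod_piP (u v : V) : reflect (qmod_pi u = qmod_pi v) (u - v \in N).
Proof. by rewrite -[_ \in N]/(_ \in submod_zmod) Quotient.idealrBE; apply: eqP. Qed.

Lemma qmod_piD : {morph qmod_pi : u v / u + v}.
Proof. by move=> u v; rewrite /qmod_pi raddfD. Qed.

Lemma qmod_repr (u : qmod) : qmod_pi (repr u) = u.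
Proof. exact: reprK. Qed.

Lemma qmod_piZ a v : qmod_pi (a *: v) = qmod_scale a (qmod_pi v).
Proof.
apply/qmod_piP; rewrite -scalerBr rpredZ //.
by apply/qmod_piP; rewrite qmod_repr.
Qed.

Lemma qmod_scaleA a b u :
  qmod_scale a (qmod_scale b u) = qmod_scale (a * b) u.
Proof. by rewrite -[u]qmod_repr -!qmod_piZ scalerA. Qed.

Lemma qmod_scale1 : left_id 1 qmod_scale.
Proof. by move=> u; rewrite -[u]qmod_repr -qmod_piZ scale1r. Qed.

Lemma qmod_scaleDr : right_distributive qmod_scale +%R.
Proof.
move=> a u v; rewrite -[u]qmod_repr -[v]qmod_repr -qmod_piD -!qmod_piZ.
by rewrite scalerDr qmod_piD.
Qed.

Lemma qmod_scaleDl u : {morph qmod_scale^~ u : a b / a + b}.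
Proof.
by move=> a b; rewrite -[u]qmod_repr -!qmod_piZ scalerDl qmod_piD.
Qed.

HB.instance Definition _ := GRing.Zmodule_isLmodule.Build R qmod
  qmod_scaleA qmod_scale1 qmod_scaleDr qmod_scaleDl.

(* The map induced on V / N by a linear map f preserving N. *)
Definition qmod_map (f : V -> V) (u : qmod) : qmod := qmod_pi (f (repr u)).

End QuotientModule.

Section Irreducible.
Variables (K : fieldType) (V : lmodType K).

Definition subspace (N : V -> Prop) : Prop :=
  N 0 /\ forall (a : K) u v, N u -> N v -> N (a *: u + v).

Definition invariant (S : (V -> V) -> Prop) (N : V -> Prop) : Prop :=
  forall f, S f -> forall v, N v -> N (f v).

Definition irreducible (S : (V -> V) -> Prop) : Prop :=
  (exists v : V, v != 0) /\
  forall N, subspace N -> invariant S N ->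
    (exists2 v, N v & v != 0) -> forall v, N v.

End Irreducible.

Section Groups.
Variables (K : fieldType) (n : nat).

Definition Gmrn (m r : nat) (g : 'M[K]_n) : Prop :=
  [/\ forall i, exists! j, g i j != 0,
      forall j, exists! i, g i j != 0,
      forall i j, g i j != 0 -> g i j ^+ m = 1
    & (\prod_(e : 'I_n * 'I_n | g e.1 e.2 != 0) g e.1 e.2) ^+ (m %/ r) = 1].

Definition mx_rep (G : 'M[K]_n -> Prop) d (rho : 'M[K]_n -> 'M[K]_d) : Prop :=
  rho 1%:M = 1%:M /\ forall g h, G g -> G h -> rho (g *m h) = rho g *m rho h.

Definition irreducible_mx_rep (G : 'M[K]_n -> Prop) d
    (rho : 'M[K]_n -> 'M[K]_d) : Prop :=
  mx_rep G rho /\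
  irreducible (fun f : 'cV[K]_d -> 'cV[K]_d =>
    exists2 g, G g & f = (fun v => rho g *m v)).

(* Multiplicative on monomial matrices only. *)
Definition pow_entries (q : nat) (g : 'M[K]_n) : 'M[K]_n :=
  map_mx (fun a => a ^+ q) g.

(* x_i |-> u x_j, x_j |-> u^-1 x_i; this matrix is its own inverse. *)
Definition s_mx (i j : 'I_n) (u : K) : 'M[K]_n :=
  \matrix_(a, b) if a == i then u * (b == j)%:R
                 else if a == j then u^-1 * (b == i)%:R
                 else (a == b)%:R.

(* x_i |-> u x_i; the entry is u^-1 because the action on h^* is dual. *)
Definition t_mx (i : 'I_n) (u : K) : 'M[K]_n :=
  diag_mx (\row_a if a == i then u^-1 else 1).

Lemma s_mxK (i j : 'I_n) (u : K) :
  i != j -> u != 0 -> s_mx i j u *m s_mx i j u = 1%:M.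
Proof.
move=> ij u0; apply/matrixP=> a b; rewrite !mxE.
have E c : s_mx i j u a c * s_mx i j u c b =
    if a == i then (u * (c == j)%:R) * s_mx i j u c b
    else if a == j then u^-1 * (c == i)%:R * s_mx i j u c b
    else (a == c)%:R * s_mx i j u c b.
  by rewrite {1}mxE; case: ifP => // _; case: ifP.
under eq_bigr do rewrite E.
have [->|ai] := eqVneq a i; [|have [->|aj] := eqVneq a j].
- rewrite (bigD1 j) //= big1 ?addr0; last by move=> c /negPf->; rewrite mulr0 mul0r.
  by rewrite eqxx mulr1 mxE eqxx eq_sym (negPf ij) mulrA divff // mul1r eq_sym.
- rewrite (bigD1 i) //= big1 ?addr0; last by move=> c /negPf->; rewrite mulr0 mul0r.
  by rewrite eqxx mulr1 mxE eqxx mulrA mulVf // mul1r eq_sym.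
- rewrite (bigD1 a) //= big1 ?addr0; last by move=> c; rewrite eq_sym => /negPf->; rewrite mul0r.
  by rewrite eqxx mul1r mxE (negPf ai) (negPf aj).
Qed.

End Groups.

Section Reflections.
Variables (K : fieldType) (m r n : nat) (xi : K).

(* inl (i, j, k) stands for s_ij^k and inr (i, k) for t_i^k. *)
Definition refl_index : finType := ('I_n * 'I_n * 'I_m + 'I_n * 'I_(m %/ r))%type.

Definition is_refl (s : refl_index) : bool :=
  match s with inl (i, j, _) => (i < j)%N | inr (_, k) => (0 < k)%N end.

Definition refl_mx (s : refl_index) : 'M[K]_n :=
  match s with
  | inl (i, j, k) => s_mx i j (xi ^+ k)
  | inr (i, k) => t_mx i (xi ^+ (r * k))
  end.

Definition refl_root (s : refl_index) : 'rV[K]_n :=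
  match s with
  | inl (i, j, k) => delta_mx 0 i - xi ^+ k *: delta_mx 0 j
  | inr (i, _) => delta_mx 0 i
  end.

Definition refl_coroot (s : refl_index) : 'cV[K]_n :=
  match s with
  | inl (i, j, k) => delta_mx i 0 - xi ^- k *: delta_mx j 0
  | inr (i, k) => (1 - xi ^+ (r * k)) *: delta_mx i 0
  end.

(* (1 - s) x = (alpha_s^vee, x) alpha_s *)
Lemma refl_rootP (s : refl_index) (x : 'rV[K]_n) : xi != 0 -> is_refl s ->
  x - x *m invmx (refl_mx s) = (x *m refl_coroot s) 0 0 *: refl_root s.
Proof.
move=> xi0.
have inv A B : A *m B = 1%:M :> 'M[K]_n -> invmx A = B.
  move=> AB; have [Au _] := mulmx1_unit AB.
  by rewrite -[invmx A]mulmx1 -AB mulmxA mulVmx // mul1mx.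
case: s => [[[i j] k]|[i k]] /= ; last first.
  move=> k0; set u := xi ^+ _.
  have u0 : u != 0 by rewrite expf_neq0.
  rewrite (inv _ (diag_mx (\row_a if a == i then u else 1))); last first.
    rewrite /t_mx mulmx_diag -diag_const_mx; congr diag_mx; apply/rowP=> a; rewrite !mxE.
    by case: ifP => _; rewrite ?mulVf ?mulr1.
  apply/rowP=> b; rewrite -scalemxAr mul_mx_diag !mxE.
  rewrite (bigD1 i) //= big1 => [|c ci]; last by rewrite mxE (negPf ci) mulr0.
  rewrite !mxE !eqxx /= addr0 mulr1.
  case: eqP => [->|_]; last by rewrite !mulr1 mulr0 subrr.
  by rewrite mulr1 mulrBl mul1r mulrC.
move=> ij; set u := xi ^+ _.
have u0 : u != 0 by rewrite expf_neq0.
have ij' : i != j by rewrite neq_ltn ij.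
rewrite (inv _ _ (s_mxK ij' u0)) mulmxBr -scalemxAr -!colE.
apply/rowP=> b; rewrite !mxE.
have E c : x 0 c * s_mx i j u c b =
    if c == i then x 0 c * (u * (b == j)%:R)
    else if c == j then x 0 c * (u^-1 * (b == i)%:R) else x 0 c * (c == b)%:R.
  by rewrite mxE; case: ifP => _ //; case: ifP.
under eq_bigr do rewrite E.
rewrite (bigD1 i) //= (bigD1 j) 1?eq_sym //= eqxx (negPf (_ : j != i)) 1?eq_sym // eqxx.
have -> : \sum_(c < n | (c != i) && (c != j))
      (if c == i then x 0 c * (u * (b == j)%:R)
       else if c == j then x 0 c * (u^-1 * (b == i)%:R)
       else x 0 c * (c == b)%:R) =
    if (b == i) || (b == j) then 0 else x 0 b.
  case: ifP => [/orP bij|/norP[bi bj]].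
    apply: big1 => c /andP[ci cj]; rewrite (negPf ci) (negPf cj).
    case: eqP => [cb|_]; last by rewrite mulr0.
    by move: ci cj; rewrite cb; case: bij => ->.
  rewrite (bigD1 b) /=; last by rewrite bi bj.
  rewrite (negPf bi) (negPf bj) eqxx mulr1 big1 ?addr0 // => c /andP[/andP[ci cj] cb].
  by rewrite (negPf ci) (negPf cj) (negPf cb) mulr0.
have [bi|bi] := eqVneq b i; have [bj|bj] := eqVneq b j => /=.
- by rewrite -bi -bj eqxx in ij'.
- by rewrite bi !(mulr0, mulr1, add0r, addr0, subr0) mulrC.
- rewrite bj !(mulr0, mulr1, add0r, addr0, sub0r).
  by rewrite mulrN mulrBl mulrAC mulVf // mul1r opprB mulrC.
- by rewrite !(mulr0n, mulr0, add0r, oppr0, addr0, subrr).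
Qed.

(* Number of parameters shared among the s_ij^k; there are none if n = 1. *)
Definition s_classes : nat :=
  if (n <= 1)%N then 0%N else if (n == 2) && ~~ odd r then 2%N else 1%N.

(* c0 0 is the parameter c_0, or c_0^+ with c0 1 = c_0^- if n = 2, r even;
   ct k is the parameter c_k of the t_i^k, for 1 <= k < m / r. *)
Definition refl_param (c0 ct : nat -> K) (s : refl_index) : K :=
  match s with
  | inl (_, _, k) => c0 (k %% s_classes)%N
  | inr (_, k) => ct k
  end.

Definition param_seq (c0 ct : nat -> K) : seq K :=
  [seq c0 a | a <- iota 0 s_classes] ++ [seq ct k | k <- iota 1 (m %/ r).-1].

End Reflections.

(* Algebraic independence over the prime field; K has positive characteristic
   where this is used, so the prime field is the image of the naturals. *)
Definition alg_indep_prime (K : fieldType) (c : seq K) : Prop :=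
  forall P : {mpoly K[size c]},
    (forall mon, exists a : nat, P@_mon = a%:R) ->
    P.@[fun i => c`_i] = 0 -> P = 0.

(* Operators by which the generators x in h^*, y in h and g in G of the
   algebra H(G) act on a vector space. *)
Record cher_ops (K : fieldType) (n : nat) (V : lmodType K) := CherOps {
  op_x : 'rV[K]_n -> V -> V;
  op_y : 'cV[K]_n -> V -> V;
  op_g : 'M[K]_n -> V -> V
}.

Section Cherednik.
Variables (K : fieldType) (m r n : nat) (xi : K) (c0 ct : nat -> K).

Local Notation G := (Gmrn (K := K) (n := n) m r).
Local Notation cpar := (refl_param (m := m) (r := r) (n := n) c0 ct).
Local Notation rmx := (refl_mx (m := m) (r := r) (n := n) xi).
Local Notation rt := (refl_root (m := m) (r := r) (n := n) xi).
Local Notation crt := (refl_coroot (m := m) (r := r) (n := n) xi).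

(* V is a representation of H(G(m,r,n)) at hbar = 0: the operators satisfy the
   relations of the semidirect product of K[G] with T(h + h^* ), and
   [x,x'] = 0, [y,y'] = 0,
   [y,x] = - sum_s c_s (y, alpha_s) (x, alpha_s^vee) s. *)
Record cher_rep (V : lmodType K) (o : cher_ops n V) : Prop := CherRep {
  rep_xl : forall x, linear (op_x o x);
  rep_x : forall v, linear (fun x => op_x o x v);
  rep_yl : forall y, linear (op_y o y);
  rep_y : forall v, linear (fun y => op_y o y v);
  rep_gl : forall g, G g -> linear (op_g o g);
  rep_g1 : forall v, op_g o 1%:M v = v;
  rep_gM : forall g h v, G g -> G h ->
    op_g o (g *m h) v = op_g o g (op_g o h v);
  rep_gx : forall g x v, G g ->
    op_g o g (op_x o x v) = op_x o (x *m invmx g) (op_g o g v);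
  rep_gy : forall g y v, G g ->
    op_g o g (op_y o y v) = op_y o (g *m y) (op_g o g v);
  rep_xx : forall x x' v, op_x o x (op_x o x' v) = op_x o x' (op_x o x v);
  rep_yy : forall y y' v, op_y o y (op_y o y' v) = op_y o y' (op_y o y v);
  rep_yx : forall y x v,
    op_y o y (op_x o x v) - op_x o x (op_y o y v) =
    - \sum_(s | is_refl s)
        (cpar s * (rt s *m y) 0 0 * (x *m crt s) 0 0) *: op_g o (rmx s) v
}.

Definition cher_action (V : lmodType K) (o : cher_ops n V) (f : V -> V) : Prop :=
  [\/ exists x, f = op_x o x, exists y, f = op_y o y
    | exists2 g, G g & f = op_g o g].

Definition cher_submod (V : lmodType K) (o : cher_ops n V) (N : V -> Prop) :=
  subspace N /\ invariant (cher_action o) N.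

Definition irreducible_cher_rep (V : lmodType K) (o : cher_ops n V) : Prop :=
  cher_rep o /\ irreducible (cher_action o).

Definition quot_ops (V : lmodType K) (N : submodClosed V)
    (o : cher_ops n V) : cher_ops n (qmod N) :=
  CherOps (fun x => qmod_map (op_x o x)) (fun y => qmod_map (op_y o y))
          (fun g => qmod_map (op_g o g)).

Section Verma.
Variables (d : nat) (rho : 'M[K]_n -> 'M[K]_d).

(* The linear polynomial of x in h^*, and the action of g on A = Sym(h^* ). *)
Definition lin_poly (x : 'rV[K]_n) : {mpoly K[n]} := \sum_i x 0 i *: 'X_i.

Definition poly_act (g : 'M[K]_n) (f : {mpoly K[n]}) : {mpoly K[n]} :=
  f \mPo [tuple lin_poly (row i (invmx g)) | i < n].

(* The exact quotient f / a in A (0 if a does not divide f). *)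
Definition exact_quo (f a : {mpoly K[n]}) : {mpoly K[n]} :=
  if pselect (exists h, h * a = f) is left e then projT1 (cid e) else 0.

(* A (x) tau with tau = K^d, the coordinate v j being the coefficient in A
   of the j-th basis vector of tau. *)
Definition verma : lmodType K := {ffun 'I_d -> {mpoly K[n]}}.

Definition verma_mul (a : {mpoly K[n]}) (v : verma) : verma :=
  [ffun j => a * v j].

(* (phi (x) rho g) for a linear endomorphism phi of A. *)
Definition verma_tensor (phi : {mpoly K[n]} -> {mpoly K[n]}) (g : 'M[K]_n)
    (v : verma) : verma :=
  [ffun i => \sum_j rho g i j *: phi (v j)].

(* The divisions in the Dunkl operators are exact. *)
Lemma dunkl_exact (g : 'M[K]_n) (a : 'rV[K]_n) f :
  (forall x, exists b, x - x *m invmx g = b *: a) ->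
  exact_quo (f - poly_act g f) (lin_poly a) * lin_poly a = f - poly_act g f.
Proof.
move=> H.
suff ex : exists h, h * lin_poly a = f - poly_act g f.
  by rewrite /exact_quo; case: pselect => // e; case: (cid e).
have X i : exists h, h * lin_poly a = 'X_i - poly_act g 'X_i.
  have [b Hb] := H (delta_mx 0 i); exists b%:MP.
  rewrite /poly_act comp_mpolyXU -tnth_nth tnth_mktuple.
  have -> : row i (invmx g) = delta_mx 0 i - b *: a by rewrite -Hb -rowE opprB addrC subrK.
  rewrite /lin_poly mul_mpolyC scaler_sumr.
  under [X in _ = _ - X]eq_bigr do rewrite !mxE scalerBl.
  rewrite sumrB [X in _ = _ - (X - _)](bigD1 i) /=; last by [].
  rewrite !eqxx scale1r [X in _ + X - _]big1 ?addr0; last first.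
    by move=> c ci; rewrite (negPf ci) scale0r.
  by rewrite opprB addrC subrK; apply: eq_bigr => c _; rewrite scalerA.
pose D f := exists h, h * lin_poly a = f - poly_act g f.
have D1 : D 1 by exists 0; rewrite mul0r /poly_act rmorph1 subrr.
have DM u v : D u -> D v -> D (u * v).
  case=> h1 e1 [h2 e2]; exists (h1 * v + poly_act g u * h2).
  rewrite mulrDl -[X in _ + X]mulrA e2 mulrAC e1 /poly_act rmorphM /= mulrBl mulrBr.
  by rewrite addrA subrK.
have DD u v : D u -> D v -> D (u + v).
  case=> h1 e1 [h2 e2]; exists (h1 + h2).
  by rewrite mulrDl e1 e2 /poly_act comp_mpolyD opprD addrACA.
have DZ c u : D u -> D (c *: u).
  case=> h1 e1; exists (c *: h1).
  by rewrite -scalerAl e1 /poly_act comp_mpolyZ scalerBr.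
have D0 : D 0 by exists 0; rewrite mul0r /poly_act comp_mpoly0 subrr.
rewrite -/(D f) [f]mpolyE; elim/big_ind: _ => // mn _; apply: DZ.
rewrite mpolyXE_id; elim/big_ind: _ => // i _.
by elim: (mn i) => [|k IH]; rewrite ?expr0 ?exprS //; apply: DM.
Qed.

Definition dunkl (y : 'cV[K]_n) (v : verma) : verma :=
  - \sum_(s | is_refl s) (cpar s * (rt s *m y) 0 0) *:
      verma_tensor
        (fun f => exact_quo (f - poly_act (rmx s) f) (lin_poly (rt s)))
        (rmx s) v.

Definition verma_ops : cher_ops n verma :=
  CherOps (fun x => verma_mul (lin_poly x)) dunkl
          (fun g => verma_tensor (poly_act g) g).

Definition verma_homog (k : nat) (v : verma) : verma :=
  [ffun j => pihomog [measure of mdeg] k (v j)].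

Definition proper_graded_submod (N : verma -> Prop) : Prop :=
  [/\ cher_submod verma_ops N,
      forall v, N v -> forall k, N (verma_homog k v)
    & exists v, ~ N v].

Definition max_proper_graded_submod (N : verma -> Prop) : Prop :=
  proper_graded_submod N /\
  forall N', proper_graded_submod N' -> (forall v, N v -> N' v) ->
    forall v, N' v -> N v.

End Verma.
End Cherednik.

Section Jq.
Variables (K : fieldType) (n d : nat).

Definition pow_vars (q : nat) (f : {mpoly K[n]}) : {mpoly K[n]} :=
  f \mPo [tuple 'X_i ^+ q | i < n].

Definition verma_pow_vars (q : nat) (v : verma K n d) : verma K n d :=
  [ffun j => pow_vars q (v j)].

Definition A_span (S : verma K n d -> Prop) : {pred verma K n d} :=
  fun v => `[< exists s : seq ({mpoly K[n]} * verma K n d),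
                 (forall au, au \in s -> S au.2) /\
                 v = \sum_(au <- s) verma_mul au.1 au.2 >].

Fact A_span_closed S : GRing.submod_closed (A_span S).
Proof.
split=> [|a u v].
  by apply/asboolP; exists [::]; split=> //; rewrite big_nil.
move=> /asboolP[s [Ss ->]] /asboolP[t [St ->]]; apply/asboolP.
exists ([seq (a *: au.1, au.2) | au <- s] ++ t); split=> [au|].
  by rewrite mem_cat => /orP[/mapP[bw /Ss Sbw ->]|/St].
rewrite big_cat big_map scaler_sumr; congr (_ + _).
by apply: eq_bigr => bw _; apply/ffunP=> j; rewrite !ffunE -scalerAl.
Qed.

HB.instance Definition _ S :=
  GRing.isSubmodClosed.Build K (verma K n d) (A_span S)
    (GRing.submod_closed_semi (A_span_closed S)).

Definition Jq (q : nat) (J1 : verma K n d -> Prop) : submodClosed (verma K n d) :=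
  A_span (fun v => exists2 u, J1 u & v = verma_pow_vars q u).

End Jq.

(* Main.v *)
(** The group of diagonal matrices with entries in mu_q (q = m / r) splits
    M = A (x) tau into components x^a U(x_1^q, ..., x_n^q) with 0 <= a_i < q,
    and x_i D_i preserves each of them: summing the divided differences of the
    s_ij^k over k in a class modulo r gives
      x_i D_i (x^a U(x^q)) = x^a (B U)(x^q),
      B U = q X_i D'_i U - q sum_(j, a_j < a_i) sum_(k < r) c_0 s_ij^k U + d_(a_i) U,
    where D' and s_ij^k on the right belong to H(G') and d_b is the scalar
    - sum_k c_k (1 - xi^(r k b)).  For a = 0 this reads
    D_i U(x^q) = q x_i^(q-1) (D'_i U)(x^q), so that J^q is a submodule, and an
    element lies in J^q iff all its components U lie in J^1.

    Let v be killed by all D_i modulo J^q.  If a_i > 0, then B U is in J^1.  The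
    operator B - d_(a_i) stabilises J^1 and maps the vectors X^b (x) tau'(g) e_j
    with X^b of bounded degree, a finite spanning family, to combinations of
    them with coefficients integral over Z[parameters other than c_1], so that
    its eigenvalues are integral over this ring.  As c_1 is transcendental over
    the other parameters, - d_(a_i) is not integral, and U is in J^1 by
    Cayley-Hamilton.  The component with a = 0 is
    singular modulo J^1, thus constant modulo J^1 by maximality.  So a nonzero
    submodule of M / J^q contains, by descending degrees, a nonzero constant,
    and constants generate M because tau is irreducible. *)

From HB Require Import structures.
Require Import Defs.
From mathcomp Require Import all_boot all_order all_algebra all_fingroup.
From mathcomp Require Import boolp mpoly ring.

Set Implicit Arguments.
Unset Strict Implicit.
Unset Printing Implicit Defensive.

Import GRing.Theory.
Local Open Scope ring_scope.

(** * Linear substitutions and monomial matrices *)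

(** Nothing is known about the matrix entries of tau': they may involve c_1, so in a basis of tau'
    the operator B - d_(a_i) need not have coefficients integral over the other parameters. The
    vectors tau'(g) e_j avoid this: h sends tau'(g) e_j to tau'(h g) e_j, and only roots of unity,
    integers and parameters remain as coefficients. The family may be linearly dependent, so
    Cayley-Hamilton is applied to a matrix of coefficients rather than to an endomorphism. The
    operator x_i D_i is used because D_i changes the component and lowers the degree, while x_i D_i
    preserves both, which keeps the family finite. For a = 0 the factor x_i has to be removed again,
    since x_i D'_i U in J^1 would not give D'_i U in J^1; this is done by reading D_i v in the
    component of x_i^(q-1). As p does not divide q, the inverse of q lies in the prime field and is
    thus the image of an integer. Hence 1 - xi^(r b), 0 < b < q, has an integral inverse, and c_1
    can be recovered from d_b without leaving the integral closure. *)

Section PolynomialInduction.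
Variables (R : comNzRingType) (n : nat).
Implicit Types f : {mpoly R[n]}.

(** Suited to operators that are known on 1 and on products with a variable, such as ring morphisms
    and twisted derivations. *)
Lemma mpoly_mulX_ind (P : {mpoly R[n]} -> Prop) :
  P 1 -> (forall c f1 f2, P f1 -> P f2 -> P (c *: f1 + f2)) ->
  (forall i f, P f -> P ('X_i * f)) -> forall f, P f.
Proof.
move=> P1 PL PX f; elim/mpolyind: f => [|c mn f _ _ Pf].
  (* The case of 0 comes from 0 = (-1) 1 + 1. *)
  by have := PL (-1) _ _ P1 P1; rewrite scaleN1r addNr.
apply: PL Pf; rewrite mpolyXE_id; elim/big_rec: _ => // i g _ Pg.
by elim: (mn i) => [|k IH]; rewrite ?expr0 ?mul1r // exprS -mulrA; apply: PX.
Qed.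

Lemma eq_mpoly_morph (S : nzRingType) (phi psi : {rmorphism {mpoly R[n]} -> S}) :
  (forall c, phi c%:MP = psi c%:MP) -> (forall i, phi 'X_i = psi 'X_i) ->
  phi =1 psi.
Proof.
move=> Ec Ex f; elim/mpoly_mulX_ind: f => [|c f g Ef Eg|i f Ef].
- by rewrite !rmorph1.
- by rewrite -mul_mpolyC !rmorphD !rmorphM Ec Ef Eg.
- by rewrite !rmorphM Ex Ef.
Qed.

End PolynomialInduction.

Section PolynomialAction.
Variables (K : fieldType) (n : nat).
Implicit Types (f : {mpoly K[n]}) (g h : 'M[K]_n) (x : 'rV[K]_n).

Lemma lin_polyD x x' : lin_poly (x + x') = lin_poly x + lin_poly x'.
Proof.
by rewrite /lin_poly -big_split; apply: eq_bigr => i _; rewrite mxE scalerDl.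
Qed.

Lemma lin_polyZ c x : lin_poly (c *: x) = c *: lin_poly x.
Proof. by rewrite /lin_poly scaler_sumr; apply: eq_bigr => i _; rewrite mxE scalerA. Qed.

Lemma lin_polyB x x' : lin_poly (x - x') = lin_poly x - lin_poly x'.
Proof. by rewrite -scaleN1r lin_polyD lin_polyZ scaleN1r. Qed.

Lemma lin_poly_delta i : lin_poly (delta_mx 0 i : 'rV[K]_n) = 'X_i.
Proof.
rewrite /lin_poly (bigD1 i) //= mxE !eqxx scale1r big1 ?addr0 // => j ji.
by rewrite mxE (negPf ji) andbF scale0r.
Qed.

Lemma mcoeff_lin_poly x i : (lin_poly x)@_(U_(i)) = x 0 i.
Proof.
rewrite /lin_poly raddf_sum /= (bigD1 i) //= mcoeffZ mcoeffXU eqxx mulr1.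
by rewrite big1 ?addr0 // => j ji; rewrite mcoeffZ mcoeffXU (negPf ji) mulr0.
Qed.

Lemma lin_poly_eq0 x : (lin_poly x == 0) = (x == 0).
Proof.
apply/eqP/eqP => [x0|->].
  by apply/rowP => i; rewrite -mcoeff_lin_poly x0 mcoeff0 mxE.
by rewrite -(scale0r 0) lin_polyZ scale0r.
Qed.

HB.instance Definition _ g :=
  GRing.RMorphism.copy (poly_act g)
    (comp_mpoly [tuple lin_poly (row i (invmx g)) | i < n]).
HB.instance Definition _ g :=
  GRing.isScalable.Build K {mpoly K[n]} {mpoly K[n]} *:%R (poly_act g)
    (fun c f => comp_mpolyZ c f [tuple lin_poly (row i (invmx g)) | i < n]).

Lemma poly_actX g i : poly_act g 'X_i = lin_poly (row i (invmx g)).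
Proof. by rewrite /poly_act comp_mpolyXU -tnth_nth tnth_mktuple. Qed.

Lemma poly_act_lin g x : poly_act g (lin_poly x) = lin_poly (x *m invmx g).
Proof.
rewrite {1}/lin_poly raddf_sum /= /lin_poly.
under eq_bigr do rewrite linearZ /= poly_actX /lin_poly scaler_sumr.
rewrite exchange_big /=; apply: eq_bigr => j _; rewrite mxE scaler_suml.
by apply: eq_bigr => i _; rewrite mxE scalerA.
Qed.

Lemma poly_actC g c : poly_act g c%:MP = c%:MP.
Proof. exact: comp_mpolyC. Qed.

Lemma poly_act1 f : poly_act 1%:M f = f.
Proof.
apply: (eq_mpoly_morph (psi := idfun)) => [c|]; first exact: poly_actC.
move=> i /=.
by rewrite poly_actX invmx1 -[RHS]lin_poly_delta rowE mulmx1.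
Qed.

Lemma mulmx1_invmx (A B : 'M[K]_n) : A *m B = 1%:M -> invmx A = B.
Proof.
move=> AB; have [Au _] := mulmx1_unit AB.
by rewrite -[invmx A]mulmx1 -AB mulmxA mulVmx // mul1mx.
Qed.

Lemma invmxM g h : g \in unitmx -> h \in unitmx ->
  invmx (g *m h) = invmx h *m invmx g.
Proof.
move=> gu hu; apply: mulmx1_invmx.
by rewrite mulmxA -(mulmxA g) mulmxV // mulmx1 mulmxV.
Qed.

(** A left action: inversion and substitution each reverse the order of the product. *)
Lemma poly_actM g h f : g \in unitmx -> h \in unitmx ->
  poly_act (g *m h) f = poly_act g (poly_act h f).
Proof.
move=> gu hu.
apply: (eq_mpoly_morph (psi := poly_act g \o poly_act h)) => [c|i] /=; first by rewrite !poly_actC.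
by rewrite !poly_actX poly_act_lin invmxM // -row_mul.
Qed.

End PolynomialAction.

(** * Weighted permutations and the groups G(m,r,n) *)

Section MonomialMatrices.
Variables (K : fieldType) (n : nat).
Implicit Types (s t : 'S_n) (u v : 'I_n -> K) (g h : 'M[K]_n).

(** The permutation is read along rows, so that matrix products follow the left-to-right product of
    ['S_n]. *)
Definition mono_mx s u : 'M[K]_n := \matrix_(a, b) (if b == s a then u a else 0).

Lemma eq_mono_mx s u v : u =1 v -> mono_mx s u = mono_mx s v.
Proof. by move=> uv; apply/matrixP=> a b; rewrite !mxE uv. Qed.

Lemma mono_mxM s t u v :
  mono_mx s u *m mono_mx t v = mono_mx (s * t)%g (fun a => u a * v (s a)).
Proof.
apply/matrixP=> a b; rewrite !mxE (bigD1 (s a)) //= !mxE eqxx permM.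
rewrite big1 ?addr0; last by move=> c ca; rewrite !mxE (negPf ca) mul0r.
by case: ifP => // _; rewrite mulr0.
Qed.

Lemma mono_mx1 : mono_mx 1 (fun=> 1) = 1%:M.
Proof. by apply/matrixP=> a b; rewrite !mxE perm1 eq_sym; case: eqP. Qed.

Lemma mono_mxV s u : (forall a, u a != 0) ->
  mono_mx s u *m mono_mx s^-1 (fun a => (u ((s^-1)%g a))^-1) = 1%:M.
Proof.
move=> u0; rewrite mono_mxM mulgV -mono_mx1; apply: eq_mono_mx => a.
by rewrite permK divff.
Qed.

Lemma s_mxE (i j : 'I_n) (w : K) : i != j ->
  s_mx i j w =
  mono_mx (tperm i j) (fun a => if a == i then w else if a == j then w^-1 else 1).
Proof.
move=> ij; apply/matrixP=> a b; rewrite !mxE.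
case: tpermP => [->|->|/eqP/negPf ai /eqP/negPf aj].
- by rewrite eqxx; case: eqP; rewrite ?mulr1 ?mulr0.
- by rewrite eqxx eq_sym (negPf ij); case: eqP; rewrite ?mulr1 ?mulr0.
- by rewrite ai aj eq_sym; case: eqP.
Qed.

Lemma t_mxE (i : 'I_n) (w : K) :
  t_mx i w = mono_mx 1 (fun a => if a == i then w^-1 else 1).
Proof.
apply/matrixP=> a b; rewrite !mxE perm1 [b == a]eq_sym.
by case: (a =P b) => [->|_]; rewrite ?mulr1n ?mulr0n.
Qed.

Lemma s_mx_inv (i j : 'I_n) (w : K) : i != j -> w != 0 ->
  invmx (s_mx i j w) = s_mx i j w.
Proof. by move=> ij w0; apply: mulmx1_invmx; apply: s_mxK. Qed.

(** Frees the reflections from the convention i < j: each one occurs for both orders of the pair,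
    with inverse weights. *)
Lemma s_mx_swap (i j : 'I_n) (w : K) : i != j -> s_mx j i w^-1 = s_mx i j w.
Proof.
move=> ij; rewrite s_mxE 1?eq_sym // s_mxE // tpermC; apply: eq_mono_mx => a.
by rewrite invrK; case: eqP => // ->; rewrite eq_sym (negPf ij).
Qed.

Lemma t_mx_inv (i : 'I_n) (w : K) : w != 0 -> invmx (t_mx i w) = t_mx i w^-1.
Proof.
move=> w0; apply: mulmx1_invmx; rewrite !t_mxE mono_mxM mulg1 -mono_mx1.
apply: eq_mono_mx => a; rewrite perm1.
by case: ifP; rewrite ?mulr1 // invrK mulVf.
Qed.

Section Gmrn.
Variables (m r : nat).
Hypothesis m0 : (0 < m)%N.

Lemma root1_neq0 (w : K) : w ^+ m = 1 -> w != 0.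
Proof.
by move=> wm; apply: contraNneq (oner_neq0 K) => w0; rewrite -wm w0 expr0n eqn0Ngt m0.
Qed.

(** Normal form that turns group computations into computations with a permutation and weights. As m
    > 0, every weight is nonzero, which the uniqueness clauses of [Gmrn] require. *)
Lemma GmrnP g : Gmrn m r g <->
  exists s u, [/\ g = mono_mx s u, forall a, u a ^+ m = 1
                & (\prod_a u a) ^+ (m %/ r) = 1].
Proof.
split.
  case=> rowP colP gm gq.
  have /all_tag[s0 s0P] : forall i, {j | g i j != 0 /\ forall k, g i k != 0 -> k = j}.
    move=> i; apply: cid; have [j [gij u]] := rowP i.
    by exists j; split=> // k /u.
  have s0_inj : injective s0.
    move=> a b ab; have [i [gi u]] := colP (s0 a).
    by rewrite -(u a (s0P a).1) -(u b) // ab (s0P b).1.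
  exists (perm s0_inj), (fun a => g a (s0 a)); split.
  - apply/matrixP=> a b; rewrite mxE permE; case: eqP => [->//|ba].
    by apply/eqP/negPn/negP => /(s0P a).2 /ba.
  - by move=> a; apply/gm/(s0P a).1.
  - move: gq; rewrite -(pair_big_dep xpredT (fun i j => g i j != 0) (fun i j => g i j)).
    rewrite (_ : \prod_i _ = \prod_a g a (s0 a)) //; apply: eq_bigr => i _.
    rewrite (big_pred1 (s0 i)) // => k /=.
    by apply/idP/eqP => [/(s0P i).2|->] //; apply: (s0P i).1.
case=> s [u [-> um uq]].
have u0 a := root1_neq0 (um a).
have E a b : (mono_mx s u a b != 0) = (b == s a).
  by rewrite mxE; case: ifP; rewrite ?u0 ?eqxx.
split.
- by move=> i; exists (s i); split=> [|k] /=; rewrite E ?eqxx // => /eqP->.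
- move=> j; exists ((s^-1)%g j); split=> [|k] /=; rewrite E ?permKV ?eqxx //.
  by move=> /eqP->; rewrite permK.
- by move=> i j; rewrite E => /eqP->; rewrite mxE eqxx.
- rewrite -(pair_big_dep xpredT (fun i j => mono_mx s u i j != 0) (fun i j => mono_mx s u i j)).
  rewrite -[RHS]uq; congr (_ ^+ _); apply: eq_bigr => i _.
  by rewrite (big_pred1 (s i)) => [|k /=]; [rewrite mxE eqxx | rewrite E].
Qed.

Lemma Gmrn1 : Gmrn m r (1%:M : 'M[K]_n).
Proof.
apply/GmrnP; exists 1%g, (fun=> 1); rewrite mono_mx1.
by split=> // [a|]; rewrite ?big1 ?expr1n.
Qed.

Lemma GmrnM g h : Gmrn m r g -> Gmrn m r h -> Gmrn m r (g *m h).
Proof.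
move=> /GmrnP[s [u [-> um uq]]] /GmrnP[t [v [-> vm vq]]]; apply/GmrnP.
exists (s * t)%g, (fun a => u a * v (s a)); split.
- exact: mono_mxM.
- by move=> a; rewrite exprMn um vm mulr1.
- by rewrite big_split exprMn uq mul1r -[RHS]vq [in RHS](reindex_inj (@perm_inj _ s)).
Qed.

Lemma Gmrn_unit g : Gmrn m r g -> g \in unitmx.
Proof.
case/GmrnP=> s [u [-> um _]]; have u0 a := root1_neq0 (um a).
by have [] := mulmx1_unit (mono_mxV s u0).
Qed.

Lemma GmrnV g : Gmrn m r g -> Gmrn m r (invmx g).
Proof.
move=> /GmrnP[s [u [-> um uq]]]; have u0 a := root1_neq0 (um a).
rewrite (mulmx1_invmx (mono_mxV s u0)); apply/GmrnP.
exists s^-1%g, (fun a => (u ((s^-1)%g a))^-1); split=> // [a|].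
  by rewrite exprVn um invr1.
by rewrite prodfV exprVn -[RHS]invr1 -[in RHS]uq [in RHS](reindex_inj (@perm_inj _ (s^-1)%g)).
Qed.

Lemma s_mx_Gmrn (i j : 'I_n) (w : K) : i != j -> w ^+ m = 1 ->
  Gmrn m r (s_mx i j w).
Proof.
move=> ij wm; have w0 := root1_neq0 wm; apply/GmrnP.
exists (tperm i j), (fun a => if a == i then w else if a == j then w^-1 else 1).
split; first exact: s_mxE.
  by move=> a; do 2?[case: ifP => _]; rewrite ?expr1n ?exprVn ?wm ?invr1.
rewrite (bigD1 i) //= (bigD1 j) 1?eq_sym //= eqxx eqxx [j == i]eq_sym (negPf ij).
rewrite big1 ?mulr1 ?divff ?expr1n // => a /andP[/negPf-> /negPf->] //.
Qed.

Lemma t_mx_Gmrn (i : 'I_n) (w : K) : (r %| m)%N -> w ^+ (m %/ r) = 1 ->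
  Gmrn m r (t_mx i w).
Proof.
move=> rm wq; apply/GmrnP; exists 1%g, (fun a => if a == i then w^-1 else 1).
split; first exact: t_mxE.
  move=> a; case: ifP; rewrite ?expr1n // exprVn => _.
  by rewrite -(divnK rm) exprM wq expr1n invr1.
rewrite (bigD1 i) //= eqxx big1 ?mulr1 ?exprVn ?wq ?invr1 //.
by move=> a /negPf->.
Qed.

End Gmrn.

Lemma pow_entries_mono q s u : (0 < q)%N ->
  pow_entries q (mono_mx s u) = mono_mx s (fun a => u a ^+ q).
Proof.
move=> q0; apply/matrixP=> a b; rewrite !mxE; case: ifP => // _.
by rewrite expr0n eqn0Ngt q0.
Qed.

Lemma pow_entriesM m r q g h : (0 < m)%N -> (0 < q)%N ->
  Gmrn m r g -> Gmrn m r h ->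
  pow_entries q (g *m h) = pow_entries q g *m pow_entries q h.
Proof.
move=> m0 q0 /(GmrnP r m0)[s [u [-> _ _]]] /(GmrnP r m0)[t [v [-> _ _]]].
rewrite mono_mxM !pow_entries_mono // mono_mxM.
by apply: eq_mono_mx => a; rewrite exprMn.
Qed.

Lemma pow_entries_s q (i j : 'I_n) (w : K) : (0 < q)%N -> i != j ->
  pow_entries q (s_mx i j w) = s_mx i j (w ^+ q).
Proof.
move=> q0 ij; rewrite !s_mxE // pow_entries_mono //; apply: eq_mono_mx => a.
by do 2?[case: ifP => _]; rewrite ?exprVn ?expr1n.
Qed.

Lemma pow_entries_t q (i : 'I_n) (w : K) : (0 < q)%N -> w ^+ q = 1 ->
  pow_entries q (t_mx i w) = 1%:M.
Proof.
move=> q0 wq; rewrite t_mxE pow_entries_mono // -mono_mx1.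
by apply: eq_mono_mx => a; case: ifP; rewrite ?exprVn ?wq ?invr1 ?expr1n.
Qed.

Lemma pow_entries_Gmrn m r g : (0 < m)%N -> (0 < r)%N -> (r %| m)%N ->
  Gmrn m r g -> Gmrn r r (pow_entries (m %/ r) g).
Proof.
move=> m0 r0 rm /(GmrnP r m0)[s [u [-> um uq]]].
have q0 : (0 < m %/ r)%N by rewrite divn_gt0 // dvdn_leq.
rewrite pow_entries_mono //; apply/(GmrnP r r0).
exists s, (fun a => u a ^+ (m %/ r)); split=> // [a|].
  by rewrite -exprM divnK.
by rewrite divnn r0 expr1 prodrXl.
Qed.

Lemma prim_root_divn m r (xi : K) : (r %| m)%N -> m.-primitive_root xi ->
  r.-primitive_root (xi ^+ (m %/ r)).
Proof.
move=> rm xiP; have := exp_prim_root xiP (m %/ r).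
have /gcdn_idPl-> : (m %/ r %| m)%N by rewrite dvdn_div.
by rewrite divnA // mulKn // (prim_order_gt0 xiP).
Qed.

(** An entry (xi^q)^k is lifted to xi^k. The qth power of the product of the lifts is the product of
    the entries of g, which is 1, and this is the condition for membership in G(m,r,n). *)
Lemma pow_entries_onto m r (xi : K) g : (0 < m)%N -> (0 < r)%N -> (r %| m)%N ->
  m.-primitive_root xi -> Gmrn r r g ->
  exists2 h, Gmrn m r h & pow_entries (m %/ r) h = g.
Proof.
move=> m0 r0 rm xiP /(GmrnP r r0)[s [u [-> ur]]].
have q0 : (0 < m %/ r)%N by rewrite divn_gt0 // dvdn_leq.
have xiq := prim_root_divn rm xiP.
have /all_tag[e eP] a : {k : 'I_r | u a = xi ^+ (m %/ r) ^+ k}.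
  by have [k ->] := prim_rootP xiq (ur a); exists k.
rewrite divnn r0 expr1 => uq.
exists (mono_mx s (fun a => xi ^+ e a)).
  apply/(GmrnP r m0); exists s, (fun a => xi ^+ e a); split=> // [a|].
    by rewrite -exprM mulnC exprM (prim_expr_order xiP) expr1n.
  by rewrite -prodrXl -[RHS]uq; apply: eq_bigr => a _; rewrite eP -!exprM mulnC.
rewrite pow_entries_mono //; apply: eq_mono_mx => a.
by rewrite eP -!exprM mulnC.
Qed.

End MonomialMatrices.

(** * Calculus of functions with a proof of linearity *)

Section LinearPredicate.
Variables (R : pzRingType) (U V : lmodType R) (f : U -> V).
Hypothesis fL : linear f.

Lemma lin_fun0 : f 0 = 0.
Proof. by have := fL (-1) 0 0; rewrite !scaleN1r oppr0 !addNr addr0. Qed.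

Lemma lin_funD u v : f (u + v) = f u + f v.
Proof. by rewrite -[u]scale1r fL !scale1r. Qed.

Lemma lin_funZ c u : f (c *: u) = c *: f u.
Proof. by rewrite -[c *: u]addr0 fL lin_fun0 addr0. Qed.

Lemma lin_funN u : f (- u) = - f u.
Proof. by rewrite -!scaleN1r lin_funZ. Qed.

Lemma lin_funB u v : f (u - v) = f u - f v.
Proof. by rewrite lin_funD lin_funN. Qed.

Lemma lin_fun_sum I (s : seq I) (P : pred I) F :
  f (\sum_(i <- s | P i) F i) = \sum_(i <- s | P i) f (F i).
Proof. exact: (big_morph f lin_funD lin_fun0). Qed.

End LinearPredicate.

Section LinearOperations.
Variables (R : comPzRingType) (U V : lmodType R).

Lemma linear_scalef (c : R) (f : U -> V) : linear f -> linear (fun u => c *: f u).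
Proof. by move=> fL b u v; rewrite fL scalerDr !scalerA mulrC. Qed.

Lemma linear_subf (f g : U -> V) : linear f -> linear g -> linear (fun u => f u - g u).
Proof. by move=> fL gL b u v; rewrite fL gL scalerBr opprD addrACA. Qed.

Lemma linear_sumf (I : finType) (P : pred I) (f : I -> U -> V) :
  (forall i, linear (f i)) -> linear (fun u => \sum_(i | P i) f i u).
Proof.
move=> fL b u v; rewrite scaler_sumr -big_split; apply: eq_bigr => i _.
exact: fL.
Qed.

End LinearOperations.


(** * Divided differences and Dunkl operators *)

Section DividedDifference.
Variables (K : fieldType) (n : nat).

Definition divdiff (g : 'M[K]_n) (a : 'rV[K]_n) (f : {mpoly K[n]}) : {mpoly K[n]} :=
  exact_quo (f - poly_act g f) (lin_poly a).

(** Says that g is the identity or a reflection with root a. The coefficient stays existential,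
    because the normalisation of the coroot matters only in the commutation relation. *)
Definition moves_along (g : 'M[K]_n) (a : 'rV[K]_n) : Prop :=
  a != 0 /\ forall x, exists b, x - x *m invmx g = b *: a.

Variables (g : 'M[K]_n) (a : 'rV[K]_n).
Hypothesis ga : moves_along g a.

Lemma divdiffE f : divdiff g a f * lin_poly a = f - poly_act g f.
Proof. by apply: dunkl_exact; case: ga. Qed.

(** Polynomials form a domain, so identities between divided differences can be checked after
    multiplication by the root. *)
Lemma divdiff_uniq f h : h * lin_poly a = f - poly_act g f -> divdiff g a f = h.
Proof.
rewrite -divdiffE => E; have [a0 _] := ga.
by apply: (@mulIf _ (lin_poly a)) => //; rewrite lin_poly_eq0.
Qed.

Lemma divdiff_linear : linear (divdiff g a).
Proof.
move=> c f1 f2; apply: divdiff_uniq.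
by rewrite mulrDl -scalerAl !divdiffE linearP scalerBr addrACA -opprD.
Qed.

Lemma divdiffMr f1 f2 :
  divdiff g a (f1 * f2) = divdiff g a f1 * poly_act g f2 + f1 * divdiff g a f2.
Proof.
apply: divdiff_uniq; rewrite mulrDl mulrAC divdiffE -mulrA divdiffE rmorphM /=.
by rewrite mulrBl mulrBr addrC addrA subrK.
Qed.

Lemma divdiff_fixed f : poly_act g f = f -> divdiff g a f = 0.
Proof. by move=> gf; apply: divdiff_uniq; rewrite gf subrr mul0r. Qed.

Lemma divdiff_fixedM f1 f2 : poly_act g f1 = f1 ->
  divdiff g a (f1 * f2) = f1 * divdiff g a f2.
Proof. by move=> gf; rewrite divdiffMr divdiff_fixed // mul0r add0r. Qed.

Lemma divdiff_lin x b : x - x *m invmx g = b *: a ->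
  divdiff g a (lin_poly x) = b%:MP.
Proof.
move=> E; apply: divdiff_uniq.
by rewrite poly_act_lin -lin_polyB E lin_polyZ mul_mpolyC.
Qed.

End DividedDifference.

(** Conjugation carries a root only to a multiple of the chosen root of the conjugate reflection; c
    corrects the normalisation. *)
Lemma divdiff_conj (K : fieldType) n (g h h' : 'M[K]_n) a a' c f :
  g \in unitmx -> h \in unitmx -> h' \in unitmx ->
  moves_along h a -> moves_along h' a' ->
  g *m h = h' *m g -> c *: (a *m invmx g) = a' -> 
  poly_act g (divdiff h a f) = c *: divdiff h' a' (poly_act g f).
Proof.
move=> gu hu h'u ha h'a' gh caa.
have c0 : c != 0.
  by apply: contraNneq h'a'.1 => c0; rewrite -caa c0 scale0r.
rewrite (divdiff_uniq h'a' (h := c^-1 *: poly_act g (divdiff h a f))).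
  by rewrite scalerA divff // scale1r.
rewrite -caa lin_polyZ -poly_act_lin -scalerAr -scalerAl scalerA divff // scale1r.
rewrite -(rmorphM (poly_act g)) /= (divdiffE ha) (rmorphB (poly_act g)) /=.
by rewrite -(poly_actM _ gu hu) gh poly_actM.
Qed.

(** * Operators phi (x) M on A (x) tau *)

Section Tensor.
Variables (K : fieldType) (n d : nat).
Local Notation A := {mpoly K[n]}.
Local Notation V := (verma K n d).
Implicit Types (phi psi : A -> A) (M N : 'M[K]_d) (v w : V) (a : A).

(** [verma_tensor] is the case M = rho g. With a free matrix, compositions are computed before it is
    known which group element acts. *)
Definition tens phi M v : V := [ffun i => \sum_j M i j *: phi (v j)].

Lemma tens_linear phi M : linear phi -> linear (tens phi M).
Proof.
move=> phiL c v w; apply/ffunP=> i; rewrite !ffunE scaler_sumr -big_split /=.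
apply: eq_bigr => j _; rewrite !ffunE phiL scalerDr !scalerA.
by rewrite [c * _]mulrC.
Qed.

Lemma eq_tens phi psi M v : phi =1 psi -> tens phi M v = tens psi M v.
Proof. by move=> E; apply/ffunP=> i; rewrite !ffunE; apply: eq_bigr => j _; rewrite E. Qed.

Lemma tens_comp phi psi M N v : linear phi ->
  tens phi M (tens psi N v) = tens (phi \o psi) (M *m N) v.
Proof.
move=> phiL; apply/ffunP=> i; rewrite !ffunE.
under eq_bigr do rewrite ffunE (lin_fun_sum phiL) scaler_sumr.
rewrite exchange_big /=; apply: eq_bigr => j _; rewrite mxE scaler_suml.
by apply: eq_bigr => k _; rewrite (lin_funZ phiL) scalerA.
Qed.

Lemma tens1 phi v : phi =1 id -> tens phi 1%:M v = v.
Proof.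
move=> E; apply/ffunP=> i; rewrite !ffunE (bigD1 i) //= mxE eqxx scale1r E.
by rewrite big1 ?addr0 // => j ji; rewrite mxE eq_sym (negPf ji) scale0r.
Qed.

Lemma tensZl c phi M v : tens (fun f => c *: phi f) M v = c *: tens phi M v.
Proof.
apply/ffunP=> i; rewrite !ffunE scaler_sumr; apply: eq_bigr => j _.
by rewrite !scalerA mulrC.
Qed.

Lemma tensDl phi psi M v :
  tens (fun f => phi f + psi f) M v = tens phi M v + tens psi M v.
Proof.
apply/ffunP=> i; rewrite !ffunE -big_split; apply: eq_bigr => j _.
by rewrite scalerDr.
Qed.

Lemma tens_suml (I : finType) (P : pred I) (phi : I -> A -> A) M v :
  tens (fun f => \sum_(k | P k) phi k f) M v = \sum_(k | P k) tens (phi k) M v.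
Proof.
apply/ffunP=> i; rewrite sum_ffunE !ffunE.
under eq_bigr do rewrite scaler_sumr.
by rewrite exchange_big; apply: eq_bigr => k _; rewrite ffunE.
Qed.

Lemma tens_mull a phi M v : tens (fun f => a * phi f) M v = verma_mul a (tens phi M v).
Proof.
apply/ffunP=> i; rewrite !ffunE mulr_sumr; apply: eq_bigr => j _.
by rewrite scalerAr.
Qed.

Lemma tens_mulr a phi M v :
  tens (fun f => phi (a * f)) M v = tens phi M (verma_mul a v).
Proof. by apply/ffunP=> i; rewrite !ffunE; apply: eq_bigr => j _; rewrite ffunE. Qed.

Lemma verma_mul_linear a : linear (verma_mul a : V -> V).
Proof. by move=> c v w; apply/ffunP=> i; rewrite !ffunE mulrDr scalerAr. Qed.

Lemma verma_mulA a b v : verma_mul a (verma_mul b v) = verma_mul (a * b) v.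
Proof. by apply/ffunP=> i; rewrite !ffunE mulrA. Qed.

Lemma verma_mul1 v : verma_mul 1 v = v.
Proof. by apply/ffunP=> i; rewrite !ffunE mul1r. Qed.

Lemma verma_mulDl a b v : verma_mul (a + b) v = verma_mul a v + verma_mul b v.
Proof. by apply/ffunP=> i; rewrite !ffunE mulrDl. Qed.

Lemma verma_mulZl c a v : verma_mul (c *: a) v = c *: verma_mul a v.
Proof. by apply/ffunP=> i; rewrite !ffunE -scalerAl. Qed.

Lemma verma_mulXI i : injective (verma_mul 'X_i : V -> V).
Proof.
move=> v w /ffunP E; apply/ffunP=> j; have := E j; rewrite !ffunE; apply: mulfI.
by rewrite -lin_poly_delta lin_poly_eq0; apply/eqP => /rowP/(_ i);
  rewrite !mxE !eqxx => /eqP; rewrite oner_eq0.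
Qed.

(* The element 1 (x) w of A (x) tau. *)
Definition vconst (e : 'cV[K]_d) : V := [ffun j => (e j 0)%:MP].

Lemma vconst_linear : linear vconst.
Proof. by move=> c v w; apply/ffunP=> j; rewrite !ffunE !mxE mpolyCD mpolyCM mul_mpolyC. Qed.

Lemma tens_vconst phi M (e : 'cV[K]_d) : (forall c, phi c%:MP = c%:MP) ->
  tens phi M (vconst e) = vconst (M *m e).
Proof.
move=> E; apply/ffunP=> i; rewrite !ffunE mxE raddf_sum; apply: eq_bigr => j _.
by rewrite ffunE E /= mpolyCM mul_mpolyC.
Qed.

(** The induction for operators that are controlled by their values on constants and their
    commutators with the x_i. *)
Lemma verma_ind (P : V -> Prop) :
  (forall e, P (vconst e)) -> (forall v w, P v -> P w -> P (v + w)) ->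
  (forall i v, P v -> P (verma_mul 'X_i v)) -> forall v, P v.
Proof.
move=> Pc PD PX v.
have P0 : P 0 by rewrite -(lin_fun0 vconst_linear).
have Pf f : forall e, P (verma_mul f (vconst e)).
  elim/mpoly_mulX_ind: f => [|c f g Pf Pg|i f Pf] e.
  - by rewrite verma_mul1.
  - rewrite verma_mulDl verma_mulZl -(lin_funZ (verma_mul_linear f)).
    by rewrite -(lin_funZ vconst_linear); apply: PD.
  - by rewrite -verma_mulA; apply: PX.
suff -> : v = \sum_j verma_mul (v j) (vconst (delta_mx j 0)).
  by elim/big_ind: _.
apply/ffunP=> k; rewrite sum_ffunE (bigD1 k) //= !ffunE mxE !eqxx mulr1.
rewrite big1 ?addr0 // => j jk.
by rewrite !ffunE mxE eq_sym (negPf jk) mpolyC0 mulr0.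
Qed.

End Tensor.

Section PeriodicSums.
Variables (V : nmodType) (m : nat) (F : nat -> V).
Hypothesis Fper : forall k, F (k %% m)%N = F k.

Lemma sum_shift_periodic e : \sum_(k < m) F (k + e)%N = \sum_(k < m) F k.
Proof.
case: m Fper => [|m'] Fp; first by rewrite !big_ord0.
elim: e => [|e IH]; first by apply: eq_bigr => k _; rewrite addn0.
rewrite -IH big_ord_recr big_ord_recl /= addrC; congr (_ + _).
  by rewrite add0n -Fp -addSnnS modnDl Fp.
by apply: eq_bigr => k _; rewrite addnS.
Qed.

Lemma sum_opp_periodic : \sum_(k < m) F (m - k)%N = \sum_(k < m) F k.
Proof.
rewrite -(sum_shift_periodic 1) (reindex_inj rev_ord_inj) /=.
by apply: eq_bigr => k _; rewrite addn1 subKn.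
Qed.

End PeriodicSums.

(** Collects the exponents k into classes modulo r; the s_ij^k of one class have the same image in
    G'. *)
Lemma sum_mod_split (V : nmodType) (F : nat -> V) r q :
  \sum_(k < r * q) F k = \sum_(k < r) \sum_(l < q) F (k + r * l)%N.
Proof.
rewrite exchange_big /=; elim: q => [|q IH].
  by rewrite [RHS]big_ord0; case: (r * 0)%N (muln0 r) => // _; rewrite big_ord0.
rewrite big_ord_recr -IH /= -!(big_mkord xpredT F) mulnS addnC.
rewrite (big_cat_nat _ (n := (r * q)%N)) ?leq_addr //=; congr (_ + _).
rewrite -{1}[(r * q)%N]add0n big_addn addKn big_mkord.
by apply: eq_bigr.
Qed.

Section Reflections.
Variables (K : fieldType) (n : nat).
Implicit Types (i j : 'I_n) (w : K).

Definition s_root i j w : 'rV[K]_n := delta_mx 0 i - w *: delta_mx 0 j.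

Lemma delta_rV_neq0 i : (delta_mx 0 i : 'rV[K]_n) != 0.
Proof.
by apply/eqP => /rowP/(_ i); rewrite !mxE !eqxx => /eqP; rewrite oner_eq0.
Qed.

Lemma s_root_neq0 i j w : i != j -> s_root i j w != 0.
Proof.
move=> ij; apply/eqP => /rowP/(_ i).
by rewrite !mxE !eqxx (negPf ij) mulr0 subr0 => /eqP; rewrite oner_eq0.
Qed.

Lemma s_root_mul i j w (y : 'cV[K]_n) : (s_root i j w *m y) 0 0 = y i 0 - w * y j 0.
Proof. by rewrite mulmxBl -scalemxAl -!rowE !mxE. Qed.

Lemma s_root_swap i j w : w != 0 -> s_root j i w^-1 = - w^-1 *: s_root i j w.
Proof.
by move=> w0; rewrite scalerBr !scaleNr opprK scalerA mulVf // scale1r addrC.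
Qed.

Lemma s_moves i j w : i != j -> w != 0 -> moves_along (s_mx i j w) (s_root i j w).
Proof.
move=> ij w0; split; first exact: s_root_neq0.
(* [refl_rootP] asks of xi only that it be nonzero, so u itself serves as xi, with exponent 1 and
   the auxiliary values m = 2, r = 1. *)
have H (a b : 'I_n) u x : (a < b)%N -> u != 0 ->
    exists c, x - x *m invmx (s_mx a b u) = c *: s_root a b u.
  move=> ab u0; exists ((x *m refl_coroot u (inl (a, b, @Ordinal 2 1 isT) : refl_index 2 1 n)) 0 0).
  exact: (@refl_rootP _ 2 1 n u (inl (a, b, @Ordinal 2 1 isT))).
move=> x; case: (ltngtP i j) => [|ji|/val_inj/eqP]; first 1 last.
- have wV0 : w^-1 != 0 by rewrite invr_eq0.
  have [c E] := H j i w^-1 x ji wV0; exists (c * - w^-1).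
  by rewrite -s_mx_swap // E s_root_swap // scalerA.
- by rewrite (negPf ij).
- by move=> lt_ij; apply: H.
Qed.

Lemma t_moves i w : w != 0 -> moves_along (t_mx i w) (delta_mx 0 i : 'rV[K]_n).
Proof.
move=> w0; split; first exact: delta_rV_neq0.
move=> x; rewrite t_mx_inv //; exists ((1 - w) * x 0 i).
apply/rowP=> b; rewrite mul_mx_diag !mxE eqxx /= invrK.
case: (eqVneq b i) => [->|_]; first by rewrite mulr1 mulrBl mul1r mulrC.
by rewrite mulr1 mulr0 subrr.
Qed.

Lemma s_act i j w l : i != j -> w != 0 ->
  poly_act (s_mx i j w) 'X_l =
  if l == i then w *: 'X_j else if l == j then w^-1 *: 'X_i else 'X_l.
Proof.
move=> ij w0; rewrite poly_actX s_mx_inv //.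
have -> : row l (s_mx i j w) =
    if l == i then w *: delta_mx 0 j
    else if l == j then w^-1 *: delta_mx 0 i else delta_mx 0 l.
  apply/rowP=> b; rewrite !mxE; do 2?[case: ifP => _]; rewrite !mxE ?eqxx //.
  by rewrite eq_sym.
by do 2?[case: ifP => _]; rewrite ?lin_polyZ !lin_poly_delta.
Qed.

Lemma t_act i w l : w != 0 ->
  poly_act (t_mx i w) 'X_l = if l == i then w *: 'X_l else 'X_l.
Proof.
move=> w0; rewrite poly_actX t_mx_inv //.
have -> : row l (t_mx i w^-1) = (if l == i then w else 1) *: delta_mx 0 l.
  apply/rowP=> b; rewrite !mxE invrK eq_sym.
  by case: (eqVneq b l) => _; rewrite ?mulr1n ?mulr0n ?mulr1 ?mulr0.
by rewrite lin_polyZ lin_poly_delta; case: ifP; rewrite ?scale1r.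
Qed.

End Reflections.

(** * Dunkl operators of the basis vectors y_i *)

Section Dunkl.
Variables (K : fieldType) (m r n : nat) (xi : K) (c0 ct : nat -> K) (d : nat).
Variable rho : 'M[K]_n -> 'M[K]_d.
Hypotheses (m0 : (0 < m)%N) (rm : (r %| m)%N) (xiP : m.-primitive_root xi).

Local Notation V := (verma K n d).
Local Notation G := (Gmrn (K := K) (n := n) m r).
Local Notation rmx := (refl_mx (m := m) (r := r) (n := n) xi).
Local Notation rt := (refl_root (m := m) (r := r) (n := n) xi).
Local Notation crt := (refl_coroot (m := m) (r := r) (n := n) xi).
Local Notation cpar := (refl_param (m := m) (r := r) (n := n) c0 ct).
Local Notation cl := (s_classes r n).
Local Notation dunkl := (@dunkl K m r n xi c0 ct d rho).

Definition s_op (i j : 'I_n) (w : K) : V -> V :=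
  tens (divdiff (s_mx i j w) (s_root i j w)) (rho (s_mx i j w)).

Definition t_op (i : 'I_n) (w : K) : V -> V :=
  tens (divdiff (t_mx i w) (delta_mx 0 i)) (rho (t_mx i w)).

(** The operator D_i of y_i. Each s_ij^k is written with i as first index, which makes (y_i,
    alpha_s) equal to 1 and removes the condition i < j. *)
Definition dunkl_i (i : 'I_n) (v : V) : V :=
  - (\sum_(j | j != i) \sum_(k < m) c0 (k %% cl)%N *: s_op i j (xi ^+ k) v +
     \sum_(k < m %/ r | (0 < k)%N) ct k *: t_op i (xi ^+ (r * k)) v).

Let xi0 : xi != 0.
Proof. by apply: (root1_neq0 m0); rewrite (prim_expr_order xiP). Qed.

Let xiX0 k : xi ^+ k != 0.
Proof. exact: expf_neq0. Qed.

(** Makes the parameter of s_ij^k depend on k modulo m only. For n <= 1 the number [s_classes] is 0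
    and does not divide m, but then there is no pair i != j. *)
Lemma s_classes_dvd : (1 < n)%N -> (cl %| m)%N.
Proof.
rewrite /s_classes => n1; rewrite leqNgt n1 /=.
by case: ifP => // /andP[_]; rewrite -dvdn2 => /dvdn_trans; apply.
Qed.

Lemma ord_neq_gt1 (i j : 'I_n) : i != j -> (1 < n)%N.
Proof.
move=> ij; rewrite ltnNge; apply: contra ij => n1; apply/eqP/val_inj => /=.
by have := ltn_ord i; have := ltn_ord j; case: n n1 {i j} (i : nat) (j : nat)
  => [|[]] // _ [|?] [|?].
Qed.

Lemma c0_periodic (i j : 'I_n) k : i != j -> c0 ((k %% m) %% cl)%N = c0 (k %% cl)%N.
Proof. by move=> ij; rewrite modn_dvdm // s_classes_dvd // (ord_neq_gt1 ij). Qed.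

Lemma s_op_swap i j w v : i != j -> w != 0 -> s_op j i w^-1 v = - w *: s_op i j w v.
Proof.
move=> ij w0; rewrite /s_op s_mx_swap // -tensZl; apply: eq_tens => f.
have ji : j != i by rewrite eq_sym.
have wV0 : w^-1 != 0 by rewrite invr_eq0.
apply: divdiff_uniq.
  by rewrite -s_mx_swap //; apply: s_moves.
rewrite s_root_swap // lin_polyZ -scalerAr -scalerAl scalerA mulrNN mulVf //.
by rewrite scale1r divdiffE //; apply: s_moves.
Qed.

(** k and -k have the same parity when m is even, so the passage from (i, j, xi^k) to (j, i, xi^-k)
    keeps the parameter. *)
Lemma modn_s_classesB k : (1 < n)%N -> (k <= m)%N -> (m - k = k %[mod cl])%N.
Proof.
move=> n1 km; move: (s_classes_dvd n1); rewrite /s_classes leqNgt n1 /=.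
case: ifP => _; last by rewrite !modn1.
by rewrite dvdn2 !modn2 => /negPf em; rewrite oddB // em.
Qed.

Lemma sum_s_op_swap i j v : i != j ->
  \sum_(k < m) c0 (k %% cl)%N *: s_op j i (xi ^+ k) v =
  - \sum_(k < m) (c0 (k %% cl)%N * xi ^+ k) *: s_op i j (xi ^+ k) v.
Proof.
move=> ij; pose F k := c0 (k %% cl)%N *: s_op j i (xi ^+ k) v.
have Fper k : F (k %% m)%N = F k.
  by rewrite /F (c0_periodic _ ij) (prim_expr_mod xiP).
apply: etrans (esym (sum_opp_periodic Fper)) _; rewrite /F {F Fper}.
rewrite -sumrN; apply: eq_bigr => k _.
rewrite modn_s_classesB ?(ord_neq_gt1 ij) // 1?ltnW //.
have -> : xi ^+ (m - k) = (xi ^+ k)^-1.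
  by rewrite expfB // (prim_expr_order xiP) div1r.
by rewrite s_op_swap // scalerA mulrN scaleNr.
Qed.

(** A reflection s_ij^k with i < j occurs in D_i and in D_j. Once the indices are swapped in the
    latter, the two coefficients combine to y_i - xi^k y_j = (y, alpha_s). *)
Lemma dunkl_basis y v : dunkl y v = \sum_i y i 0 *: dunkl_i i v.
Proof.
rewrite /Defs.dunkl big_sumType /=.
have dy (i : 'I_n) : ((delta_mx 0 i : 'rV[K]_n) *m y) 0 0 = y i 0.
  by rewrite -rowE mxE.
under [RHS]eq_bigr do rewrite /dunkl_i scalerN scalerDr.
rewrite sumrN big_split /=; congr (- (_ + _)); last first.
  under [RHS]eq_bigr do rewrite scaler_sumr.
  rewrite (pair_big_dep xpredT (fun (_ : 'I_n) (k : 'I_(m %/ r)) => (0 < k)%N)) /=.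
  apply: eq_big => [[i k]|[i k] _] //=.
  by rewrite dy scalerA mulrC.
have -> : \sum_i y i 0 *: (\sum_(j | j != i) \sum_(k < m)
      c0 (k %% cl)%N *: s_op i j (xi ^+ k) v) =
    \sum_(i : 'I_n) \sum_(j : 'I_n | (i < j)%N) \sum_(k < m)
      (c0 (k %% cl)%N * (y i 0 - xi ^+ k * y j 0)) *: s_op i j (xi ^+ k) v.
  pose S (i j : 'I_n) := y i 0 *: \sum_(k < m) c0 (k %% cl)%N *: s_op i j (xi ^+ k) v.
  transitivity (\sum_(i : 'I_n) (\sum_(j : 'I_n | (i < j)%N) S i j +
      \sum_(j : 'I_n | (j < i)%N) S i j)).
    apply: eq_bigr => i _; rewrite scaler_sumr (bigID (fun j : 'I_n => (i < j)%N)) /=.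
    by congr (_ + _); apply: eq_bigl => j; rewrite -val_eqE /=; case: ltngtP.
  rewrite big_split /= [X in _ + X](exchange_big_dep xpredT) //= -big_split /=.
  apply: eq_bigr => i _; rewrite -big_split /=; apply: eq_bigr => j ij.
  have ij' : i != j by rewrite neq_ltn ij.
  rewrite /S [X in _ + _ *: X](sum_s_op_swap v ij') scalerN !scaler_sumr -sumrB.
  apply: eq_bigr => k _; rewrite !scalerA -scalerBl; congr (_ *: _).
  by rewrite mulrBr [in RHS]mulrA; congr (_ - _); rewrite mulrC.
rewrite (pair_big_dep xpredT (fun i j : 'I_n => (i < j)%N)) /=.
rewrite (pair_big_dep (fun p : 'I_n * 'I_n => (p.1 < p.2)%N) (fun _ _ => true)) /=.
apply: eq_big => [[[i j] k]|[[i j] k] _] //=; first by rewrite andbT.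
by rewrite -[_ - _]/(s_root i j (xi ^+ k)) s_root_mul.
Qed.

End Dunkl.

#[local] Opaque poly_act divdiff.

(** * Equivariance of the Dunkl operators *)

Section Equivariance.
Variables (K : fieldType) (m r n : nat) (xi : K) (c0 ct : nat -> K) (d : nat).
Variable rho : 'M[K]_n -> 'M[K]_d.
Hypotheses (m0 : (0 < m)%N) (rm : (r %| m)%N) (xiP : m.-primitive_root xi).
Hypothesis rhoP : mx_rep (Gmrn (K := K) (n := n) m r) rho.

Local Notation V := (verma K n d).
Local Notation G := (Gmrn (K := K) (n := n) m r).
Local Notation rmx := (refl_mx (m := m) (r := r) (n := n) xi).
Local Notation rt := (refl_root (m := m) (r := r) (n := n) xi).
Local Notation crt := (refl_coroot (m := m) (r := r) (n := n) xi).
Local Notation cpar := (refl_param (m := m) (r := r) (n := n) c0 ct).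
Local Notation cl := (s_classes r n).
Local Notation dunkl := (@dunkl K m r n xi c0 ct d rho).
Local Notation dunkl_i := (@dunkl_i K m r n xi c0 ct d rho).
Local Notation s_op := (s_op (n := n) rho).
Local Notation t_op := (t_op (n := n) rho).

Definition verma_act (g : 'M[K]_n) : V -> V := tens (poly_act g) (rho g).

Lemma poly_act_linear (g : 'M[K]_n) : linear (poly_act g).
Proof. exact: linearP. Qed.

Lemma verma_act_linear g : linear (verma_act g).
Proof. exact/tens_linear/poly_act_linear. Qed.

Lemma rhoM g h : G g -> G h -> rho (g *m h) = rho g *m rho h.
Proof. by case: rhoP => _; apply. Qed.

Lemma rho1 : rho 1%:M = 1%:M.
Proof. by case: rhoP. Qed.

Lemma verma_act1 v : verma_act 1%:M v = v.
Proof. by rewrite /verma_act rho1 tens1 // => f; apply: poly_act1. Qed.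

Lemma verma_actM g h v : G g -> G h ->
  verma_act (g *m h) v = verma_act g (verma_act h v).
Proof.
move=> Gg Gh; rewrite /verma_act tens_comp; last exact: poly_act_linear.
rewrite (rhoM Gg Gh); apply: eq_tens => f /=.
exact: poly_actM (Gmrn_unit m0 Gg) (Gmrn_unit m0 Gh).
Qed.

Lemma verma_act_mul g a v :
  verma_act g (verma_mul a v) = verma_mul (poly_act g a) (verma_act g v).
Proof.
rewrite /verma_act -tens_mulr -tens_mull; apply: eq_tens => f; exact: rmorphM.
Qed.

Lemma verma_act_const g e : verma_act g (vconst n e) = vconst n (rho g *m e).
Proof. by apply: tens_vconst => c; apply: poly_actC. Qed.

Lemma xi_neq0 : xi != 0.
Proof. by apply: (root1_neq0 m0); rewrite (prim_expr_order xiP). Qed.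

Lemma xiX_root k : (xi ^+ k) ^+ m = 1.
Proof. by rewrite -exprM mulnC exprM (prim_expr_order xiP) expr1n. Qed.

Lemma xirX_root k : (xi ^+ (r * k)) ^+ (m %/ r) = 1.
Proof.
by rewrite -exprM mulnAC [(r * _)%N]mulnC divnK // exprM (prim_expr_order xiP) expr1n.
Qed.

Lemma s_mx_conj (s : 'S_n) u a b w : (forall c, u c != 0) -> a != b ->
  mono_mx s u *m s_mx (s a) (s b) w = s_mx a b (w * u a / u b) *m mono_mx s u :> 'M[K]_n.
Proof.
move=> u0 ab; have sab : s a != s b by rewrite (inj_eq perm_inj).
rewrite !s_mxE // !mono_mxM.
have -> : (s * tperm (s a) (s b) = tperm a b * s)%g.
  by rewrite -tpermJ mulKVg.
apply: eq_mono_mx => c; rewrite !(inj_eq perm_inj).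
case: tpermP => [->|->|/eqP/negPf ca /eqP/negPf cb].
- by rewrite eqxx mulrC mulfVK.
- rewrite eqxx eq_sym (negPf ab) invf_div invfM.
  by rewrite -!mulrA mulVf // mulr1.
- by rewrite ca cb mulr1 mul1r.
Qed.

Lemma t_mx_conj (s : 'S_n) u a w :
  mono_mx s u *m t_mx (s a) w = t_mx a w *m mono_mx s u :> 'M[K]_n.
Proof.
rewrite !t_mxE !mono_mxM mulg1 mul1g; apply: eq_mono_mx => c.
by rewrite (inj_eq perm_inj) perm1 mulrC.
Qed.

Lemma delta_mono_inv (s : 'S_n) u a : (forall c, u c != 0) ->
  (delta_mx 0 (s a) : 'rV[K]_n) *m invmx (mono_mx s u) = (u a)^-1 *: delta_mx 0 a.
Proof.
move=> u0; rewrite (mulmx1_invmx (mono_mxV s u0)) -rowE; apply/rowP=> b.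
by rewrite !mxE permK eqxx /=; case: eqP; rewrite ?mulr1 ?mulr0.
Qed.

Section Conjugation.
Variables (s : 'S_n) (u : 'I_n -> K).
Hypothesis Gg : G (mono_mx s u).

Lemma mono_Gmrn : (forall a, u a ^+ m = 1) /\ (\prod_a u a) ^+ (m %/ r) = 1.
Proof.
have [s' [u' [E u'm u'q]]] := (GmrnP r m0 (mono_mx s u)).1 Gg.
have uu' a : u a = u' a.
  move/matrixP/(_ a (s' a)): E; rewrite !mxE eqxx; case: eqP => // _ E0.
  by case/eqP: (root1_neq0 m0 (u'm a)).
by split=> [a|]; [rewrite uu'|under eq_bigr do rewrite uu'].
Qed.

Let um a : u a ^+ m = 1. Proof. exact: mono_Gmrn.1. Qed.
Let u0 a : u a != 0. Proof. exact: root1_neq0 (um a). Qed.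
Let gu : mono_mx s u \in unitmx. Proof. exact: Gmrn_unit Gg. Qed.

(** The factor u a is the constant of [divdiff_conj]: the group element sends x_(s a) to (u a)^-1
    x_a. *)
Lemma verma_act_s_op a b w v : a != b -> w ^+ m = 1 ->
  verma_act (mono_mx s u) (s_op (s a) (s b) w v) =
  u a *: s_op a b (w * u a / u b) (verma_act (mono_mx s u) v).
Proof.
move=> ab wm; have sab : s a != s b by rewrite (inj_eq perm_inj).
have w0 := root1_neq0 m0 wm.
have w'm : (w * u a / u b) ^+ m = 1 by rewrite !exprMn exprVn !um wm invr1 !mulr1.
have w'0 := root1_neq0 m0 w'm.
have Gs := s_mx_Gmrn r m0 sab wm; have Gs' := s_mx_Gmrn r m0 ab w'm.
have mv := s_moves sab w0; have mv' := s_moves ab w'0.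
rewrite /verma_act /s_op -tensZl.
rewrite [LHS]tens_comp; last exact: poly_act_linear.
rewrite [RHS]tens_comp; last first.
  by move=> c f1 f2; rewrite divdiff_linear // scalerDr !scalerA [c * _]mulrC.
rewrite -(rhoM Gg Gs) (s_mx_conj s w u0 ab) (rhoM Gs' Gg); apply: eq_tens => f /=.
apply: (divdiff_conj _ gu (Gmrn_unit m0 Gs) (Gmrn_unit m0 Gs') mv mv').
  exact: s_mx_conj.
rewrite /s_root mulmxBl -scalemxAl !delta_mono_inv // scalerBr !scalerA.
rewrite divff // scale1r; congr (_ - _ *: _).
by rewrite [u a * w]mulrC.
Qed.

Lemma verma_act_t_op a w v : w ^+ (m %/ r) = 1 ->
  verma_act (mono_mx s u) (t_op (s a) w v) =
  u a *: t_op a w (verma_act (mono_mx s u) v).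
Proof.
move=> wq.
have wm : w ^+ m = 1 by rewrite -(divnK rm) exprM wq expr1n.
have w0 := root1_neq0 m0 wm.
have Gt := t_mx_Gmrn m0 (s a) rm wq; have Gt' := t_mx_Gmrn m0 a rm wq.
have mv := t_moves (s a) w0; have mv' := t_moves a w0.
rewrite /verma_act /t_op -tensZl.
rewrite [LHS]tens_comp; last exact: poly_act_linear.
rewrite [RHS]tens_comp; last first.
  by move=> c f1 f2; rewrite divdiff_linear // scalerDr !scalerA [c * _]mulrC.
rewrite -(rhoM Gg Gt) t_mx_conj (rhoM Gt' Gg); apply: eq_tens => f /=.
apply: (divdiff_conj _ gu (Gmrn_unit m0 Gt) (Gmrn_unit m0 Gt') mv mv').
  exact: t_mx_conj.
by rewrite delta_mono_inv // scalerA divff // scale1r.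
Qed.

(* When n = 2 and r is even, u a / u b is an even power of xi, because the
   product u a * u b is a power of xi ^+ r. *)
Lemma entry_ratio a b : a != b ->
  exists e, u a / u b = xi ^+ e /\ forall k, c0 ((k + e) %% cl)%N = c0 (k %% cl)%N.
Proof.
move=> ab; have [ea Ea] := prim_rootP xiP (um a).
have [eb Eb] := prim_rootP xiP (um b).
have n1 := ord_neq_gt1 ab.
exists (ea + (m - eb))%N; split.
  rewrite exprD expfB // (prim_expr_order xiP) div1r -Ea -Eb //.
move=> k; rewrite /s_classes leqNgt n1 /=; case: ifP => [/andP[/eqP n2 er]|_].
  have m2 : (2 %| m)%N by apply: dvdn_trans rm; rewrite dvdn2.
  have ub : \prod_c u c = u a * u b.
    rewrite (bigD1 a) //= (bigD1 b) 1?eq_sym //= big1 ?mulr1 // => c /andP[ca cb].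
    have lt2 (x : 'I_n) : (x < 2)%N by apply: leq_trans (ltn_ord x) _; rewrite n2.
    have := lt2 a; have := lt2 b; have := lt2 c.
    move: ca cb ab; rewrite -!val_eqE /=.
    by case: (val a) (val b) (val c) => [|[|?]] [|[|?]] [|[|?]].
  have : (m %| (ea + eb) * (m %/ r))%N.
    by rewrite (prim_order_dvd xiP) exprM exprD -Ea -Eb -ub mono_Gmrn.2.
  have q0 : (0 < m %/ r)%N by rewrite divn_gt0 ?(dvdn_gt0 m0 rm) // dvdn_leq.
  rewrite -{1}(divnK rm) mulnC dvdn_pmul2r // => /(dvdn_trans _) eab.
  have {}eab : (2 %| ea + eb)%N by apply: eab; rewrite dvdn2.
  move: eab m2; rewrite !dvdn2 oddD => eab /negPf em.
  rewrite !modn2 oddD oddD oddB 1?ltnW // em /=.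
  by move: eab; case: (odd ea); case: (odd eb) => // _; rewrite /= addbF.
by rewrite !modn1.
Qed.

Lemma verma_act_dunkl_i a v :
  verma_act (mono_mx s u) (dunkl_i (s a) v) =
  u a *: dunkl_i a (verma_act (mono_mx s u) v).
Proof.
have aL := verma_act_linear (mono_mx s u).
rewrite /dunkl_i (lin_funN aL) (lin_funD aL) scalerN scalerDr; congr (- (_ + _)).
  rewrite (lin_fun_sum aL) (reindex_inj (@perm_inj _ s)) scaler_sumr /=.
  apply: eq_big => [b|b ba]; first by rewrite (inj_eq perm_inj).
  have ab : a != b by apply: contra ba => /eqP->.
  have [e [Ee ce]] := entry_ratio ab.
  pose F k := c0 (k %% cl)%N *: s_op a b (xi ^+ k) (verma_act (mono_mx s u) v).
  have Fper k : F (k %% m)%N = F k.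
    by rewrite /F (c0_periodic c0 rm k ab) (prim_expr_mod xiP).
  (* Conjugation multiplies the weight xi^k by u a / u b = xi^e; shifting k by e absorbs this and
     leaves the parameters unchanged. *)
  rewrite (lin_fun_sum aL) -[in RHS](sum_shift_periodic Fper e) scaler_sumr.
  apply: eq_bigr => k _; rewrite (lin_funZ aL).
  rewrite (verma_act_s_op v ab (xiX_root k)) /F ce -mulrA Ee -exprD.
  by rewrite !scalerA mulrC.
rewrite (lin_fun_sum aL) scaler_sumr; apply: eq_bigr => k _.
by rewrite (lin_funZ aL) (verma_act_t_op _ _ (xirX_root k)) !scalerA mulrC.
Qed.

End Conjugation.

Lemma verma_act_dunkl g y v : G g ->
  verma_act g (dunkl y v) = dunkl (g *m y) (verma_act g v).
Proof.
move=> Gg; have [s [u [Eg _ _]]] := (GmrnP r m0 g).1 Gg; rewrite {g}Eg in Gg *.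
have aL := verma_act_linear (mono_mx s u).
rewrite !(dunkl_basis _ _ _ m0 rm xiP) (lin_fun_sum aL).
rewrite (reindex_inj (@perm_inj _ s)) /=; apply: eq_bigr => a _.
rewrite (lin_funZ aL) (verma_act_dunkl_i Gg) scalerA; congr (_ *: _).
rewrite mxE (bigD1 (s a)) //= mxE eqxx big1 ?addr0 1?mulrC // => b ba.
by rewrite mxE (negPf ba) mul0r.
Qed.

End Equivariance.

(** * The relations of the Cherednik algebra on Verma modules *)

Section VermaRepresentation.
Variables (K : fieldType) (m r n : nat) (xi : K) (c0 ct : nat -> K) (d : nat).
Variable rho : 'M[K]_n -> 'M[K]_d.
Hypotheses (m0 : (0 < m)%N) (rm : (r %| m)%N) (xiP : m.-primitive_root xi).
Hypothesis rhoP : mx_rep (Gmrn (K := K) (n := n) m r) rho.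

Local Notation V := (verma K n d).
Local Notation G := (Gmrn (K := K) (n := n) m r).
Local Notation rmx := (refl_mx (m := m) (r := r) (n := n) xi).
Local Notation rt := (refl_root (m := m) (r := r) (n := n) xi).
Local Notation crt := (refl_coroot (m := m) (r := r) (n := n) xi).
Local Notation cpar := (refl_param (m := m) (r := r) (n := n) c0 ct).
Local Notation dunkl := (@dunkl K m r n xi c0 ct d rho).
Local Notation verma_act := (verma_act rho).
Implicit Types (s : refl_index m r n) (x : 'rV[K]_n) (y : 'cV[K]_n) (v : V).

Lemma refl_moves s : is_refl s -> moves_along (rmx s) (rt s).
Proof.
case: s => [[[i j] k]|[i k]] /= H.
  by apply: s_moves; rewrite ?neq_ltn ?H // expf_neq0 // (xi_neq0 m0 xiP).
by apply: t_moves; rewrite expf_neq0 // (xi_neq0 m0 xiP).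
Qed.

Lemma refl_Gmrn s : is_refl s -> G (rmx s).
Proof.
case: s => [[[i j] k]|[i k]] /= H.
  by apply: s_mx_Gmrn; rewrite ?neq_ltn ?H // (xiX_root xiP).
by apply: t_mx_Gmrn; rewrite // (xirX_root rm xiP).
Qed.

Lemma dunklE y v : dunkl y v = - \sum_(s | is_refl s)
  (cpar s * (rt s *m y) 0 0) *: tens (divdiff (rmx s) (rt s)) (rho (rmx s)) v.
Proof. by []. Qed.

Lemma dunkl_linear y : linear (dunkl y).
Proof.
move=> c v w; rewrite !dunklE scalerN scaler_sumr -opprD -big_split /=.
congr (- _); apply: eq_bigr => s Hs.
rewrite (tens_linear (rho (rmx s)) (divdiff_linear (refl_moves Hs))).
by rewrite scalerDr !scalerA [c * _]mulrC.
Qed.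

Lemma dunkl_linearl v : linear (fun y => dunkl y v).
Proof.
move=> c y z; rewrite !dunklE scalerN scaler_sumr -opprD -big_split /=.
congr (- _); apply: eq_bigr => s Hs.
rewrite mulmxDr -scalemxAr !mxE mulrDr scalerDl scalerA.
by rewrite mulrCA.
Qed.

(** Twisted Leibniz rule: the divided difference of x is the constant (x, alpha_s^vee), and at hbar
    = 0 there is no derivative term. *)
Lemma dunkl_mulx y x v :
  dunkl y (verma_mul (lin_poly x) v) = verma_mul (lin_poly x) (dunkl y v) -
    \sum_(s | is_refl s) (cpar s * (rt s *m y) 0 0 * (x *m crt s) 0 0) *:
      verma_act (rmx s) v.
Proof.
have xL := verma_mul_linear (d := d) (lin_poly x).
rewrite !dunklE (lin_funN xL) (lin_fun_sum xL) -opprD -big_split /=; congr (- _).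
apply: eq_bigr => s Hs; have mv := refl_moves Hs.
rewrite (lin_funZ xL) -[X in _ = _ + X]scalerA -scalerDr; congr (_ *: _).
rewrite -tens_mulr -tens_mull -tensZl -tensDl; apply: eq_tens => f.
rewrite (divdiffMr mv) (divdiff_lin mv (refl_rootP x (xi_neq0 m0 xiP) Hs)).
by rewrite mul_mpolyC addrC.
Qed.

Lemma dunkl_const y e : dunkl y (vconst n e) = 0.
Proof.
rewrite dunklE big1 ?oppr0 // => s Hs; have mv := refl_moves Hs.
suff -> : tens (divdiff (rmx s) (rt s)) (rho (rmx s)) (vconst n e) = 0 by rewrite scaler0.
apply/ffunP=> i; rewrite !ffunE big1 // => j _.
by rewrite ffunE (divdiff_fixed mv (poly_actC _ _)) scaler0.
Qed.

#[local] Opaque Defs.dunkl.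

(** Dual form of [refl_rootP]: s moves y along the coroot. The constant k is the inverse of the
    eigenvalue l of s on its root; for [dunklC] it matters only that k does not depend on y. *)
Lemma refl_mulmx s : is_refl s -> exists k, forall y,
  rmx s *m y - y = (k * (rt s *m y) 0 0) *: crt s.
Proof.
move=> Hs; have E := refl_rootP (s := s) _ (xi_neq0 m0 xiP) Hs.
have Ru := Gmrn_unit m0 (refl_Gmrn Hs); have [a0 _] := refl_moves Hs.
have Ey y : y - invmx (rmx s) *m y = (rt s *m y) 0 0 *: crt s.
  apply/colP=> i; have /(congr1 (fun z => (z *m y) 0 0)) := E (delta_mx 0 i).
  rewrite mulmxBl -mulmxA -scalemxAl -!rowE !mxE => ->.
  by rewrite mulrC.
have Ea : rt s *m invmx (rmx s) = (1 - (rt s *m crt s) 0 0) *: rt s.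
  by rewrite scalerBl scale1r -E opprB addrC subrK.
set l := 1 - _ in Ea.
have l0 : l != 0.
  apply: contraNneq a0 => l0; move: Ea; rewrite l0 scale0r => /(congr1 (mulmx^~ (rmx s))).
  by rewrite mulmxKV // mul0mx => ->.
exists l^-1 => y; have := Ey (rmx s *m y).
rewrite mulKmx // => ->; congr (_ *: _).
have -> : rt s *m (rmx s *m y) = l^-1 *: (rt s *m y).
  apply: (canRL (scalerK l0)); rewrite scalemxAl -Ea -mulmxA mulKmx //.
by rewrite mxE.
Qed.

(** Both sides vanish on constants. Moving x_i to the left of D_y D_z adds a sum over reflections,
    which is symmetric in y and z because s z - z is proportional to (alpha_s, z) alpha_s^vee. *)
Lemma dunklC y z v : dunkl y (dunkl z v) = dunkl z (dunkl y v).
Proof.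
move: v; apply: verma_ind => [e|v w Ev Ew|i v Ev].
- by rewrite !dunkl_const !(lin_fun0 (dunkl_linear _)).
- rewrite [dunkl z _](lin_funD (dunkl_linear z)) [dunkl y (v + w)](lin_funD (dunkl_linear y)).
  rewrite (lin_funD (dunkl_linear y)) (lin_funD (dunkl_linear z)).
  exact: (congr2 +%R Ev Ew).
rewrite -lin_poly_delta; set x := delta_mx 0 i.
pose b s y := cpar s * (rt s *m y) 0 0 * (x *m crt s) 0 0.
have H y' z' : dunkl y' (dunkl z' (verma_mul (lin_poly x) v)) =
    verma_mul (lin_poly x) (dunkl y' (dunkl z' v))
    - \sum_(s | is_refl s) (b s y' *: dunkl (rmx s *m z') (verma_act (rmx s) v)
                          + b s z' *: dunkl y' (verma_act (rmx s) v)).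
  rewrite [dunkl z' _]dunkl_mulx (lin_funB (dunkl_linear y')) dunkl_mulx -addrA -opprD.
  rewrite (lin_fun_sum (dunkl_linear y')) -big_split; congr (_ - _).
  apply: eq_bigr => s Hs; rewrite (lin_funZ (dunkl_linear y')).
  apply: (congr2 (fun a b => _ *: a + b)); last by [].
  exact: verma_act_dunkl (refl_Gmrn Hs).
apply: etrans (H y z) (etrans _ (esym (H z y))).
apply: (congr2 (fun a b => verma_mul (lin_poly x) a - b) Ev).
apply: eq_bigr => s Hs; have [k Hk] := refl_mulmx Hs.
have E y' z' : b s y' *: dunkl (rmx s *m z') (verma_act (rmx s) v) =
    b s y' *: dunkl z' (verma_act (rmx s) v) +
    (b s y' * (k * (rt s *m z') 0 0)) *: dunkl (crt s) (verma_act (rmx s) v).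
  have -> : rmx s *m z' = (k * (rt s *m z') 0 0) *: crt s + z' by rewrite -Hk subrK.
  by rewrite (dunkl_linearl (verma_act (rmx s) v)) scalerDr scalerA addrC.
rewrite [b s y *: dunkl (rmx s *m z) _]E [b s z *: dunkl (rmx s *m y) _]E.
rewrite addrAC [RHS]addrAC; apply: (congr2 (fun a c => a + c *: _)); first exact: addrC.
by rewrite /b; ring.
Qed.

Lemma verma_cher_rep : cher_rep m r xi c0 ct (verma_ops m r xi c0 ct rho).
Proof.
split=> /=.
- by move=> x; apply: verma_mul_linear.
- by move=> v c x x'; rewrite lin_polyD lin_polyZ verma_mulDl verma_mulZl.
- exact: dunkl_linear.
- exact: dunkl_linearl.
- by move=> g _; apply: verma_act_linear.
- exact: verma_act1 rhoP.
- exact: verma_actM m0 rhoP.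
- move=> g x v Gg; rewrite -poly_act_lin; exact: verma_act_mul.
- by move=> g y v Gg; apply: verma_act_dunkl.
- by move=> x x' v; rewrite !verma_mulA mulrC.
- by move=> y z v; apply: dunklC.
- by move=> y x v; rewrite dunkl_mulx addrAC subrr add0r.
Qed.

End VermaRepresentation.

(** * Representations on quotients by stable subspaces *)

Section QuotientRepresentation.
Variables (K : fieldType) (m r n : nat) (xi : K) (c0 ct : nat -> K).
Variables (V : lmodType K) (N : submodClosed V) (o : cher_ops n V).

Local Notation pi := (@qmod_pi _ _ N).

Lemma qmod_map_pi (f : V -> V) v : linear f -> (forall w, w \in N -> f w \in N) ->
  qmod_map (N := N) f (pi v) = pi (f v).
Proof.
move=> fL fN; apply/qmod_piP; rewrite -(lin_funB fL); apply: fN.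
by apply/qmod_piP; rewrite qmod_repr.
Qed.

Lemma qmod_pi_linear : linear pi.
Proof. by move=> c u v; rewrite qmod_piD qmod_piZ. Qed.

Hypothesis oP : cher_rep m r xi c0 ct o.
Hypothesis oN : Defs.invariant (cher_action m r o) (fun v => v \in N).

Let op_xN x w : w \in N -> op_x o x w \in N.
Proof. by move=> Nw; apply: oN Nw; constructor 1; exists x. Qed.

Let op_yN y w : w \in N -> op_y o y w \in N.
Proof. by move=> Nw; apply: oN Nw; constructor 2; exists y. Qed.

Let op_gN g w : Gmrn m r g -> w \in N -> op_g o g w \in N.
Proof. by move=> Gg Nw; apply: oN Nw; constructor 3; exists g. Qed.

Lemma qmod_op_x x v : op_x (quot_ops N o) x (pi v) = pi (op_x o x v).
Proof. by apply: qmod_map_pi => [|w]; [apply: rep_xl oP x | apply: op_xN]. Qed.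

Lemma qmod_op_y y v : op_y (quot_ops N o) y (pi v) = pi (op_y o y v).
Proof. by apply: qmod_map_pi => [|w]; [apply: rep_yl oP y | apply: op_yN]. Qed.

Lemma qmod_op_g g v : Gmrn m r g ->
  op_g (quot_ops N o) g (pi v) = pi (op_g o g v).
Proof.
by move=> Gg; apply: qmod_map_pi => [|w]; [apply: rep_gl oP g Gg | apply: op_gN].
Qed.

Lemma quot_cher_rep : (0 < m)%N -> (r %| m)%N -> m.-primitive_root xi ->
  cher_rep m r xi c0 ct (quot_ops N o).
Proof.
move=> m0 rm xiP.
have piL := qmod_pi_linear.
have piE (u : qmod N) : exists v, u = pi v by exists (generic_quotient.repr u); rewrite qmod_repr.
split.
- move=> x c u u'; have [v ->] := piE u; have [v' ->] := piE u'.
  by rewrite -piL !qmod_op_x (rep_xl oP) piL.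
- by move=> u c x x'; have [v ->] := piE u; rewrite !qmod_op_x (rep_x oP) piL.
- move=> x c u u'; have [v ->] := piE u; have [v' ->] := piE u'.
  by rewrite -piL !qmod_op_y (rep_yl oP) piL.
- by move=> u c x x'; have [v ->] := piE u; rewrite !qmod_op_y (rep_y oP) piL.
- move=> g Gg c u u'; have [v ->] := piE u; have [v' ->] := piE u'.
  by rewrite -piL !(qmod_op_g _ Gg) (rep_gl oP Gg) piL.
- move=> u; have [v ->] := piE u.
  by rewrite (qmod_op_g _ (Gmrn1 _ _ r m0)) (rep_g1 oP).
- move=> g h u Gg Gh; have [v ->] := piE u.
  rewrite (qmod_op_g _ Gh) !(qmod_op_g _ Gg) (qmod_op_g _ (GmrnM m0 Gg Gh)).
  by rewrite (rep_gM oP).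
- move=> g x u Gg; have [v ->] := piE u.
  by rewrite qmod_op_x !(qmod_op_g _ Gg) qmod_op_x (rep_gx oP).
- move=> g x u Gg; have [v ->] := piE u.
  by rewrite qmod_op_y !(qmod_op_g _ Gg) qmod_op_y (rep_gy oP).
- by move=> x x' u; have [v ->] := piE u; rewrite !qmod_op_x (rep_xx oP).
- by move=> x x' u; have [v ->] := piE u; rewrite !qmod_op_y (rep_yy oP).
- move=> y x u; have [v ->] := piE u.
  rewrite qmod_op_x qmod_op_y qmod_op_y.
  rewrite qmod_op_x -(lin_funB piL) (rep_yx oP).
  rewrite (lin_funN piL) (lin_fun_sum piL); congr (- _); apply: eq_bigr => s Hs.
  by rewrite (lin_funZ piL) (qmod_op_g _ (refl_Gmrn m0 rm xiP Hs)).
Qed.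

End QuotientRepresentation.

(** * Grading and singular vectors *)

Section Homogeneous.
Variables (K : fieldType) (n : nat).
Implicit Types (f g : {mpoly K[n]}) (k : nat).

Local Notation ph k := (pihomog (Measure.clone _ mdeg _) k).

Lemma pihomogXM0 i f : ph 0 ('X_i * f) = 0.
Proof.
elim/mpolyind: f => [|c mn f _ _ IH]; first by rewrite mulr0 pihomog0.
rewrite mulrDr pihomogD IH addr0 -scalerAr -mpolyXD linearZ /= pihomogX /= mdegD mdeg1.
by rewrite scaler0.
Qed.

Lemma pihomogXMS i k f : ph k.+1 ('X_i * f) = 'X_i * ph k f.
Proof.
elim/mpolyind: f => [|c mn f _ _ IH]; first by rewrite mulr0 !pihomog0 mulr0.
rewrite mulrDr !pihomogD IH mulrDr; congr (_ + _).
rewrite -scalerAr -mpolyXD !linearZ /= !pihomogX /= mdegD mdeg1 add1n eqSS -scalerAr.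
by case: ifP => _; rewrite ?mulr0 // mpolyXD.
Qed.

Lemma pihomog_linM0 x f : ph 0 (lin_poly x * f) = 0.
Proof.
rewrite /lin_poly mulr_suml raddf_sum big1 // => i _.
by rewrite /= -scalerAl linearZ /= pihomogXM0 scaler0.
Qed.

Lemma pihomog_linMS x k f : ph k.+1 (lin_poly x * f) = lin_poly x * ph k f.
Proof.
rewrite /lin_poly !mulr_suml raddf_sum; apply: eq_bigr => i _.
by rewrite /= -scalerAl linearZ /= pihomogXMS scalerAl.
Qed.

Lemma pihomog1 k : ph k (1 : {mpoly K[n]}) = (k == 0%N)%:R.
Proof. by rewrite -mpolyX0 pihomogX /= mdeg0 eq_sym mpolyX0; case: eqP. Qed.

Lemma pihomog_coef0 f : ph 0 f = (f@_0%MM)%:MP.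
Proof.
elim/mpolyind: f => [|c mn f _ _ IH]; first by rewrite pihomog0 mcoeff0 mpolyC0.
rewrite pihomogD IH mcoeffD mpolyCD linearZ /= pihomogX /= mcoeffZ mcoeffX mdeg_eq0.
congr (_ + _); case: eqP => [->|_]; last by rewrite mulr0 scaler0 mpolyC0.
by rewrite mpolyX0 mulr1 -mul_mpolyC mulr1.
Qed.

Lemma pihomog_poly_act (g : 'M[K]_n) k f : ph k (poly_act g f) = poly_act g (ph k f).
Proof.
elim/mpoly_mulX_ind: f k => [|c f1 f2 E1 E2|i f E] k.
- by rewrite rmorph1 !pihomog1 rmorph_nat.
- by rewrite (linearP (poly_act g)) linearP /= E1 E2 -(linearP (poly_act g)) -linearP.
- rewrite rmorphM /= poly_actX; case: k => [|k].
    by rewrite pihomog_linM0 pihomogXM0 rmorph0.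
  by rewrite pihomog_linMS pihomogXMS E rmorphM /= poly_actX.
Qed.

Lemma pihomog_divdiff (g : 'M[K]_n) a k f : moves_along g a ->
  ph k (divdiff g a f) = divdiff g a (ph k.+1 f).
Proof.
move=> ga; apply/esym/divdiff_uniq => //.
rewrite mulrC -pihomog_linMS mulrC divdiffE // -pihomog_poly_act.
exact: linearB.
Qed.

End Homogeneous.

Section VermaHomogeneous.
Variables (K : fieldType) (n d : nat).
Local Notation V := (verma K n d).
Implicit Types (v w : V) (k : nat).

Lemma verma_homog_linear k : linear (verma_homog k : V -> V).
Proof. by move=> c v w; apply/ffunP=> j; rewrite !ffunE linearP. Qed.

Lemma verma_homog_tens (phi psi : {mpoly K[n]} -> {mpoly K[n]}) M k l v :
  (forall f, pihomog (Measure.clone _ mdeg _) k (phi f) =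
             psi (pihomog (Measure.clone _ mdeg _) l f)) ->
  verma_homog k (tens phi M v) = tens psi M (verma_homog l v).
Proof.
move=> E; apply/ffunP=> i; rewrite !ffunE linear_sum; apply: eq_bigr => j _.
by rewrite ffunE linearZ /= E.
Qed.

Lemma verma_homogXM0 i v : verma_homog 0 (verma_mul 'X_i v) = 0.
Proof. by apply/ffunP=> j; rewrite !ffunE pihomogXM0. Qed.

Lemma verma_homogXMS i k v :
  verma_homog k.+1 (verma_mul 'X_i v) = verma_mul 'X_i (verma_homog k v).
Proof. by apply/ffunP=> j; rewrite !ffunE pihomogXMS. Qed.

Lemma verma_homog_act (rho : 'M[K]_n -> 'M[K]_d) g k v :
  verma_homog k (verma_act rho g v) = verma_act rho g (verma_homog k v).
Proof. by apply: verma_homog_tens => f; apply: pihomog_poly_act. Qed.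

Lemma verma_homog0 v : verma_homog 0 v = vconst n (\col_j (v j)@_0%MM).
Proof. by apply/ffunP=> j; rewrite !ffunE mxE pihomog_coef0. Qed.

Lemma verma_homog0_const e : verma_homog 0 (vconst n e : V) = vconst n e.
Proof.
rewrite verma_homog0; congr vconst; apply/colP=> j.
by rewrite mxE ffunE mcoeffC eqxx mulr1.
Qed.

Lemma verma_homog_homog k l v :
  verma_homog k (verma_homog l v) = if k == l then verma_homog l v else 0.
Proof.
apply/ffunP=> j; rewrite !ffunE; case: eqP => [->|/eqP kl]; rewrite !ffunE.
  exact: pihomog_id.
by apply: (pihomog_ne0 (d := l)); rewrite 1?eq_sym // pihomogP.
Qed.

Lemma verma_homog_sum v : exists N,
  (forall k, (N <= k)%N -> verma_homog k v = 0) /\ v = \sum_(k < N) verma_homog k v.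
Proof.
exists (\max_j msize (v j))%N; split=> [k kN|].
  apply/ffunP=> j; rewrite !ffunE pihomogE big1_seq // => mn /andP[/eqP mk mv].
  have := msize_mdeg_lt mv; rewrite [mdeg mn]mk ltnNge.
  by rewrite (leq_trans _ kN) // (leq_bigmax (F := fun j => msize (v j))).
apply/ffunP=> j; rewrite sum_ffunE.
rewrite [LHS](pihomog_partitionE (mf := Measure.clone _ mdeg _)
  (leq_bigmax (F := fun j => msize (v j)) j)).
by apply: eq_bigr => k _; rewrite ffunE.
Qed.

End VermaHomogeneous.

(** * Submodules generated over A *)

Section ASpan.
Variables (K : fieldType) (n d : nat).
Local Notation V := (verma K n d).
Implicit Types (S P : V -> Prop).

Lemma mem_A_span S v : S v -> v \in A_span S.
Proof.
move=> Sv; apply/asboolP; exists [:: (1, v)]; split.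
  by move=> au; rewrite inE => /eqP->.
by rewrite big_seq1 verma_mul1.
Qed.

Lemma A_span_mul S a v : v \in A_span S -> verma_mul a v \in A_span S.
Proof.
case/asboolP=> s [Ss ->]; apply/asboolP.
exists [seq (a * bw.1, bw.2) | bw <- s]; split.
  by move=> _ /mapP[bw /Ss Sbw ->].
rewrite (lin_fun_sum (verma_mul_linear a)) big_map; apply: eq_bigr => bw _.
exact: verma_mulA.
Qed.

Lemma A_span_ind S P : P 0 -> (forall v w, P v -> P w -> P (v + w)) ->
  (forall a v, S v -> P (verma_mul a v)) -> forall v, v \in A_span S -> P v.
Proof.
move=> P0 PD PS _ /asboolP[s [Ss ->]]; rewrite big_seq.
by elim/big_ind: _ => // au /Ss; apply: PS.
Qed.

Lemma A_span_mulX_ind S P : P 0 ->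
  (forall c v w, P v -> P w -> P (c *: v + w)) ->
  (forall v, S v -> P v) ->
  (forall i v, v \in A_span S -> P v -> P (verma_mul 'X_i v)) ->
  forall v, v \in A_span S -> P v.
Proof.
move=> P0 PL PS PX; apply: A_span_ind => // [v w Pv Pw|a v Sv].
  by rewrite -[v]scale1r; apply: PL.
elim/mpoly_mulX_ind: a => [|c f g Pf Pg|i f Pf].
- by rewrite verma_mul1; apply: PS.
- by rewrite verma_mulDl verma_mulZl; apply: PL.
- by rewrite -verma_mulA; apply: PX; rewrite // A_span_mul ?mem_A_span.
Qed.

Lemma A_span_homog S k v :
  (forall w l, S w -> verma_homog l w \in A_span S) ->
  v \in A_span S -> verma_homog k v \in A_span S.
Proof.
move=> SH Sv; move: k; elim/A_span_mulX_ind: Sv => [k|c u w Hu Hw k|u Su k|i u _ Hu [|k]].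
- by rewrite (lin_fun0 (verma_homog_linear k)) rpred0.
- by rewrite verma_homog_linear; apply: rpredD => //; apply: rpredZ.
- exact: SH.
- by rewrite verma_homogXM0 rpred0.
- by rewrite verma_homogXMS A_span_mul.
Qed.

Lemma A_span_homog0 S v : (forall w, S w -> verma_homog 0 w = 0) ->
  v \in A_span S -> verma_homog 0 v = 0.
Proof.
move=> S0; elim/A_span_mulX_ind => [|c u w Hu Hw|u /S0 //|i u _ _].
- exact: lin_fun0 (verma_homog_linear _).
- by rewrite verma_homog_linear Hu Hw scaler0 addr0.
- exact: verma_homogXM0.
Qed.

End ASpan.

Section VermaSubmodules.
Variables (K : fieldType) (m r n : nat) (xi : K) (c0 ct : nat -> K) (d : nat).
Variable rho : 'M[K]_n -> 'M[K]_d.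
Hypotheses (m0 : (0 < m)%N) (rm : (r %| m)%N) (xiP : m.-primitive_root xi).
Hypothesis rhoP : mx_rep (Gmrn (K := K) (n := n) m r) rho.

Local Notation V := (verma K n d).
Local Notation G := (Gmrn (K := K) (n := n) m r).
Local Notation dunkl := (@dunkl K m r n xi c0 ct d rho).
Local Notation verma_act := (verma_act rho).
Local Notation Mops := (verma_ops m r xi c0 ct rho).
Implicit Types (N : V -> Prop) (v w : V).

Lemma dunkl_homog y k v : verma_homog k (dunkl y v) = dunkl y (verma_homog k.+1 v).
Proof.
rewrite !dunklE (lin_funN (verma_homog_linear k)) (lin_fun_sum (verma_homog_linear k)).
congr (- _); apply: eq_bigr => s Hs; rewrite (lin_funZ (verma_homog_linear k)).
congr (_ *: _); apply: verma_homog_tens => f.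
exact: pihomog_divdiff (refl_moves m0 xiP Hs).
Qed.

Section Subspace.
Variable N : V -> Prop.
Hypothesis Ns : subspace N.

Lemma subspace0 : N 0. Proof. by case: Ns. Qed.

Lemma subspaceZ c v : N v -> N (c *: v).
Proof. by move=> Nv; rewrite -[_ *: _]addr0; apply: Ns.2 => //; apply: subspace0. Qed.

Lemma subspaceD v w : N v -> N w -> N (v + w).
Proof. by move=> Nv Nw; rewrite -[v]scale1r; apply: Ns.2. Qed.

Lemma subspaceB v w : N v -> N w -> N (v - w).
Proof. by move=> Nv Nw; apply: subspaceD => //; rewrite -scaleN1r; apply: subspaceZ. Qed.

Lemma subspace_sum I (s : seq I) (P : pred I) F :
  (forall i, P i -> N (F i)) -> N (\sum_(i <- s | P i) F i).
Proof. by move=> NF; elim/big_ind: _ => //; [apply: subspace0 | apply: subspaceD]. Qed.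

End Subspace.

Section CherSubmod.
Variable N : V -> Prop.
Hypothesis NP : cher_submod m r Mops N.

Lemma submod_act g v : G g -> N v -> N (verma_act g v).
Proof. by move=> Gg Nv; apply: NP.2 Nv; constructor 3; exists g. Qed.

Lemma submod_dunkl y v : N v -> N (dunkl y v).
Proof. by move=> Nv; apply: NP.2 Nv; constructor 2; exists y. Qed.

Lemma submod_mul a v : N v -> N (verma_mul a v).
Proof.
move=> Nv; elim/mpoly_mulX_ind: a => [|c f g Nf Ng|i f Nf].
- by rewrite verma_mul1.
- by rewrite verma_mulDl verma_mulZl; apply: NP.1.2.
- rewrite -verma_mulA -lin_poly_delta; apply: NP.2 Nf.
  by constructor 1; exists (delta_mx 0 i).
Qed.

End CherSubmod.

(** Stability can be tested on generators, because the commutator of D_y with x_i is a combination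
    of group elements, and these preserve the span. *)
Lemma A_span_submod (S : V -> Prop) :
  (forall g v, G g -> S v -> verma_act g v \in A_span S) ->
  (forall y v, S v -> dunkl y v \in A_span S) ->
  cher_submod m r Mops (fun v => v \in A_span S).
Proof.
move=> SG SD.
have HG g v : G g -> v \in A_span S -> verma_act g v \in A_span S.
  move=> Gg; elim/A_span_ind => [|u w Hu Hw|a u Su].
  - by rewrite (lin_fun0 (verma_act_linear rho g)) rpred0.
  - rewrite (lin_funD (verma_act_linear rho g)); exact: rpredD Hu Hw.
  - by rewrite verma_act_mul A_span_mul // SG.
split; first by split=> [|c u v Nu Nv]; rewrite ?rpred0 // rpredD ?rpredZ.
move=> _ [[x ->]|[y ->]|[g Gg ->]] v /=.
- exact: A_span_mul.
- elim/A_span_mulX_ind => [|c u w Hu Hw|u Su|i u Su Hu].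
  + by rewrite (lin_fun0 (dunkl_linear r c0 ct rho m0 xiP y)) rpred0.
  + rewrite (dunkl_linear r c0 ct rho m0 xiP y c u w); exact: rpredD (rpredZ _ Hu) Hw.
  + exact: SD.
  + rewrite -lin_poly_delta (dunkl_mulx r c0 ct rho m0 xiP).
    apply: rpredB; first exact: A_span_mul.
    by apply: rpred_sum => s Hs; apply/rpredZ/HG; first apply: (refl_Gmrn m0 rm xiP).
- exact: HG.
Qed.

End VermaSubmodules.

(** * Singular vectors modulo the maximal graded submodule *)

Section SingularVectors.
Variables (K : fieldType) (m r n : nat) (xi : K) (c0 ct : nat -> K) (d : nat).
Variable rho : 'M[K]_n -> 'M[K]_d.
Hypotheses (m0 : (0 < m)%N) (rm : (r %| m)%N) (xiP : m.-primitive_root xi).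
Hypothesis rhoI : irreducible_mx_rep (Gmrn (K := K) (n := n) m r) rho.
Variable J : verma K n d -> Prop.
Hypothesis JP : max_proper_graded_submod m r xi c0 ct rho J.

Local Notation V := (verma K n d).
Local Notation G := (Gmrn (K := K) (n := n) m r).
Local Notation dunkl := (@dunkl K m r n xi c0 ct d rho).
Local Notation verma_act := (verma_act rho).
Local Notation Mops := (verma_ops m r xi c0 ct rho).

Let rhoP : mx_rep G rho. Proof. by case: rhoI. Qed.
Let Jsub : cher_submod m r Mops J. Proof. by case: JP => -[]. Qed.
Let Jgr v k : J v -> J (verma_homog k v).
Proof. by case: JP => -[_ H _] _ Jv; apply: H. Qed.

Lemma submod_const (N : V -> Prop) e : cher_submod m r Mops N ->
  N (vconst n e) -> e != 0 -> forall v, N v.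
Proof.
move=> NP Ne e0; have [_ [_ H]] := rhoI.
have cL : linear (@vconst K n d) by apply: vconst_linear.
have Nc e' : N (vconst n e').
  apply: (H (fun e => N (vconst n e))); last by exists e.
  - by split=> [|c a b]; rewrite ?(lin_fun0 cL) ?cL; [apply: NP.1.1 | apply: NP.1.2].
  - by move=> _ [g Gg ->] a Na; rewrite -verma_act_const; apply: (submod_act NP Gg Na).
apply: verma_ind => // [v w|i v]; first by move=> Nv Nw; apply: (subspaceD NP.1).
by move=> Nv; apply: (submod_mul NP).
Qed.

(** As J is graded, the degree 0 part of v is a constant lying in J, and a nonzero constant would
    generate everything. *)
Lemma max_submod_homog0 v : J v -> verma_homog 0 v = 0.
Proof.
move=> Jv; have := Jgr 0 Jv; rewrite verma_homog0; set e := \col_j _ => Je.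
have [->|e0] := eqVneq e 0; first exact: lin_fun0 (@vconst_linear _ _ _).
have [[_ _ [w nJw]] _] := JP.
by case: nJw; apply: (submod_const Jsub Je e0 w).
Qed.

(* The submodule generated by J and a singular vector of positive degree meets
   the degree 0 part trivially, so that it is J. *)
Lemma homog_singular k v : (forall y, J (dunkl y v)) -> verma_homog k.+1 v = v -> J v.
Proof.
move=> Dv hv; pose S w := J w \/ exists2 g, G g & w = verma_act g v.
have SJ w : J w -> w \in A_span S by move=> Jw; apply: mem_A_span; left.
have S0 w : S w -> verma_homog 0 w = 0.
  case=> [|[g Gg ->]]; first exact: max_submod_homog0.
  rewrite verma_homog_act -hv verma_homog_homog /=.
  exact: lin_fun0 (verma_act_linear rho g).
have [_ Jmax] := JP; apply: (Jmax (fun w => w \in A_span S)) => //; last first.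
  by apply: mem_A_span; right; exists 1%:M; rewrite ?(verma_act1 rhoP) //; apply: Gmrn1.
split.
- apply: (A_span_submod m0 rm xiP) => [g w Gg|y w].
    case=> [Jw|[h Gh ->]]; first by apply: SJ; apply: (submod_act Jsub).
    apply: mem_A_span; right; exists (g *m h); first exact: GmrnM.
    by rewrite (verma_actM m0 rhoP).
  case=> [Jw|[h Gh ->]]; first by apply: SJ; apply: (submod_dunkl Jsub).
  apply: SJ; have Gi := GmrnV m0 Gh.
  (* Equivariance moves h out of the Dunkl operator and leaves some D_z v, which lies in J. *)
  have -> : y = h *m (invmx h *m y) by rewrite mulKVmx // (Gmrn_unit m0 Gh).
  rewrite -(verma_act_dunkl c0 ct m0 rm xiP rhoP) //.
  exact: (submod_act Jsub Gh (Dv _)).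
- move=> w Sw k'; apply: A_span_homog Sw => u l; case=> [Ju|[g Gg ->]].
    by apply: SJ; apply: Jgr.
  rewrite verma_homog_act -hv verma_homog_homog; case: ifP => _.
    by rewrite hv; apply: mem_A_span; right; exists g.
  by rewrite (lin_fun0 (verma_act_linear rho g)) rpred0.
- have [_ [[e e0] _]] := rhoI; exists (vconst n e) => /(A_span_homog0 S0).
  rewrite verma_homog0_const => /ffunP E; case/eqP: e0; apply/colP=> j.
  by have := congr1 (mcoeff 0%MM) (E j); rewrite !ffunE mcoeffC eqxx mulr1 mcoeff0 mxE.
Qed.

(** D_y is homogeneous of degree -1 and J is graded, so every component of v is singular modulo J;
    those of positive degree fall under [homog_singular]. *)
Lemma singular_const v : (forall y, J (dunkl y v)) -> J (v - verma_homog 0 v).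
Proof.
move=> Dv; have [N [_ Ev]] := verma_homog_sum v.
have Jk k : J (verma_homog k.+1 v).
  apply: (@homog_singular k); last by rewrite verma_homog_homog eqxx.
  move=> y; rewrite -[verma_homog k.+1 v]/(verma_homog k.+1 v).
  by rewrite -(dunkl_homog r c0 ct rho m0 xiP); apply: Jgr.
case: N Ev => [|N] Ev.
  rewrite big_ord0 in Ev; rewrite Ev (lin_fun0 (@verma_homog_linear _ _ _ 0)) subr0.
  exact: (subspace0 Jsub.1).
rewrite {1}Ev big_ord_recl /= addrC addKr.
by apply: (subspace_sum Jsub.1) => i _; apply: Jk.
Qed.

End SingularVectors.

(** * Components for the diagonal subgroup *)

Section IsotypicComponents.
Variables (K : fieldType) (n q : nat).
Hypothesis q0 : (0 < q)%N.
Implicit Types (f g : {mpoly K[n]}) (a b : {ffun 'I_n -> 'I_q}) (mn : 'X_{1..n}).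

Local Notation pow_vars := (@pow_vars K n q).

HB.instance Definition _ := GRing.RMorphism.copy pow_vars
  (comp_mpoly [tuple 'X_i ^+ q | i < n]).
HB.instance Definition _ :=
  GRing.isScalable.Build K {mpoly K[n]} {mpoly K[n]} *:%R pow_vars
    (fun c f => comp_mpolyZ c f [tuple 'X_i ^+ q | i < n]).

Lemma pow_varsX i : pow_vars 'X_i = 'X_i ^+ q.
Proof. by rewrite /Defs.pow_vars comp_mpolyXU -tnth_nth tnth_mktuple. Qed.

Lemma pow_varsC c : pow_vars c%:MP = c%:MP.
Proof. exact: comp_mpolyC. Qed.

Lemma pow_vars_mon mn : pow_vars 'X_[mn] = 'X_[mn *+ q].
Proof.
rewrite mpolyXE_id rmorph_prod mpolyXE_id; apply: eq_bigr => i _.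
by rewrite rmorphXn /= pow_varsX -exprM mulmnE mulnC.
Qed.

Definition exponent a : 'X_{1..n} := [multinom (a i : nat) | i < n].

Definition mnm_div mn : 'X_{1..n} := [multinom (mn i %/ q)%N | i < n].

Definition congruent a mn : bool := [forall i, (mn i %% q == a i)%N].

(* The component on which the diagonal group acts as on x^a, divided by x^a and
   expressed in the variables x_i^q. *)
Definition iso a f : {mpoly K[n]} :=
  \sum_(mn <- msupp f | congruent a mn) f@_mn *: 'X_[mnm_div mn].

Lemma congruentE a mn beta :
  congruent a mn && (mnm_div mn == beta) = (mn == (exponent a + beta *+ q)%MM).
Proof.
apply/andP/eqP => [[/forallP E /eqP <-]|->].
  apply/mnmP=> i; rewrite mnmDE mulmnE !mnmE addnC -(eqP (E i)).
  exact: divn_eq.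
split; first by apply/forallP=> i; rewrite mnmDE mulmnE mnmE addnC modnMDl modn_small.
apply/eqP/mnmP=> i; rewrite mnmE mnmDE mulmnE mnmE addnC divnMDl //.
by rewrite divn_small // addn0.
Qed.

Lemma mcoeff_iso a f beta : (iso a f)@_beta = f@_(exponent a + beta *+ q).
Proof.
rewrite /iso raddf_sum /= big_mkcond /=.
under eq_bigr => mn _.
  rewrite mcoeffZ mcoeffX (_ : (if _ then _ else _) =
    if mn == (exponent a + beta *+ q)%MM then f@_mn else 0); last first.
    by rewrite -congruentE; case: congruent; rewrite //=; case: eqP;
      rewrite ?mulr1 ?mulr0.
  over.
rewrite -big_mkcond /=; have [Hin|Hout] := boolP ((exponent a + beta *+ q)%MM \in msupp f).
  by rewrite -big_filter filter_pred1_uniq ?msupp_uniq // big_seq1.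
rewrite big1_seq ?(memN_msupp_eq0 Hout) // => mn /andP[/eqP-> H].
by rewrite H in Hout.
Qed.

Lemma iso_linear a : linear (iso a).
Proof. by move=> c f g; apply/mpolyP=> mn; rewrite mcoeffD mcoeffZ !mcoeff_iso mcoeffD mcoeffZ. Qed.

Lemma iso_mon a mn : iso a 'X_[mn] = if congruent a mn then 'X_[mnm_div mn] else 0.
Proof. by rewrite /iso msuppX big_mkcond big_seq1 mcoeffX eqxx scale1r. Qed.

Lemma iso_mulXq a i f : iso a ('X_i ^+ q * f) = 'X_i * iso a f.
Proof.
elim/mpolyind: f => [|c mn f _ _ IH].
  by rewrite mulr0 (lin_fun0 (iso_linear a)) mulr0.
rewrite mulrDr (lin_funD (iso_linear a)) IH (iso_linear a) mulrDr; congr (_ + _).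
rewrite -!scalerAr (lin_funZ (iso_linear a)); congr (_ *: _).
rewrite mpolyXn -mpolyXD !iso_mon.
have -> : congruent a (U_(i) *+ q + mn) = congruent a mn.
  by apply: eq_forallb => j; rewrite mnmDE mulmnE modnMDl.
case: ifP => _; last by rewrite mulr0.
rewrite -mpolyXD; congr 'X_[_]; apply/mnmP=> j.
by rewrite mnmDE !mnmE mulmnE divnMDl // mnm1E.
Qed.

(** A is free over the polynomials in the x_i^q, with the x^a, 0 <= a_i < q, as a basis. [iso a] is
    the coordinate along x^a, and this is its linearity over that subring. *)
Lemma iso_mul_pow a f g : iso a (f * pow_vars g) = iso a f * g.
Proof.
elim/mpoly_mulX_ind: g f => [|c g1 g2 E1 E2|i g E] f.
- by rewrite rmorph1 !mulr1.
- rewrite linearP !mulrDr -!scalerAr -E1 -E2; exact: iso_linear.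
- by rewrite rmorphM /= pow_varsX mulrCA iso_mulXq E mulrCA.
Qed.

Lemma iso_exponent a b : iso a 'X_[exponent b] = (a == b)%:R.
Proof.
rewrite iso_mon; have -> : congruent a (exponent b) = (a == b).
  apply/forallP/eqP => [E|-> i]; last by rewrite mnmE modn_small.
  by apply/ffunP=> i; apply: val_inj; rewrite /= -(eqP (E i)) mnmE modn_small.
case: eqP => // _; rewrite -mpolyX0; congr 'X_[_]; apply/mnmP=> i.
by rewrite !mnmE divn_small.
Qed.

Lemma iso_sum f : f = \sum_a 'X_[exponent a] * pow_vars (iso a f).
Proof.
elim/mpolyind: f => [|c mn f _ _ {1}->].
  by rewrite big1 // => a _; rewrite (lin_fun0 (iso_linear a)) rmorph0 mulr0.
have E a : 'X_[exponent a] * pow_vars (iso a (c *: 'X_[mn] + f)) =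
    c *: ('X_[exponent a] * pow_vars (iso a 'X_[mn])) + 'X_[exponent a] * pow_vars (iso a f).
  by rewrite iso_linear linearP mulrDr -scalerAr.
under [RHS]eq_bigr do rewrite E.
rewrite big_split -scaler_sumr /=; congr (_ *: _ + _).
have aP i : (mn i %% q < q)%N by rewrite ltn_pmod.
pose a := [ffun i => Ordinal (aP i)] : {ffun 'I_n -> 'I_q}.
have Ea b : congruent b mn = (b == a).
  apply/forallP/eqP => [E'|-> i]; last by rewrite ffunE.
  by apply/ffunP=> i; apply: val_inj; rewrite ffunE /= -(eqP (E' i)).
rewrite (bigD1 a) //= big1 => [|b ba]; last first.
  by rewrite iso_mon Ea (negPf ba) rmorph0 mulr0.
rewrite addr0 iso_mon Ea eqxx pow_vars_mon -mpolyXD; congr 'X_[_].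
apply/eqP; rewrite -congruentE Ea !eqxx //.
Qed.

End IsotypicComponents.

Section VermaIsotypic.
Variables (K : fieldType) (n d q : nat).
Hypothesis q0 : (0 < q)%N.
Local Notation V := (verma K n d).
Implicit Types (v w : V) (a : {ffun 'I_n -> 'I_q}).

Definition verma_iso a v : V := [ffun j => iso a (v j)].

Lemma verma_iso_linear a : linear (verma_iso a).
Proof. by move=> c v w; apply/ffunP=> j; rewrite !ffunE iso_linear. Qed.

Lemma verma_pow_vars_linear : linear (verma_pow_vars q : V -> V).
Proof. by move=> c v w; apply/ffunP=> j; rewrite !ffunE linearP. Qed.

Lemma verma_pow_varsM f v :
  verma_pow_vars q (verma_mul f v) = verma_mul (pow_vars q f) (verma_pow_vars q v).
Proof. by apply/ffunP=> j; rewrite !ffunE rmorphM. Qed.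

Lemma verma_iso_pow a f v :
  verma_iso a (verma_mul f (verma_pow_vars q v)) = verma_mul (iso a f) v.
Proof. by apply/ffunP=> j; rewrite !ffunE iso_mul_pow. Qed.

Lemma verma_iso_sum v :
  v = \sum_a verma_mul 'X_[exponent a] (verma_pow_vars q (verma_iso a v)).
Proof.
apply/ffunP=> j; rewrite sum_ffunE [LHS](iso_sum q0).
by apply: eq_bigr => a _; rewrite !ffunE.
Qed.

(** The component a of f U(x^q) is [iso a f] times U, which is where the stability of J under A
    enters. *)
Lemma mem_Jq (J : V -> Prop) v : subspace J ->
  (forall f w, J w -> J (verma_mul f w)) ->
  v \in Jq q J <-> forall a, J (verma_iso a v).
Proof.
move=> Js Jm; split=> [Jv a|Jv].
  move: v Jv; apply: A_span_ind => [|v w Jv Jw|f w [u Ju ->]].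
  - rewrite (lin_fun0 (verma_iso_linear a)); exact: subspace0 Js.
  - rewrite (lin_funD (verma_iso_linear a)); exact: subspaceD Js _ _ Jv Jw.
  - by rewrite verma_iso_pow; apply: Jm.
rewrite (verma_iso_sum v); apply: rpred_sum => a _.
by apply: A_span_mul; apply: mem_A_span; exists (verma_iso a v).
Qed.

End VermaIsotypic.

Lemma sum_root1 (R : idomainType) q (z : R) : z ^+ q = 1 -> z != 1 ->
  \sum_(l < q) z ^+ l = 0.
Proof.
move=> zq z1; have := subrXX z 1 q; rewrite zq expr1n subrr => /esym/eqP.
rewrite mulf_eq0 subr_eq0 (negPf z1) /= => /eqP E; rewrite -[RHS]E.
rewrite (reindex_inj rev_ord_inj) /=; apply: eq_bigr => l _.
by rewrite expr1n mulr1 -subn1 -subnDA add1n.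
Qed.

(** * Divided differences summed over the qth roots of unity *)

Section SumOverRoots.
Variables (K : fieldType) (n q : nat) (om : K).
Hypothesis omP : q.-primitive_root om.
Local Notation A := {mpoly K[n]}.
Implicit Types (F : A) (i j : 'I_n) (w : K).

Let q0 : (0 < q)%N. Proof. exact: prim_order_gt0 omP. Qed.
Let om0 : om != 0.
Proof. by apply: (root1_neq0 q0); rewrite (prim_expr_order omP). Qed.

Lemma om_exp1 t : (om ^+ t) ^+ q = 1.
Proof. by rewrite -exprM mulnC exprM (prim_expr_order omP) expr1n. Qed.

Lemma om_exp_neq1 t : (0 < t < q)%N -> om ^+ t != 1.
Proof.
case/andP=> t0 tq; rewrite -(prim_order_dvd omP).
by apply/negP => /(dvdn_leq t0); rewrite leqNgt tq.
Qed.

(** The sum of om^(l t) over l vanishes unless q divides t; as t < c <= q, only t = 0 survives. *)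
Lemma sum_quot_roots (x y : A) w c : (0 < c <= q)%N ->
  \sum_(l < q) \sum_(t < c) x ^+ (c.-1 - t) * ((w * om ^+ l) *: y) ^+ t =
  q%:R *: x ^+ c.-1.
Proof.
case/andP; case: c => // c _ cq; rewrite exchange_big /= big_ord_recl /= subn0.
rewrite [X in _ + X]big1 ?addr0 => [|t _].
  under eq_bigr do rewrite expr0 mulr1.
  by rewrite sumr_const card_ord scaler_nat.
under eq_bigr do rewrite exprZn exprMn -[om ^+ _ ^+ _]exprM mulnC exprM
  -scalerAr -scalerA.
rewrite -scaler_sumr -scaler_suml sum_root1 ?scale0r ?scaler0 ?om_exp1 //.
by apply: om_exp_neq1; rewrite /= (leq_ltn_trans _ cq) // ltn_ord.
Qed.

Lemma lin_s_root i j w : lin_poly (s_root i j w : 'rV[K]_n) = 'X_i - w *: 'X_j.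
Proof. by rewrite lin_polyB lin_polyZ !lin_poly_delta. Qed.

Local Notation dd i j w := (divdiff (s_mx i j w) (s_root i j w)).

Lemma divdiff_X i j w c : i != j -> w != 0 ->
  dd i j w ('X_i ^+ c) = \sum_(t < c) 'X_i ^+ (c.-1 - t) * (w *: 'X_j) ^+ t.
Proof.
move=> ij w0; apply: (divdiff_uniq (s_moves ij w0)).
by rewrite lin_s_root mulrC -subrXX rmorphXn /= s_act // eqxx.
Qed.

Lemma divdiff_Xj i j w c : i != j -> w != 0 ->
  dd i j w ('X_j ^+ c) =
  - \sum_(t < c) w ^- (c - t) *: ('X_i ^+ (c.-1 - t) * 'X_j ^+ t).
Proof.
move=> ij w0; apply: (divdiff_uniq (s_moves ij w0)).
have -> : \sum_(t < c) w ^- (c - t) *: ('X_i ^+ (c.-1 - t) * 'X_j ^+ t) =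
    w ^- c *: \sum_(t < c) 'X_i ^+ (c.-1 - t) * (w *: 'X_j) ^+ t :> A.
  rewrite scaler_sumr; apply: eq_bigr => t _.
  rewrite exprZn -scalerAr scalerA; congr (_ *: _).
  by rewrite expfB // invf_div mulrC.
rewrite lin_s_root mulNr -scalerAl [X in - (_ *: X)]mulrC -subrXX.
rewrite rmorphXn /= s_act // eq_sym (negPf ij) eqxx !exprZn scalerBr scalerA.
by rewrite mulVf ?expf_neq0 // scale1r opprB exprVn.
Qed.

(** A factor fixed by all the reflections of the sum is pulled out, since x_i x_j and the other
    variables are fixed. There remains a power of x_i or of x_j with exponent c = |a_i - a_j| < q,
    where a is the exponent [mn]. A power of x_i falls under [sum_quot_roots]. For x_j the weights
    occur with exponents -(c - t), where 0 < c - t < q, so that every term sums to 0. *)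
Lemma sum_divdiff_mon (mn : 'X_{1..n}) i j w : i != j -> w != 0 ->
  (mn i < q)%N -> (mn j < q)%N ->
  \sum_(l < q) 'X_i * dd i j (w * om ^+ l) 'X_[mn] =
  (if (mn j < mn i)%N then q%:R else 0) *: 'X_[mn].
Proof.
move=> ij w0 iq jq.
have wl0 l : w * om ^+ l != 0 by rewrite mulf_neq0 ?expf_neq0.
pose rest : A := \prod_(b | (b != i) && (b != j)) 'X_b ^+ mn b.
have EX : 'X_[mn] = rest * ('X_i ^+ mn i * 'X_j ^+ mn j).
  rewrite mpolyXE_id (bigD1 i) //= (bigD1 j) 1?eq_sym //=.
  by rewrite mulrCA mulrA mulrC [X in _ * X]mulrC.
have fixR l : poly_act (s_mx i j (w * om ^+ l)) rest = rest.
  rewrite rmorph_prod; apply: eq_bigr => b /andP[/negPf bi /negPf bj].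
  by rewrite rmorphXn /= s_act // bi bj.
have fixP l c : poly_act (s_mx i j (w * om ^+ l)) (('X_i * 'X_j) ^+ c) = ('X_i * 'X_j) ^+ c.
  rewrite rmorphXn rmorphM /= !s_act // eqxx eq_sym (negPf ij) eqxx.
  by rewrite -scalerAl -scalerAr scalerA mulfV // scale1r mulrC.
case: (leqP (mn j) (mn i)) => [le_ji|lt_ij].
  pose c := (mn i - mn j)%N.
  have {}EX : 'X_[mn] = rest * ('X_i * 'X_j) ^+ mn j * 'X_i ^+ c.
    by rewrite EX -mulrA; congr (_ * _); rewrite exprMn mulrAC -exprD subnKC.
  have Ed l : 'X_i * dd i j (w * om ^+ l) 'X_[mn] = rest * ('X_i * 'X_j) ^+ mn j *
      ('X_i * dd i j (w * om ^+ l) ('X_i ^+ c)).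
    rewrite EX (divdiff_fixedM (s_moves ij (wl0 l))); first by rewrite mulrCA.
    by rewrite rmorphM /= fixR fixP.
  under eq_bigr do rewrite Ed.
  rewrite -mulr_sumr -mulr_sumr EX.
  under eq_bigr do rewrite divdiff_X //.
  rewrite -subn_gt0 -/c; case: (posnP c) => [->|c0].
    by rewrite scale0r big1 ?mulr0 // => l _; rewrite big_ord0.
  rewrite sum_quot_roots ?c0 /=; last by rewrite (leq_trans (leq_subr _ _)) // ltnW.
  by rewrite -!scalerAr -exprS prednK.
rewrite ltnNge ltnW //= scale0r.
pose c := (mn j - mn i)%N.
have {}EX : 'X_[mn] = rest * ('X_i * 'X_j) ^+ mn i * 'X_j ^+ c.
  by rewrite EX -mulrA; congr (_ * _); rewrite exprMn -mulrA -exprD subnKC // ltnW.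
have Ed l : 'X_i * dd i j (w * om ^+ l) 'X_[mn] = rest * ('X_i * 'X_j) ^+ mn i *
    ('X_i * dd i j (w * om ^+ l) ('X_j ^+ c)).
  rewrite EX (divdiff_fixedM (s_moves ij (wl0 l))); first by rewrite mulrCA.
  by rewrite rmorphM /= fixR fixP.
under eq_bigr do rewrite Ed divdiff_Xj //.
rewrite -!mulr_sumr sumrN exchange_big big1 ?oppr0 ?mulr0 // => t _ /=.
rewrite -scaler_suml.
have -> : \sum_(l < q) (w * om ^+ l) ^- (c - t) = 0; last by rewrite scale0r.
have Ez l : (w * om ^+ l) ^- (c - t) = w ^- (c - t) * (om ^- (c - t)) ^+ l.
  by rewrite exprMn invfM; congr (_ * _); rewrite -!exprVn -!exprM mulnC.
under eq_bigr do rewrite Ez.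
rewrite -mulr_sumr sum_root1 ?mulr0 //.
  by rewrite exprVn om_exp1 invr1.
rewrite -[1]invr1 (inj_eq invr_inj) om_exp_neq1 // subn_gt0 ltn_ord /=.
by rewrite (leq_ltn_trans (leq_subr _ _)) // (leq_ltn_trans (leq_subr _ _)).
Qed.

(** A monomial matrix sends variables to multiples of variables, and (u x_b)^q = u^q x_b^q; for a
    general matrix the substitution would not commute with the action. *)
Lemma pow_poly_act (s : 'S_n) (u : 'I_n -> K) F : (forall a, u a != 0) ->
  pow_vars q (poly_act (mono_mx s (fun a => u a ^+ q)) F) =
  poly_act (mono_mx s u) (pow_vars q F).
Proof.
move=> u0; have uq0 a : u a ^+ q != 0 by rewrite expf_neq0.
have actX v b : (forall a, v a != 0) ->
    poly_act (mono_mx s v) 'X_b = (v ((s^-1)%g b))^-1 *: 'X_((s^-1)%g b).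
  move=> v0; rewrite -[in LHS](permKV s b) -[in LHS]lin_poly_delta poly_act_lin.
  by rewrite delta_mono_inv // lin_polyZ lin_poly_delta.
apply: (eq_mpoly_morph (phi := pow_vars q \o poly_act (mono_mx s (fun a => u a ^+ q)))
                       (psi := poly_act (mono_mx s u) \o pow_vars q)) => [c|b] /=.
  by rewrite pow_varsC !poly_actC pow_varsC.
by rewrite pow_varsX rmorphXn /= !actX // linearZ /= pow_varsX exprZn exprVn.
Qed.

Lemma pow_s_act i j w l F : i != j -> w != 0 ->
  poly_act (s_mx i j (w * om ^+ l)) (pow_vars q F) =
  pow_vars q (poly_act (s_mx i j (w ^+ q)) F).
Proof.
move=> ij w0; have wl0 : w * om ^+ l != 0 by rewrite mulf_neq0 ?expf_neq0.
have -> : w ^+ q = (w * om ^+ l) ^+ q by rewrite exprMn om_exp1 mulr1.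
rewrite -(pow_entries_s _ q0 ij) (s_mxE _ ij) (pow_entries_mono _ _ q0).
rewrite (pow_poly_act _ _ (u := fun a => _)) // => a.
by do 2?[case: ifP => _]; rewrite ?invr_eq0 ?oner_eq0.
Qed.

(** Twisted Leibniz rule for x^a times F(x^q). The action on F(x^q) involves w^q only and hence not
    l. The divided difference of F(x^q) is that of F, taken at x^q, times (x_i^q - w^q x_j^q) / (x_i
    - w om^l x_j), and the sum of these quotients over l is q x_i^(q-1). *)
Lemma sum_divdiff (mn : 'X_{1..n}) i j w F : i != j -> w != 0 ->
  (mn i < q)%N -> (mn j < q)%N ->
  \sum_(l < q) 'X_i * dd i j (w * om ^+ l) ('X_[mn] * pow_vars q F) =
  'X_[mn] * pow_vars q (q%:R *: ('X_i * dd i j (w ^+ q) F) +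
     (if (mn j < mn i)%N then q%:R else 0) *: poly_act (s_mx i j (w ^+ q)) F).
Proof.
move=> ij w0 iq jq.
have wl0 l : w * om ^+ l != 0 by rewrite mulf_neq0 ?expf_neq0.
have ddF l : dd i j (w * om ^+ l) (pow_vars q F) = pow_vars q (dd i j (w ^+ q) F) *
    \sum_(t < q) 'X_i ^+ (q.-1 - t) * ((w * om ^+ l) *: 'X_j) ^+ t.
  apply: (divdiff_uniq (s_moves ij (wl0 l))).
  rewrite pow_s_act // -mulrA lin_s_root [X in _ * X]mulrC -subrXX exprZn.
  have -> : (w * om ^+ l) ^+ q = w ^+ q by rewrite exprMn om_exp1 mulr1.
  rewrite -!pow_varsX -linearZ -rmorphB -rmorphM /= -lin_s_root.
  by rewrite (divdiffE (s_moves ij _)) ?expf_neq0 // rmorphB.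
have Ed l : 'X_i * dd i j (w * om ^+ l) ('X_[mn] * pow_vars q F) =
    ('X_i * dd i j (w * om ^+ l) 'X_[mn]) * pow_vars q (poly_act (s_mx i j (w ^+ q)) F) +
    'X_[mn] * pow_vars q (dd i j (w ^+ q) F) * ('X_i *
    \sum_(t < q) 'X_i ^+ (q.-1 - t) * ((w * om ^+ l) *: 'X_j) ^+ t).
  by rewrite (divdiffMr (s_moves ij (wl0 l))) pow_s_act // ddF; ring.
under eq_bigr do rewrite Ed.
rewrite big_split /= -[X in X + _]mulr_suml -[X in _ + X]mulr_sumr.
rewrite -[X in _ + _ * X]mulr_sumr sum_divdiff_mon //.
rewrite sum_quot_roots ?q0 ?leqnn // -scalerAr -exprS prednK // -pow_varsX.
rewrite rmorphD /= 2!linearZ /= rmorphM /= mulrDr addrC -!scalerAr -scalerAl.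
by congr (_ *: _ + _); ring.
Qed.

End SumOverRoots.

(** * The operators x_i D_i on the components of the pullback *)

Section PullbackVerma.
Variables (K : fieldType) (m r n : nat) (xi : K) (c0 ct : nat -> K) (d : nat).
Variable tau' : 'M[K]_n -> 'M[K]_d.
Hypotheses (m0 : (0 < m)%N) (rm : (r %| m)%N) (xiP : m.-primitive_root xi).
Hypothesis tauP : mx_rep (Gmrn (K := K) (n := n) r r) tau'.

Local Notation q := (m %/ r)%N.
Local Notation om := (xi ^+ r).
Local Notation ze := (xi ^+ q).
Local Notation V := (verma K n d).
Local Notation G := (Gmrn (K := K) (n := n) m r).
Local Notation tau := (fun g : 'M[K]_n => tau' (pow_entries q g)).
Local Notation cl := (s_classes r n).
Local Notation D := (@dunkl_i K m r n xi c0 ct d tau).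
Local Notation D' := (@dunkl_i K r r n ze c0 ct d tau').
Local Notation exponent := (@exponent n q).
Implicit Types (a : {ffun 'I_n -> 'I_q}) (U v : V).

Lemma r_gt0 : (0 < r)%N. Proof. exact: dvdn_gt0 m0 rm. Qed.

Lemma q_gt0 : (0 < q)%N. Proof. by rewrite divn_gt0 ?r_gt0 // dvdn_leq. Qed.

Lemma prim_om : q.-primitive_root om.
Proof.
have := prim_root_divn (dvdn_div rm) xiP.
by rewrite divnA // mulKn.
Qed.

Lemma prim_ze : r.-primitive_root ze.
Proof. exact: prim_root_divn rm xiP. Qed.

Lemma pullback_rep : mx_rep G tau.
Proof.
split=> [|g h Gg Gh].
  rewrite -{1}(@mono_mx1 K n) pow_entries_mono ?q_gt0 //.
  rewrite (eq_mono_mx _ (v := fun=> 1)) ?mono_mx1; last by move=> a; rewrite expr1n.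
  by case: tauP.
rewrite (pow_entriesM m0 q_gt0 Gg Gh); case: tauP => _; apply.
  exact: pow_entries_Gmrn m0 r_gt0 rm Gg.
exact: pow_entries_Gmrn m0 r_gt0 rm Gh.
Qed.

Lemma tens_pow_vars (phi : {mpoly K[n]} -> {mpoly K[n]}) M U :
  tens phi M (verma_pow_vars q U) = tens (fun f => phi (pow_vars q f)) M U.
Proof. by apply/ffunP=> i; rewrite !ffunE; apply: eq_bigr => j _; rewrite ffunE. Qed.

Lemma pow_vars_tens (psi : {mpoly K[n]} -> {mpoly K[n]}) M U :
  tens (fun f => pow_vars q (psi f)) M U = verma_pow_vars q (tens psi M U).
Proof.
apply/ffunP=> i; rewrite !ffunE linear_sum; apply: eq_bigr => j _.
by rewrite linearZ.
Qed.

Lemma verma_act_pow g U : G g ->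
  verma_act tau g (verma_pow_vars q U) =
  verma_pow_vars q (verma_act tau' (pow_entries q g) U).
Proof.
move=> Gg; rewrite /verma_act tens_pow_vars -pow_vars_tens; apply: eq_tens => f.
have [s [u [-> um _]]] := (GmrnP r m0 g).1 Gg.
rewrite (pow_entries_mono _ _ q_gt0); symmetry.
by apply: pow_poly_act => a; apply: (root1_neq0 m0 (um a)).
Qed.

(** Replacing k by k + r l changes neither the parameter, as [s_classes] divides r, nor the image in
    G'; the sum over l therefore acts on the divided differences alone. *)
Lemma sum_s_op a i j U : i != j ->
  \sum_(k < m) c0 (k %% cl)%N *:
    verma_mul 'X_i (s_op tau i j (xi ^+ k)
      (verma_mul 'X_[exponent a] (verma_pow_vars q U))) =
  verma_mul 'X_[exponent a] (verma_pow_vars q (\sum_(k < r) c0 (k %% cl)%N *: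
    (q%:R *: verma_mul 'X_i (s_op tau' i j (ze ^+ k) U) +
     (if (a j < a i)%N then q%:R else 0) *: verma_act tau' (s_mx i j (ze ^+ k)) U))).
Proof.
move=> ij; have n1 := ord_neq_gt1 ij; have xi0 := xi_neq0 m0 xiP.
have L := verma_mul_linear (d := d) 'X_[K, exponent a].
rewrite (lin_fun_sum (@verma_pow_vars_linear _ _ _ q)) (lin_fun_sum L).
set F := (fun k : nat => c0 (k %% cl)%N *:
    verma_mul 'X_i (s_op tau i j (xi ^+ k)
      (verma_mul 'X_[exponent a] (verma_pow_vars q U)))).
have -> : \sum_(k < m) c0 (k %% cl)%N *: verma_mul 'X_i (s_op tau i j (xi ^+ k)
    (verma_mul 'X_[exponent a] (verma_pow_vars q U))) = \sum_(k < r * q) F k.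
  by rewrite mulnC divnK.
rewrite sum_mod_split; apply: eq_bigr => k _.
rewrite (lin_funZ (@verma_pow_vars_linear _ _ _ q)) (lin_funZ L).
have clr : (cl %| r)%N by apply: s_classes_dvd.
have EF l : F (k + r * l)%N = c0 (k %% cl)%N *:
    tens (fun f => 'X_i * divdiff (s_mx i j (xi ^+ k * om ^+ l))
                     (s_root i j (xi ^+ k * om ^+ l)) ('X_[exponent a] * pow_vars q f))
         (tau' (s_mx i j (ze ^+ k))) U.
  rewrite /F; congr (_ *: _).
    by congr c0; rewrite -modnDmr (eqP (dvdn_mulr l clr)) addn0.
  rewrite exprD exprM /s_op -tens_mull -tens_mulr tens_pow_vars.
  congr (tens _ (tau' _) _); rewrite (pow_entries_s _ q_gt0 ij) exprMn.
  by rewrite (om_exp1 prim_om) mulr1 -!exprM mulnC.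
under eq_bigr do rewrite EF.
rewrite -scaler_sumr -(tens_suml xpredT); congr (_ *: _).
rewrite (eq_tens _ _ (psi := fun f => 'X_[exponent a] * pow_vars q
   (q%:R *: ('X_i * divdiff (s_mx i j (ze ^+ k)) (s_root i j (ze ^+ k)) f) +
   (if (a j < a i)%N then q%:R else 0) *: poly_act (s_mx i j (ze ^+ k)) f))); last first.
  move=> f; have -> : ze ^+ k = (xi ^+ k) ^+ q by rewrite -!exprM mulnC.
  have -> : (a j < a i)%N = (exponent a j < exponent a i)%N by rewrite !mnmE.
  by apply: (sum_divdiff prim_om f ij (expf_neq0 k xi0)); rewrite mnmE.
rewrite tens_mull pow_vars_tens; congr (verma_mul _ (verma_pow_vars _ _)).
by rewrite tensDl !tensZl tens_mull.
Qed.

Definition t_weight (b : nat) : K := - \sum_(k < q | (0 < k)%N) ct k * (1 - om ^+ (k * b)).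

(** t_i^k acts trivially on tau, and the factor x_i undoes the division by the root. What is left is
    1 - t_i^k on its eigenvector x^a U(x^q). *)
Lemma t_op_iso a i k U :
  verma_mul 'X_i (t_op tau i (xi ^+ (r * k))
    (verma_mul 'X_[exponent a] (verma_pow_vars q U))) =
  (1 - om ^+ (k * a i)) *: verma_mul 'X_[exponent a] (verma_pow_vars q U).
Proof.
have xi0 := xi_neq0 m0 xiP; have w0 : xi ^+ (r * k) != 0 by apply: expf_neq0.
rewrite /t_op (pow_entries_t _ q_gt0); last exact: xirX_root rm xiP k.
have -> : tau' 1%:M = 1%:M by case: tauP.
rewrite -tens_mull -tens_mulr tens_pow_vars.
rewrite (eq_tens _ _ (psi := fun f => (1 - om ^+ (k * a i)) *:
    ('X_[exponent a] * pow_vars q f))).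
  by rewrite tensZl tens_mull pow_vars_tens tens1.
move=> f; have mv := t_moves i w0.
have -> : 'X_i = lin_poly (delta_mx 0 i : 'rV[K]_n) by rewrite lin_poly_delta.
rewrite mulrC (divdiffE mv) rmorphM /=.
have -> : poly_act (t_mx i (xi ^+ (r * k))) (pow_vars q f) = pow_vars q f.
  apply: (eq_mpoly_morph (phi := poly_act (t_mx i (xi ^+ (r * k))) \o pow_vars q)
                         (psi := pow_vars q)) => [c|b] /=.
    by rewrite pow_varsC poly_actC.
  rewrite pow_varsX rmorphXn /= t_act //; case: ifP => // _.
  by rewrite exprZn (xirX_root rm xiP) scale1r.
have -> : poly_act (t_mx i (xi ^+ (r * k))) 'X_[exponent a] =
    om ^+ (k * a i) *: 'X_[exponent a].
  rewrite mpolyXE_id rmorph_prod (bigD1 i) //= [in RHS](bigD1 i) //= scalerAl.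
  congr (_ * _); last first.
    by apply: eq_bigr => b /negPf bi; rewrite rmorphXn /= t_act // bi.
  by rewrite rmorphXn /= t_act // eqxx exprZn mnmE -!exprM mulnA.
by rewrite -scalerAl scalerBl scale1r.
Qed.

Lemma dunkl_i_rr i U : D' i U =
  - \sum_(j | j != i) \sum_(k < r) c0 (k %% cl)%N *: s_op tau' i j (ze ^+ k) U.
Proof.
rewrite /dunkl_i [X in - (_ + X)]big1 ?addr0 // => k k0.
have k1 : (k < 1)%N by apply: leq_trans (ltn_ord k) _; rewrite divnn r_gt0.
by rewrite ltnNge -ltnS k1 in k0.
Qed.

(** The operator B - d_(a_i) of the overview, free of the parameters of the t_i^k. *)
Definition base_dunkl i a U : V :=
  q%:R *: verma_mul 'X_i (D' i U) -
  \sum_(j | j != i) \sum_(k < r) (c0 (k %% cl)%N * (if (a j < a i)%N then q%:R else 0)) *: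
     verma_act tau' (s_mx i j (ze ^+ k)) U.

(* The operator induced by x_i D_i on the component x^a A^(q) (x) tau; the
   parameters of the t_i^k enter only through the scalar t_weight (a i). *)
Definition iso_dunkl i a U : V := base_dunkl i a U + t_weight (a i) *: U.

Lemma mulX_dunkl_iso i a U :
  verma_mul 'X_i (D i (verma_mul 'X_[exponent a] (verma_pow_vars q U))) =
  verma_mul 'X_[exponent a] (verma_pow_vars q (iso_dunkl i a U)).
Proof.
have L := verma_mul_linear (d := d) 'X_[K, exponent a].
have P := @verma_pow_vars_linear K n d q.
have X := verma_mul_linear (d := d) ('X_i : {mpoly K[n]}).
rewrite /dunkl_i (lin_funN X) (lin_funD X) !(lin_fun_sum X).
have -> : \sum_(k < q | (0 < k)%N) verma_mul 'X_i (ct k *: t_op tau i (xi ^+ (r * k))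
      (verma_mul 'X_[exponent a] (verma_pow_vars q U))) =
    verma_mul 'X_[exponent a] (verma_pow_vars q (- t_weight (a i) *: U)).
  rewrite (lin_funZ P) (lin_funZ L) /t_weight opprK scaler_suml.
  by apply: eq_bigr => k _; rewrite (lin_funZ X) t_op_iso scalerA.
have -> : \sum_(j | j != i) verma_mul 'X_i (\sum_(k < m) c0 (k %% cl)%N *:
      s_op tau i j (xi ^+ k) (verma_mul 'X_[exponent a] (verma_pow_vars q U))) =
    verma_mul 'X_[exponent a] (verma_pow_vars q (\sum_(j | j != i) \sum_(k < r)
     c0 (k %% cl)%N *: (q%:R *: verma_mul 'X_i (s_op tau' i j (ze ^+ k) U) +
     (if (a j < a i)%N then q%:R else 0) *: verma_act tau' (s_mx i j (ze ^+ k)) U))).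
  rewrite (lin_fun_sum P) (lin_fun_sum L); apply: eq_bigr => j ji.
  rewrite (lin_fun_sum X) -sum_s_op 1?eq_sym //.
  by apply: eq_bigr => k _; rewrite (lin_funZ X).
rewrite -(lin_funD L) -(lin_funD P) -(lin_funN L) -(lin_funN P).
congr (verma_mul _ (verma_pow_vars _ _)).
rewrite /iso_dunkl /base_dunkl opprD scaleNr opprK; congr (_ + _).
rewrite [D' i U]dunkl_i_rr (lin_funN X) scalerN -opprD; congr (- _).
rewrite !(lin_fun_sum X) scaler_sumr -big_split; apply: eq_bigr => j ji.
rewrite (lin_fun_sum X) scaler_sumr -big_split; apply: eq_bigr => k _ /=.
by rewrite (lin_funZ X) scalerDr !scalerA [q%:R * _]mulrC.
Qed.

End PullbackVerma.

(** * Generic parameters *)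

Section StableFamilies.
Variables (K : fieldType) (S : subringClosed K).

Lemma char_poly_over N (A : 'M[K]_N) : (forall i j, A i j \in S) ->
  char_poly A \is a polyOver S.
Proof.
move=> AS; rewrite /char_poly /determinant rpred_sum // => s _.
rewrite rpredMsign rpred_prod // => i _.
by rewrite !mxE rpredB ?polyOverC // rpredMn ?polyOverX.
Qed.

(* x is not an eigenvalue of B on the span of the family w, because the
   eigenvalues are roots of a monic polynomial over S (Cayley-Hamilton). *)
Lemma stable_family_cancel (V : lmodType K) (J : V -> Prop) (B : V -> V)
    N (w : 'I_N -> V) (C : 'M[K]_N) (kappa : 'rV[K]_N) (x : K) :
  subspace J -> linear B -> (forall v, J v -> J (B v)) ->
  (forall i, B (w i) = \sum_j C i j *: w j) -> (forall i j, C i j \in S) ->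
  (forall p, p \is monic -> p \is a polyOver S -> ~~ root p x) ->
  let u := \sum_i kappa 0 i *: w i in J (B u - x *: u) -> J u.
Proof.
case: N w C kappa => [|N] w C kappa Js BL BJ BC CS nroot u Ju.
  by rewrite /u big_ord0; case: Js.
(* The family w need not be free, so the computation takes place on coefficient rows, where B
   becomes right multiplication by C. *)
pose L (k : 'rV[K]_N.+1) := \sum_i k 0 i *: w i.
have LL : linear L.
  move=> c k1 k2; rewrite /L scaler_sumr -big_split; apply: eq_bigr => i _ /=.
  by rewrite !mxE scalerDl scalerA.
have BLE k : B (L k) = L (k *m C).
  rewrite /L (lin_fun_sum BL).
  under eq_bigr do rewrite (lin_funZ BL) BC scaler_sumr.
  rewrite exchange_big; apply: eq_bigr => j _; rewrite mxE scaler_suml.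
  by apply: eq_bigr => i _; rewrite scalerA.
have JD v1 v2 c : J v1 -> J v2 -> J (c *: v1 + v2) by case: Js => _; apply.
have Jpoly p k : J (L k) -> J (L (k *m horner_mx C p)).
  elim/poly_ind: p => [|p c IH] Jk.
    by rewrite rmorph0 mulmx0 (lin_fun0 LL); case: Js.
  rewrite rmorphD rmorphM /= horner_mx_X horner_mx_C mulmxDr mul_mx_scalar addrC LL.
  by apply: JD => //; rewrite mulmxA -BLE; apply/BJ/IH.
(* With chi the characteristic polynomial, chi - chi(x) = Q (X - x), hence (C - x) Q(C) = - chi(x),
   a nonzero scalar. Applying Q(C) to the element B u - x u of J leaves a nonzero multiple of u. *)
have /factor_theorem[Q EQ] : root (char_poly C - (char_poly C).[x]%:P) x.
  by rewrite rootE !hornerE subrr.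
have /eqP := nroot _ (char_poly_monic C) (char_poly_over CS).
set px := (char_poly C).[x] in EQ * => /eqP px0.
have := Jpoly Q (kappa *m (C - x%:M)).
have -> : L (kappa *m (C - x%:M)) = B u - x *: u.
  by rewrite mulmxBr mul_mx_scalar (lin_funB LL) (lin_funZ LL) -BLE.
move=> /(_ Ju).
have -> : kappa *m (C - x%:M) *m horner_mx C Q = - px *: kappa.
  have -> : C - x%:M = horner_mx C ('X - x%:P).
    by rewrite rmorphB /= horner_mx_X horner_mx_C.
  rewrite -mulmxA -[_ *m horner_mx C Q]rmorphM /= mulrC -EQ rmorphB /=.
  by rewrite Cayley_Hamilton horner_mx_C sub0r mulmxN mul_mx_scalar scaleNr.
rewrite (lin_funZ LL) => Jp.
have -> : u = (- px)^-1 *: (- px *: L kappa) + 0.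
  by rewrite addr0 scalerA mulVf ?scale1r // oppr_eq0.
by apply: JD => //; case: Js.
Qed.

End StableFamilies.

(** * Integral elements and transcendence of one parameter over the others *)

Section AlgebraicIndependence.
Variables (K : fieldType) (p : nat) (c : seq K).
Hypothesis pK : p \in [pchar K].
Hypothesis cP : alg_indep_prime c.
Variable idx : 'I_(size c).
Local Notation N := (size c).

(* Evaluation at c with the entry at idx replaced by 0; its image is the subring
   generated by the other entries. *)
Definition others : {mpoly int[N]} -> K :=
  mmap intr (fun i => if i == idx then 0 else c`_i).

HB.instance Definition _ := GRing.RMorphism.copy others
  (mmap (intr : int -> K) (fun i => if i == idx then 0 else c`_i)).

Lemma othersX i : i != idx -> others 'X_i = c`_i.
Proof. by move=> /negPf ii; rewrite /others mmapX mmap1U ii. Qed.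

(** [alg_indep_prime] speaks of natural coefficients; in characteristic p these cover the integers,
    because -1 = p - 1. *)
Lemma int_pchar_nat (z : int) : exists a : nat, z%:~R = a%:R :> K.
Proof.
case: z => k; first by exists k.
have p0 : p%:R = 0 :> K by apply: pcharf0 pK.
exists (k.+1 * p.-1)%N; rewrite NegzE mulrNz natrM.
have -> : p.-1%:R = -1 :> K.
  apply/eqP; rewrite -addr_eq0 -[1]/(1%:R) -natrD addn1 prednK ?p0 //.
  exact: prime_gt0 (pcharf_prime pK).
by rewrite mulrN1.
Qed.

(** An integral equation for the parameter at [idx] is turned into a relation between all
    parameters: psi clears the variable X_idx from the coefficients, and X_idx then replaces the
    unknown. The relation is nontrivial, because setting the other variables to 0 gives back a monic
    polynomial. *)
Lemma alg_indep_not_integral : ~ integralOver others c`_idx.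
Proof.
case=> P monP rootP.
pose psi : {rmorphism {mpoly int[N]} -> {mpoly int[N]}} :=
  comp_mpoly [tuple if i == idx then 0 else 'X_i | i < N].
pose Q0 := (map_poly psi P).['X_idx].
pose Q : {mpoly K[N]} := map_mpoly intr Q0.
have Q_eq0 : Q = 0.
  apply: cP => [mon|].
    by rewrite mcoeff_map_mpoly; apply: int_pchar_nat.
  pose ev : {rmorphism {mpoly int[N]} -> K} := meval (fun i : 'I_N => c`_i) \o map_mpoly intr.
  rewrite -[LHS]/(ev Q0) /Q0.
  have -> : ev (map_poly psi P).['X_idx] = (map_poly (ev \o psi) P).[ev 'X_idx].
    rewrite [RHS](_ : _ = (map_poly ev (map_poly psi P)).[ev 'X_idx]).
      exact: esym (horner_map ev _ _).
    by rewrite -map_poly_comp.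
  have -> : ev 'X_idx = c`_idx by rewrite /ev /= map_mpolyX mevalXU.
  have E : ev \o psi =1 others.
    apply: (eq_mpoly_morph (phi := ev \o psi) (psi := others)) => [z|i] /=.
      by rewrite /ev /psi /= comp_mpolyC map_mpolyC mevalC /others mmapC.
    rewrite /ev /psi /= comp_mpolyXU -tnth_nth tnth_mktuple.
    rewrite /others mmapX mmap1U; case: ifP => _; first by rewrite !rmorph0.
    by rewrite map_mpolyX mevalXU.
  by rewrite (eq_map_poly E); apply/eqP.
pose chi : {rmorphism {mpoly K[N]} -> {poly K}} := mmap polyC (fun i => if i == idx then 'X else 0).
pose th : {rmorphism {mpoly int[N]} -> K} := mmap intr (fun=> 0).
have : chi Q = map_poly th P.
  pose et : {rmorphism {mpoly int[N]} -> {poly K}} := chi \o map_mpoly intr.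
  rewrite -[LHS]/(et Q0) /Q0.
  have -> : et (map_poly psi P).['X_idx] = (map_poly (et \o psi) P).[et 'X_idx].
    rewrite [RHS](_ : _ = (map_poly et (map_poly psi P)).[et 'X_idx]).
      exact: esym (horner_map et _ _).
    by rewrite -map_poly_comp.
  have -> : et 'X_idx = 'X by rewrite /et /= map_mpolyX /chi mmapX mmap1U eqxx.
  have E : et \o psi =1 polyC \o th.
    apply: (eq_mpoly_morph (phi := et \o psi) (psi := polyC \o th)) => [z|i] /=.
      by rewrite /et /psi /= comp_mpolyC map_mpolyC /chi /th !mmapC.
    rewrite /et /psi /= comp_mpolyXU -tnth_nth tnth_mktuple.
    rewrite /th mmapX mmap1U polyC0; case: ifP => ii; first by rewrite !rmorph0.
    by rewrite map_mpolyX /chi mmapX mmap1U ii.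
  by rewrite (eq_map_poly E) map_poly_comp -[(_).['X]]/(_ \Po 'X) comp_polyXr.
rewrite Q_eq0 rmorph0 => /esym/eqP; apply/negP.
exact/monic_neq0/monic_map.
Qed.

Definition integral_closure : {pred K} := fun x => `[< integralOver others x >].

Lemma integral_closureP x : reflect (integralOver others x) (x \in integral_closure).
Proof. exact: asboolP. Qed.

Fact integral_subring : subring_closed integral_closure.
Proof.
split=> [|x y|x y].
- by apply/integral_closureP; apply: integral1.
- move=> /integral_closureP ix /integral_closureP iy; apply/integral_closureP.
  exact: integral_sub.
- move=> /integral_closureP ix /integral_closureP iy; apply/integral_closureP.
  exact: integral_mul.
Qed.

HB.instance Definition _ :=
  GRing.isSubringClosed.Build K integral_closure integral_subring.

Lemma integral_root_closure (f : {poly K}) x : f \is monic ->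
  f \is a polyOver integral_closure -> root f x -> x \in integral_closure.
Proof.
move=> fm fS fx; apply/integral_closureP; apply: integral_root_monic fm fx _.
by move=> y /(allP fS) /integral_closureP.
Qed.

Lemma integral_closure_other i : i != idx -> c`_i \in integral_closure.
Proof. by move=> ii; apply/integral_closureP; rewrite -othersX //; apply: integral_id. Qed.

(** By Fermat, 1/k = k^(p-2) in the prime field. *)
Lemma integral_closure_natV k : (k%:R)^-1 \in integral_closure.
Proof.
have pp := pcharf_prime pK; have [->|k0] := eqVneq (k%:R : K) 0.
  by rewrite invr0 rpred0.
suff -> : (k%:R : K)^-1 = k%:R ^+ p.-2 by rewrite rpredX ?rpred_nat.
apply: (mulfI k0); rewrite mulfV // -exprS; apply: (mulfI k0).
have kp : (k%:R : K) ^+ p = k%:R by rewrite -(pFrobenius_autE pK) pFrobenius_aut_nat.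
by rewrite mulr1 -exprS; case: p pp kp => [|[|p']].
Qed.

Lemma integral_closure_root1 k z : (0 < k)%N -> z ^+ k = 1 -> z \in integral_closure.
Proof.
move=> k0 zk; apply: (@integral_root_closure ('X^k - 1)).
- exact: monicXnsubC.
- by rewrite rpredB ?rpred1 // rpredX ?polyOverX.
- by rewrite rootE !hornerE zk subrr.
Qed.

(* 1 / (1 - z) = - (sum_(l < k) l z^l) / k *)
Lemma integral_closure_1subV k z : (0 < k)%N -> z ^+ k = 1 -> z != 1 ->
  k%:R != 0 :> K -> (1 - z)^-1 \in integral_closure.
Proof.
move=> k0 zk z1 kK; have z1' : 1 - z != 0 by rewrite subr_eq0 eq_sym.
suff -> : (1 - z)^-1 = - (k%:R^-1 * \sum_(l < k) l%:R * z ^+ l).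
  rewrite rpredN rpredM ?integral_closure_natV // rpred_sum // => l _.
  by rewrite rpredM ?rpred_nat // rpredX // (integral_closure_root1 k0).
apply: (mulfI z1'); rewrite mulfV // mulrN mulrCA.
suff -> : (1 - z) * (\sum_(l < k) l%:R * z ^+ l) = - k%:R.
  by rewrite mulrN opprK mulVf.
have H j : (1 - z) * (\sum_(l < j) l%:R * z ^+ l) =
    \sum_(l < j) z ^+ l.+1 - j%:R * z ^+ j.
  elim: j => [|j IH]; first by rewrite !big_ord0 mulr0 mul0r subrr.
  by rewrite !big_ord_recr mulrDr IH /= !exprS -natr1; ring.
rewrite H zk mulr1; under eq_bigr do rewrite exprS.
by rewrite -mulr_sumr sum_root1 // mulr0 sub0r.
Qed.

End AlgebraicIndependence.

(** * A finite spanning family with integral structure constants *)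

Section IntegralFamily.
Variables (K : fieldType) (n d r : nat) (ze : K) (tau' : 'M[K]_n -> 'M[K]_d).
Hypotheses (r0 : (0 < r)%N) (zeP : r.-primitive_root ze).
Hypothesis tauP : mx_rep (Gmrn (K := K) (n := n) r r) tau'.
Variable S : subringClosed K.
Hypothesis S_root : forall z : K, z ^+ r = 1 -> z \in S.

Local Notation V := (verma K n d).
Local Notation G' := (Gmrn (K := K) (n := n) r r).
Local Notation A := {mpoly K[n]}.
Implicit Types (g h : 'M[K]_n) (f : A).

(** [Gmrn] is a predicate on matrices over an arbitrary field; the codes give a finite type that
    covers G'. The extra code r stands for a zero entry. *)
Definition coded_mx (e : {ffun 'I_n * 'I_n -> 'I_r.+1}) : 'M[K]_n :=
  \matrix_(i, j) if (e (i, j) < r)%N then ze ^+ e (i, j) else 0.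

Lemma coded_mx_onto g : G' g -> exists e, g = coded_mx e.
Proof.
case=> _ _ gr _.
have H (ij : 'I_n * 'I_n) : exists k : 'I_r.+1,
    g ij.1 ij.2 = if (k < r)%N then ze ^+ k else 0.
  have [g0|/gr /(prim_rootP zeP)[k ->]] := eqVneq (g ij.1 ij.2) 0.
    by exists ord_max; rewrite ltnn.
  by exists (widen_ord (leqnSn r) k); rewrite /= ltn_ord.
have /all_tag[e eP] ij := cid (H ij).
by exists (finfun e); apply/matrixP=> i j; rewrite mxE ffunE -eP.
Qed.

(** The vector f (x) tau'(g) e_j. *)
Definition elem_tensor f g (j : 'I_d) : V := [ffun l => tau' g l j *: f].

Lemma elem_tensor_linear g j : linear (fun f => elem_tensor f g j).
Proof.
by move=> c f1 f2; apply/ffunP=> l; rewrite !ffunE scalerDr !scalerA mulrC.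
Qed.

Lemma tens_elem_tensor phi h f g j : linear phi -> G' h -> G' g ->
  tens phi (tau' h) (elem_tensor f g j) = elem_tensor (phi f) (h *m g) j.
Proof.
move=> phiL Gh Gg; apply/ffunP=> l; rewrite !ffunE.
under eq_bigr do rewrite ffunE (lin_funZ phiL) scalerA.
by rewrite -scaler_suml; have [_ ->] := tauP => //; rewrite mxE.
Qed.

Variable N : nat.

Definition family_index : finType :=
  ('X_{1..n < N} * {ffun 'I_n * 'I_n -> 'I_r.+1} * 'I_d)%type.

(** Codes of matrices outside G' contribute 0, which changes no span. *)
Definition family (t : family_index) : V :=
  if `[< G' (coded_mx t.1.2) >]
  then elem_tensor 'X_[t.1.1] (coded_mx t.1.2) t.2 else 0.

Definition int_span (v : V) : Prop := exists c : family_index -> K,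
  (forall t, c t \in S) /\ v = \sum_t c t *: family t.

Lemma int_span0 : int_span 0.
Proof.
exists (fun=> 0); split=> [t|]; first exact: rpred0.
by rewrite big1 // => t _; rewrite scale0r.
Qed.

Lemma int_spanD v w : int_span v -> int_span w -> int_span (v + w).
Proof.
case=> c [cS ->] [e [eS ->]]; exists (fun t => c t + e t); split=> [t|].
  by rewrite rpredD.
by rewrite -big_split; apply: eq_bigr => t _; rewrite scalerDl.
Qed.

Lemma int_spanZ x v : x \in S -> int_span v -> int_span (x *: v).
Proof.
move=> xS [c [cS ->]]; exists (fun t => x * c t); split=> [t|].
  by rewrite rpredM.
by rewrite scaler_sumr; apply: eq_bigr => t _; rewrite scalerA.
Qed.

Lemma int_spanN v : int_span v -> int_span (- v).
Proof. by move=> Hv; rewrite -scaleN1r; apply: int_spanZ => //; rewrite rpredN1. Qed.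

Lemma int_span_sum I (s : seq I) (P : pred I) F :
  (forall i, P i -> int_span (F i)) -> int_span (\sum_(i <- s | P i) F i).
Proof. by move=> H; elim/big_ind: _ => //; [apply: int_span0 | apply: int_spanD]. Qed.

Lemma int_span_family t : int_span (family t).
Proof.
exists (fun t' => (t' == t)%:R); split=> [t'|]; first exact: rpred_nat.
rewrite (bigD1 t) //= eqxx scale1r big1 ?addr0 // => t' /negPf->.
by rewrite scale0r.
Qed.

Lemma int_span_elem f g j : G' g -> f \is a mpolyOver n S -> (msize f <= N)%N ->
  int_span (elem_tensor f g j).
Proof.
move=> Gg /mpolyOverP fS fN; have [e Ee] := coded_mx_onto Gg.
rewrite (mpolywE fN) (lin_fun_sum (elem_tensor_linear g j)).
apply: int_span_sum => mn _; rewrite (lin_funZ (elem_tensor_linear g j)).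
apply: int_spanZ => //.
have := int_span_family (mn, e, j); rewrite /family /= -Ee.
by case: asboolP.
Qed.

(** The members with g = 1 suffice, and the coefficients may be anything in K: integrality is asked
    of the operator and not of the vector. *)
Lemma family_spans (U : V) : (forall j, (msize (U j) <= N)%N) ->
  exists c : family_index -> K, U = \sum_t c t *: family t.
Proof.
move=> UN; have G1 : G' 1%:M by apply: Gmrn1.
have [e Ee] := coded_mx_onto G1; have [t1 _] := tauP.
exists (fun t : family_index => if t.1.2 == e then (U t.2)@_(t.1.1) else 0).
pose F (mn : 'X_{1..n < N}) (e' : {ffun 'I_n * 'I_n -> 'I_r.+1}) (j : 'I_d) : V :=
  (if e' == e then (U j)@_mn else 0) *: family (mn, e', j).
transitivity (\sum_mn \sum_e' \sum_j F mn e' j); last first.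
  rewrite (pair_bigA _ (fun mn e' => \sum_j F mn e' j)).
  by rewrite (pair_bigA _ (fun me j => F me.1 me.2 j)); apply: eq_bigr => -[[]].
apply/ffunP=> l; rewrite sum_ffunE [LHS](mpolywE (UN l)); apply: eq_bigr => mn _.
rewrite sum_ffunE (bigD1 e) //= [X in _ + X]big1 ?addr0 => [|e' /negPf ee].
  rewrite sum_ffunE (bigD1 l) //= /F eqxx !ffunE /family /= -Ee.
  case: asboolP => // _; rewrite !ffunE t1 mxE eqxx scale1r big1 ?addr0 // => j jl.
  by rewrite !ffunE t1 mxE eq_sym (negPf jl) scale0r scaler0.
by rewrite sum_ffunE big1 // => j _; rewrite /F ee scale0r ffunE.
Qed.

Section Monomials.
Variables (i j : 'I_n) (u : K) (mn : 'X_{1..n}).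
Hypotheses (ij : i != j) (ur : u ^+ r = 1) (mN : (mdeg mn < N)%N).

Let u0 : u != 0. Proof. exact: (root1_neq0 r0 ur). Qed.
Local Notation act := (poly_act (s_mx i j u)).
Local Notation dd := (divdiff (s_mx i j u) (s_root i j u)).

(** On a variable, the action and the divided difference only produce the coefficients 0, 1, u, u^-1
    and -u^-1, all in S; the twisted Leibniz rule extends this to monomials. *)
Lemma monomial_over :
  act 'X_[mn] \is a mpolyOver n S /\ 'X_i * dd 'X_[mn] \is a mpolyOver n S.
Proof.
have uS : u \in S by apply: S_root.
have uVS : u^-1 \in S by apply: S_root; rewrite exprVn ur invr1.
have XS b : ('X_b : A) \is a mpolyOver n S by apply: mpolyOverX.
have mv := s_moves ij u0.
have actX b : act 'X_b \is a mpolyOver n S.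
  by rewrite s_act //; do 2?[case: ifP => _]; rewrite ?mpolyOverZ.
have ddX b : dd 'X_b \is a mpolyOver n S.
  have -> : dd 'X_b = (if b == i then 1 else if b == j then - u^-1 else 0)%:MP.
    apply: (divdiff_uniq mv); rewrite s_act // lin_s_root mul_mpolyC.
    have [->|bi] := eqVneq b i; first by rewrite scale1r.
    have [->|bj] := eqVneq b j; last by rewrite scale0r subrr.
    by rewrite scaleNr scalerBr scalerA mulVf // scale1r opprB.
  by rewrite mpolyOverC; do 2?[case: ifP => _]; rewrite ?rpred1 ?rpredN ?rpred0.
suff [? ? ?] : [/\ 'X_[mn] \is a mpolyOver n S, act 'X_[mn] \is a mpolyOver n S
                & dd 'X_[mn] \is a mpolyOver n S].
  by split=> //; rewrite rpredM.
rewrite mpolyXE_id; elim/big_rec: _ => [|b f _ Hf].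
  by rewrite rmorph1 (divdiff_fixed mv) ?rmorph1 ?rpred1 ?rpred0.
elim: (mn b) => [|k [IH1 IH2 IH3]]; first by rewrite expr0 mul1r.
rewrite exprS -mulrA; split; first exact: rpredM.
  by rewrite rmorphM /=; apply: rpredM.
by rewrite (divdiffMr mv); apply: rpredD; apply: rpredM.
Qed.

Lemma pihomog_msize k f : pihomog (Measure.clone _ mdeg _) k f = f -> (msize f <= k.+1)%N.
Proof.
move=> E; rewrite msizeE; apply/bigmax_leqP_seq => m1 m1f _.
have := pihomogP (Measure.clone _ mdeg _) k f; rewrite E => /dhomogP/(_ _ m1f) /= ->.
by [].
Qed.

(** Both operators preserve the degree, so the degree bound N that makes the family finite is
    respected. *)
Lemma monomial_msize :
  (msize (act 'X_[mn]) <= N)%N /\ (msize ('X_i * dd 'X_[mn]) <= N)%N.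
Proof.
have E : pihomog (Measure.clone _ mdeg _) (mdeg mn) 'X_[K, mn] = 'X_[mn].
  by rewrite pihomogX eqxx.
split; apply: leq_trans mN; apply: pihomog_msize.
  by rewrite pihomog_poly_act E.
have mv := s_moves ij u0; move: E; case: (mdeg mn) => [|k] E.
  by rewrite pihomogXM0 -E pihomog_coef0 (divdiff_fixed mv) ?mulr0 // poly_actC.
by rewrite pihomogXMS (pihomog_divdiff _ _ mv) E.
Qed.

End Monomials.

End IntegralFamily.

(** * Cancelling x_i D_i on the components with a_i > 0 *)

Section Genericity.
Variables (K : fieldType) (m r n p : nat) (xi : K) (c0 ct : nat -> K) (d : nat).
Variable tau' : 'M[K]_n -> 'M[K]_d.
Hypotheses (m0 : (0 < m)%N) (rm : (r %| m)%N) (xiP : m.-primitive_root xi).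
Hypotheses (pK : p \in [pchar K]) (pm : ~~ (p %| m)%N).
Hypothesis cP : alg_indep_prime (param_seq m r n c0 ct).
Hypothesis tauP : mx_rep (Gmrn (K := K) (n := n) r r) tau'.

Local Notation q := (m %/ r)%N.
Local Notation om := (xi ^+ r).
Local Notation ze := (xi ^+ q).
Local Notation V := (verma K n d).
Local Notation cl := (s_classes r n).
Local Notation params := (param_seq m r n c0 ct).
Local Notation B := (@iso_dunkl K m r n xi c0 ct d tau').
Local Notation base_dunkl := (@base_dunkl K m r n xi c0 ct d tau').
Implicit Types (a : {ffun 'I_n -> 'I_q}) (U v : V).

Let r0 : (0 < r)%N. Proof. exact: r_gt0 m0 rm. Qed.
Let q0 : (0 < q)%N. Proof. exact: q_gt0 m0 rm. Qed.
Let zeP := prim_ze rm xiP.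

Lemma natq_neq0 : q%:R != 0 :> K.
Proof.
rewrite -(dvdn_pcharf pK); apply: contra pm => pq.
by rewrite -(divnK rm) dvdn_mulr.
Qed.

Lemma size_param_seq : size params = (cl + q.-1)%N.
Proof. by rewrite size_cat !size_map !size_iota. Qed.

Lemma nth_param_c0 k : (k < cl)%N -> params`_k = c0 k.
Proof.
move=> kc; rewrite nth_cat size_map size_iota kc.
by rewrite (nth_map 0%N) ?size_iota // nth_iota.
Qed.

Lemma nth_param_ct k : (0 < k < q)%N -> params`_(cl + k.-1) = ct k.
Proof.
case: k => // k /=; rewrite -ltnS => kq.
have kq' : (k < q.-1)%N by rewrite -ltnS prednK.
rewrite nth_cat size_map size_iota ltnNge leq_addr /= addKn.
by rewrite (nth_map 0%N) ?size_iota // nth_iota.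
Qed.

Lemma dunkl_i_dunkl mm rr (z : K) rho i v : (0 < mm)%N -> (rr %| mm)%N ->
  mm.-primitive_root z ->
  dunkl_i mm rr z c0 ct rho i v = dunkl mm rr z c0 ct rho (delta_mx i 0) v :> V.
Proof.
move=> mm0 rmm zP; rewrite (dunkl_basis _ _ _ mm0 rmm zP) (bigD1 i) //=.
rewrite mxE !eqxx scale1r big1 ?addr0 // => j ji.
by rewrite mxE (negPf ji) scale0r.
Qed.

Lemma base_dunkl_linear i a : linear (base_dunkl i a).
Proof.
have D'L : linear (dunkl_i r r ze c0 ct tau' i : V -> V).
  by move=> c v w; rewrite !(dunkl_i_dunkl _ _ _ r0 (dvdnn r) zeP); apply: dunkl_linear.
have X := verma_mul_linear (d := d) ('X_i : {mpoly K[n]}).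
apply: linear_subf; first by apply: linear_scalef => c v w; rewrite D'L X.
apply: linear_sumf => j; apply: linear_sumf => k; apply: linear_scalef.
exact: verma_act_linear.
Qed.

Lemma base_dunkl_submod (J : V -> Prop) i a U :
  cher_submod r r (verma_ops r r ze c0 ct tau') J -> J U -> J (base_dunkl i a U).
Proof.
move=> JP JU; apply: (subspaceB JP.1).
  apply: (subspaceZ JP.1); apply: (submod_mul JP).
  by rewrite (dunkl_i_dunkl _ _ _ r0 (dvdnn r) zeP); apply: (submod_dunkl JP).
apply: (subspace_sum JP.1) => j ji; apply: (subspace_sum JP.1) => k _.
apply: (subspaceZ JP.1); apply: (submod_act JP) => //.
by apply: s_mx_Gmrn; rewrite 1?eq_sym // (xiX_root zeP).
Qed.

Section Integral.
Variable S : subringClosed K.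
Hypothesis S_root : forall z : K, z ^+ r = 1 -> z \in S.
Hypothesis S_c0 : forall k, (k < cl)%N -> c0 k \in S.

Lemma int_span_base_dunkl i a N t :
  int_span r ze tau' S N (base_dunkl i a (family (r := r) ze tau' (N := N) t)).
Proof.
have BL := base_dunkl_linear i a.
rewrite /family; case: asboolP => Gg; last by rewrite (lin_fun0 BL); apply: int_span0.
move: t.2 (coded_mx ze t.1.2) Gg => j g Gg; set mn : 'X_{1..n} := t.1.1.
have mN : (mdeg mn < N)%N by apply: bmdeg.
have c0S (l : 'I_n) k : l != i -> c0 (k %% cl)%N \in S.
  move=> li; apply: S_c0; rewrite ltn_mod /s_classes [(n <= 1)%N]leqNgt (ord_neq_gt1 li) /=.
  by case: ifP.
have sr k : (ze ^+ k) ^+ r = 1 by apply: xiX_root zeP k.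
have span_elem f h := @int_span_elem K n d r ze tau' zeP S N f h j.
rewrite /base_dunkl (dunkl_i_rr _ _ _ _ m0 rm).
have X := verma_mul_linear (d := d) ('X_i : {mpoly K[n]}).
apply: int_spanD; last first.
  apply: int_spanN; apply: int_span_sum => l li; apply: int_span_sum => k _.
  have il : i != l by rewrite eq_sym.
  apply: int_spanZ; first by rewrite rpredM ?(c0S l) //; case: ifP; rewrite ?rpred_nat ?rpred0.
  have Gs : Gmrn r r (s_mx i l (ze ^+ k)) by apply: s_mx_Gmrn.
  rewrite /verma_act (tens_elem_tensor tauP _ j (poly_act_linear _) Gs Gg).
  apply: span_elem; first exact: (GmrnM r0 Gs Gg).
    by have [] := monomial_over r0 S_root mn il (sr k).
  by have [] := monomial_msize r0 il (sr k) mN.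
apply: int_spanZ; first exact: rpred_nat.
rewrite (lin_funN X) (lin_fun_sum X); apply: int_spanN; apply: int_span_sum => l li.
rewrite (lin_fun_sum X); apply: int_span_sum => k _; rewrite (lin_funZ X).
have il : i != l by rewrite eq_sym.
apply: int_spanZ; first exact: c0S li.
have Gs : Gmrn r r (s_mx i l (ze ^+ k)) by apply: s_mx_Gmrn.
have mv := s_moves il (root1_neq0 r0 (sr k)).
have phiL : linear (fun f => 'X_i * divdiff (s_mx i l (ze ^+ k)) (s_root i l (ze ^+ k)) f).
  by move=> c f1 f2; rewrite (divdiff_linear mv) mulrDr scalerAr.
rewrite /s_op -tens_mull (tens_elem_tensor tauP _ j phiL Gs Gg).
apply: span_elem; first exact: (GmrnM r0 Gs Gg).
  by have [] := monomial_over r0 S_root mn il (sr k).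
by have [] := monomial_msize r0 il (sr k) mN.
Qed.

Lemma base_dunkl_cancel (J : V -> Prop) i a U x :
  cher_submod r r (verma_ops r r ze c0 ct tau') J ->
  (forall f, f \is monic -> f \is a polyOver S -> ~~ root f x) ->
  J (base_dunkl i a U - x *: U) -> J U.
Proof.
(* The bound depends on U; since the operator preserves degrees, any N for which the family spans U
   will do. *)
move=> JP nroot; pose N := (\max_j msize (U j))%N.
have UN j : (msize (U j) <= N)%N by apply: (leq_bigmax (F := fun j => msize (U j))).
have [kappa ->] := family_spans r0 zeP tauP UN.
set T := family_index n d r N in kappa *.
pose w (t : T) : V := family ze tau' t.
have /all_tag[C CP] (t : T) : {c : T -> K | (forall t', c t' \in S) /\
    base_dunkl i a (w t) = \sum_t' c t' *: w t'}.
  by apply: cid; apply: int_span_base_dunkl.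
have ET (F : T -> V) : \sum_t F t = \sum_(s < #|T|) F (enum_val s).
  exact: reindex (onW_bij _ (enum_val_bij T)).
rewrite ET => JU.
pose CM : 'M[K]_#|T| := \matrix_(s, s') C (enum_val s) (enum_val s').
pose kap : 'rV[K]_#|T| := \row_s kappa (enum_val s).
have Eu : \sum_(s < #|T|) kappa (enum_val s) *: w (enum_val s) =
    \sum_(s < #|T|) kap 0 s *: w (enum_val s).
  by apply: eq_bigr => s _; rewrite mxE.
rewrite Eu in JU *.
apply: (stable_family_cancel (C := CM) JP.1 (base_dunkl_linear i a) _ _ _ nroot JU).
- by move=> v; apply: base_dunkl_submod JP.
- move=> s; rewrite (CP (enum_val s)).2 ET; apply: eq_bigr => s' _.
  by rewrite mxE.
- by move=> s s'; rewrite mxE; apply: (CP (enum_val s)).1.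
Qed.

End Integral.

(** S is the integral closure of the ring generated by all parameters except c_1. If - d_b were in
    S, then so would be c_1 (1 - om^b), by subtracting the terms with k > 1, and then c_1 itself, as
    the inverse of 1 - om^b lies in S. *)
Lemma t_weight_not_root b : (0 < b < q)%N ->
  exists S : subringClosed K, [/\ forall z : K, z ^+ r = 1 -> z \in S,
    forall k, (k < cl)%N -> c0 k \in S &
    forall f, f \is monic -> f \is a polyOver S -> ~~ root f (- t_weight m r xi ct b)].
Proof.
move=> bq; have q1 : (1 < q)%N by case/andP: bq => b0; apply: leq_ltn_trans.
have idxP : (cl < size params)%N by rewrite size_param_seq -addn1 leq_add2l -ltnS prednK.
(* [param_seq] lists the [s_classes] values of [c0] before c_1, which is present because q > 1. *)
pose idx := Ordinal idxP; pose S : subringClosed K := integral_closure idx.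
have nthS k : (k < size params)%N -> k != cl -> params`_k \in S.
  move=> ks kc; exact: (integral_closure_other (i := Ordinal ks)).
exists S; split.
- by move=> z; apply: integral_closure_root1.
- move=> k kc; rewrite -nth_param_c0 //; apply: nthS; last by rewrite neq_ltn kc.
  exact: ltn_trans kc idxP.
move=> f fm fS; apply/negP => /(integral_root_closure fm fS).
rewrite /t_weight opprK (bigD1 (Ordinal q1)) //= mul1n => xS.
case: (alg_indep_not_integral pK cP (idx := idx)); apply/integral_closureP.
have om_b : (om ^+ b) ^+ q = 1 by apply: om_exp1 (prim_om m0 rm xiP) b.
have b1 : om ^+ b != 1 by apply: om_exp_neq1 (prim_om m0 rm xiP) b bq.
have omS k : om ^+ k \in S.
  by apply: (integral_closure_root1 _ q0); apply: om_exp1 (prim_om m0 rm xiP) k.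
have -> : params`_idx = ct 1%N.
  by rewrite -(nth_param_ct (k := 1)) //= addn0.
have restS : \sum_(k < q | (0 < k)%N && (k != Ordinal q1)) ct k * (1 - om ^+ (k * b)) \in S.
  apply: rpred_sum => k /andP[k0 k1]; apply: rpredM; last exact: rpredB (rpred1 _) (omS _).
  rewrite -nth_param_ct ?k0 ?ltn_ord //; apply: nthS.
    by rewrite size_param_seq ltn_add2l -ltnS !prednK.
  rewrite -[X in _ != X]addn0 eqn_add2l -lt0n -ltnS prednK // ltn_neqAle k0 andbT.
  by rewrite eq_sym.
have := rpredM (rpredB xS restS) (integral_closure_1subV pK idx q0 om_b b1 natq_neq0).
by rewrite addrK mulfK // subr_eq0 eq_sym.
Qed.

Lemma iso_dunkl_cancel (J : V -> Prop) i a U :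
  cher_submod r r (verma_ops r r ze c0 ct tau') J -> (0 < a i)%N ->
  J (B i a U) -> J U.
Proof.
move=> JP ai JB; have [|S [S1 S2 S3]] := @t_weight_not_root (a i); first by rewrite ai ltn_ord.
apply: (base_dunkl_cancel S1 S2 JP S3 (i := i) (a := a)).
by rewrite scaleNr opprK.
Qed.

End Genericity.

(** * The submodule generated by J^1 after x_i -> x_i^q *)

Section ExtremeExponents.
Variables (K : fieldType) (n q : nat).
Hypothesis q0 : (0 < q)%N.
Implicit Types (f : {mpoly K[n]}) (i : 'I_n) (mn : 'X_{1..n}).

Let ltq_pred : (q.-1 < q)%N. Proof. by rewrite prednK. Qed.

Definition exp0 : {ffun 'I_n -> 'I_q} := [ffun=> Ordinal q0].

(** The exponent of x_i^(q-1), the component into which D_i sends the component a = 0. *)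
Definition exp_top i : {ffun 'I_n -> 'I_q} :=
  [ffun j => if j == i then Ordinal ltq_pred else Ordinal q0].

Lemma exponent0 : exponent exp0 = 0%MM.
Proof. by apply/mnmP=> i; rewrite mnmE ffunE mnm0E. Qed.

Lemma exponent_top i : (U_(i) + exponent (exp_top i) = U_(i) *+ q)%MM.
Proof.
apply/mnmP=> j; rewrite mnmDE mulmnE mnm1E mnmE ffunE eq_sym.
by case: eqP => _; rewrite ?mul1n ?add1n ?prednK.
Qed.

Lemma congruent_top i mn : congruent exp0 (U_(i) + mn)%MM = congruent (exp_top i) mn.
Proof.
apply/forallP/forallP => H j; have /eqP := H j; rewrite ?mnmDE mnm1E !ffunE.
  have [->|_] := eqVneq j i; last by rewrite add0n => ->.
  rewrite /= -modnDmr add1n => E; have := ltn_pmod (mn i) q0.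
  rewrite leq_eqVlt => /orP[/eqP Eq|lt].
    by rewrite -[X in _ == X.-1]Eq.
  by rewrite modn_small in E.
have [->|_] := eqVneq j i; last by rewrite add0n => ->.
by rewrite /= -modnDmr add1n => ->; rewrite prednK // modnn.
Qed.

(** A carry in base q: x_i times x_i^(q-1) U(x^q) is (x_i U)(x^q). *)
Lemma iso0_mulX i f : iso exp0 ('X_i * f) = 'X_i * iso (exp_top i) f.
Proof.
elim/mpolyind: f => [|c mn f _ _ IH].
  by rewrite mulr0 !(lin_fun0 (@iso_linear _ _ _ q0 _)) mulr0.
rewrite mulrDr !(lin_funD (@iso_linear _ _ _ q0 _)) IH mulrDr; congr (_ + _).
rewrite -!scalerAr !(lin_funZ (@iso_linear _ _ _ q0 _)) -scalerAr; congr (_ *: _).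
rewrite -mpolyXD !iso_mon congruent_top; case: ifP => H; last by rewrite mulr0.
rewrite -mpolyXD; congr 'X_[_]; apply/eqP.
have := congruentE q0 exp0 (U_(i) + mn)%MM (U_(i) + mnm_div q mn)%MM.
rewrite congruent_top H /= => ->; rewrite exponent0 add0m.
have := congruentE q0 (exp_top i) mn (mnm_div q mn); rewrite H eqxx => /esym/eqP E.
rewrite {1}E addmA exponent_top; apply/eqP/mnmP=> j.
by rewrite !(mnmDE, mulmnE) mulnDl.
Qed.

End ExtremeExponents.

(** * Singular vectors modulo J^q and irreducibility of the quotient *)

Section Pullback.
Variables (K : fieldType) (m r n p : nat) (xi : K) (c0 ct : nat -> K) (d : nat).
Variables (tau' : 'M[K]_n -> 'M[K]_d) (J : verma K n d -> Prop).
Hypotheses (m0 : (0 < m)%N) (rm : (r %| m)%N) (xiP : m.-primitive_root xi).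
Hypotheses (pK : p \in [pchar K]) (pm : ~~ (p %| m)%N).
Hypothesis cP : alg_indep_prime (param_seq m r n c0 ct).
Hypothesis tauI : irreducible_mx_rep (Gmrn (K := K) (n := n) r r) tau'.

Local Notation q := (m %/ r)%N.
Local Notation om := (xi ^+ r).
Local Notation ze := (xi ^+ q).
Hypothesis JP : max_proper_graded_submod r r ze c0 ct tau' J.

Local Notation V := (verma K n d).
Local Notation G := (Gmrn (K := K) (n := n) m r).
Local Notation tau := (fun g : 'M[K]_n => tau' (pow_entries q g)).
Local Notation D := (@dunkl_i K m r n xi c0 ct d tau).
Local Notation D' := (@dunkl_i K r r n ze c0 ct d tau').
Local Notation dunkl := (@dunkl K m r n xi c0 ct d tau).
Local Notation Mops := (verma_ops m r xi c0 ct tau).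
Implicit Types (a : {ffun 'I_n -> 'I_q}) (U v : V) (i : 'I_n).

Let r0 : (0 < r)%N. Proof. exact: r_gt0 m0 rm. Qed.
Let q0 : (0 < q)%N. Proof. exact: q_gt0 m0 rm. Qed.
Let zeP := prim_ze rm xiP.
Let tauP : mx_rep (Gmrn r r) tau'. Proof. by case: tauI. Qed.
Let Jsub : cher_submod r r (verma_ops r r ze c0 ct tau') J.
Proof. by case: JP => -[]. Qed.
Let nq0 : q%:R != 0 :> K. Proof. exact: natq_neq0 rm pK pm. Qed.
Let a0 := exp0 n q0.

Lemma pullback_irreducible : irreducible_mx_rep G tau.
Proof.
split; first exact: pullback_rep m0 rm tauP.
have [_ [ex H]] := tauI; split=> // N Ns Ninv; apply: H => //.
move=> _ [g Gg ->]; have [h Gh Eh] := pow_entries_onto m0 r0 rm xiP Gg.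
by apply: Ninv; exists h; rewrite // Eh.
Qed.

Lemma mem_JqP v : v \in Jq q J <-> forall a, J (verma_iso a v).
Proof. by apply: (mem_Jq q0) => [|f w Jw]; [apply: Jsub.1 | apply: (submod_mul Jsub)]. Qed.

Lemma verma_iso_delta a b U :
  verma_iso b (verma_mul 'X_[exponent a] (verma_pow_vars q U)) =
  if b == a then U else 0.
Proof.
rewrite (verma_iso_pow q0) iso_exponent; case: eqP => _; first exact: verma_mul1.
by apply/ffunP=> j; rewrite !ffunE mul0r.
Qed.

Lemma verma_iso_mulX_dunkl a i v :
  verma_iso a (verma_mul 'X_i (D i v)) = iso_dunkl xi c0 ct tau' i a (verma_iso a v).
Proof.
have tP := pullback_rep m0 rm tauP.
have DL : linear (D i : V -> V).
  by move=> c u w; rewrite !(dunkl_i_dunkl _ _ _ _ _ m0 rm xiP); apply: dunkl_linear.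
rewrite {1}(verma_iso_sum q0 v) (lin_fun_sum DL).
rewrite (lin_fun_sum (verma_mul_linear (d := d) 'X_i)).
rewrite (lin_fun_sum (verma_iso_linear q0 a)) (bigD1 a) //= big1 ?addr0 => [|b ba].
  by rewrite (mulX_dunkl_iso _ _ m0 rm xiP tauP) verma_iso_delta eqxx.
by rewrite (mulX_dunkl_iso _ _ m0 rm xiP tauP) verma_iso_delta eq_sym (negPf ba).
Qed.

Lemma iso_dunkl0 i U : iso_dunkl xi c0 ct tau' i a0 U = q%:R *: verma_mul 'X_i (D' i U).
Proof.
rewrite /iso_dunkl /base_dunkl [X in _ - X]big1 => [|j ji]; last first.
  by rewrite big1 // => k _; rewrite !ffunE ltnn mulr0 scale0r.
rewrite subr0 [t_weight _ _ _ _ _](_ : _ = 0) ?scale0r ?addr0 //.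
rewrite /t_weight big1 ?oppr0 // => k _.
by rewrite ffunE muln0 expr0 subrr mulr0.
Qed.

Lemma dunkl_pow_vars i U : D i (verma_pow_vars q U) =
  verma_mul ('X_i ^+ q.-1) (verma_pow_vars q (q%:R *: D' i U)).
Proof.
apply: (@verma_mulXI K n d i); have := mulX_dunkl_iso c0 ct m0 rm xiP tauP i a0 U.
rewrite exponent0 mpolyX0 !verma_mul1 => ->; rewrite iso_dunkl0.
rewrite -(lin_funZ (verma_mul_linear _)) verma_pow_varsM pow_varsX verma_mulA.
by rewrite -exprS prednK.
Qed.

Lemma Jq_submod : cher_submod m r Mops (fun v => v \in Jq q J).
Proof.
apply: (A_span_submod m0 rm xiP) => [g _ Gg [U JU ->]|y _ [U JU ->]].
  apply: mem_A_span; exists (verma_act tau' (pow_entries q g) U).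
    by apply: (submod_act Jsub) => //; apply: pow_entries_Gmrn.
  exact: verma_act_pow m0 rm _ _ Gg.
rewrite (dunkl_basis _ _ _ m0 rm xiP); apply: rpred_sum => i _; apply: rpredZ.
rewrite dunkl_pow_vars; apply/A_span_mul/mem_A_span.
exists (q%:R *: D' i U) => //; apply: (subspaceZ Jsub.1).
by rewrite (dunkl_i_dunkl _ _ _ _ _ r0 (dvdnn r) zeP); apply: (submod_dunkl Jsub).
Qed.

Lemma verma_iso_const a e : verma_iso a (vconst n e : V) = if a == a0 then vconst n e else 0.
Proof.
rewrite -verma_iso_delta exponent0 mpolyX0 verma_mul1; congr verma_iso.
by apply/ffunP=> j; rewrite !ffunE pow_varsC.
Qed.

Lemma Jq_singular v : (forall y, dunkl y v \in Jq q J) ->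
  exists e, v - vconst n e \in Jq q J.
Proof.
move=> Dv; have Di i : D i v \in Jq q J by rewrite (dunkl_i_dunkl _ _ _ _ _ m0 rm xiP).
(* The factor x_i is cancelled in an equality of the Verma module, not inside J: the component of
   D_i v at [exp_top] equals q D'_i U, with U the component of v at 0. It lies in J, and q is
   invertible. *)
have D'0 i : J (D' i (verma_iso a0 v)).
  have := verma_iso_mulX_dunkl a0 i v; rewrite iso_dunkl0.
  have -> : verma_iso a0 (verma_mul 'X_i (D i v)) =
      verma_mul 'X_i (verma_iso (exp_top q0 i) (D i v)).
    by apply/ffunP=> j; rewrite !ffunE iso0_mulX.
  rewrite -(lin_funZ (verma_mul_linear _)) => /verma_mulXI E.
  have := (mem_JqP _).1 (Di i) (exp_top q0 i); rewrite E => /(subspaceZ Jsub.1 (q%:R)^-1).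
  by rewrite scalerA mulVf // scale1r.
have Du y : J (Defs.dunkl r r ze c0 ct tau' y (verma_iso a0 v)).
  rewrite (dunkl_basis _ _ _ r0 (dvdnn r) zeP); apply: (subspace_sum Jsub.1) => i _.
  exact: (subspaceZ Jsub.1).
have := singular_const r0 (dvdnn r) zeP tauI JP Du.
rewrite verma_homog0; set e := \col_j _ => Je; exists e.
apply/mem_JqP => a; rewrite (lin_funB (verma_iso_linear q0 a)) verma_iso_const.
have [->//|aa0] := eqVneq a a0; rewrite subr0.
have [i ai] : exists i, (0 < a i)%N.
  apply/existsP; rewrite -[[exists i, _]]negbK negb_exists.
  apply: contra aa0 => /forallP H; apply/eqP/ffunP=> i; apply: val_inj.
  by have := H i; rewrite ffunE /= -eqn0Ngt => /eqP.
apply: (iso_dunkl_cancel m0 rm xiP pK pm cP tauP (i := i) (a := a) Jsub ai).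
rewrite -verma_iso_mulX_dunkl; apply: ((mem_JqP _).1 _ a).
exact: A_span_mul.
Qed.

(** N is not assumed to be graded, so the induction is on a strict bound for all degrees occurring
    in v. Each D_y v has a smaller bound, hence lies in J^q; then v is constant modulo J^q, and that
    constant lies in N. *)
Lemma Jq_meet_const (N : V -> Prop) v : cher_submod m r Mops N ->
  (forall w, w \in Jq q J -> N w) -> (forall e, N (vconst n e) -> e = 0) ->
  N v -> v \in Jq q J.
Proof.
move=> NP JN N0 Nv; have [k [vk _]] := verma_homog_sum v.
elim: k v Nv vk => [|k IH] v Nv vk.
  have [k [_ ->]] := verma_homog_sum v.
  by rewrite big1 ?rpred0 // => l _; apply: vk.
have [y|e Je] := Jq_singular (v := v).
  apply: IH => [|l kl]; first exact: (submod_dunkl NP).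
  rewrite (dunkl_homog _ _ _ _ m0 xiP) vk //.
  exact: lin_fun0 (dunkl_linear r c0 ct tau m0 xiP y).
suff e0 : e = 0 by move: Je; rewrite e0 (lin_fun0 (@vconst_linear _ _ _)) subr0.
apply: N0; have -> : vconst n e = v - (v - vconst n e) :> V by rewrite subKr.
by apply: (subspaceB NP.1) => //; apply: JN.
Qed.

Lemma Jq_quotient_irreducible : irreducible (cher_action m r (quot_ops (Jq q J) Mops)).
Proof.
have tP := pullback_rep m0 rm tauP.
have MP := verma_cher_rep c0 ct m0 rm xiP tP; have [_ JqI] := Jq_submod.
have piL := qmod_pi_linear (Jq q J).
have piE (u : qmod (Jq q J)) : exists v, u = qmod_pi (Jq q J) v.
  by exists (generic_quotient.repr u); rewrite qmod_repr.
have pi0 v : (qmod_pi (Jq q J) v == 0) = (v \in Jq q J).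
  rewrite -(lin_fun0 piL) -[v in RHS]subr0.
  by apply/eqP/idP => /qmod_piP.
split.
  (* The quotient is nonzero: for w outside J, the element w(x^q) has the component w at a = 0. *)
  have [[_ _ [w nJw]] _] := JP; exists (qmod_pi (Jq q J) (verma_pow_vars q w)).
  rewrite pi0; apply/negP => /(mem_JqP _).1 /(_ a0).
  rewrite -[verma_pow_vars q w]verma_mul1 -mpolyX0 -(exponent0 n q0) verma_iso_delta.
  by rewrite eqxx.
move=> N Ns Ninv [u Nu u0]; have [v0 Ev0] := piE u; rewrite {u}Ev0 in Nu u0.
pose M v := N (qmod_pi (Jq q J) v).
have Msub : cher_submod m r Mops M.
  split; first split; rewrite /M.
  - by rewrite (lin_fun0 piL); case: Ns.
  - by move=> c v w Nv Nw; rewrite piL; apply: Ns.2.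
  move=> _ [[x ->]|[y ->]|[g Gg ->]] v Nv; rewrite /M.
  - rewrite -(qmod_op_x MP JqI); apply: Ninv Nv.
    by constructor 1; exists x.
  - rewrite -(qmod_op_y MP JqI); apply: Ninv Nv.
    by constructor 2; exists y.
  - rewrite -(qmod_op_g MP JqI _ Gg); apply: Ninv Nv.
    by constructor 3; exists g.
have JM w : w \in Jq q J -> M w.
  by rewrite -pi0 /M => /eqP->; case: Ns.
have [e Me e0] : exists2 e, M (vconst n e) & e != 0.
  apply: contrapT => H; case/negP: u0; rewrite pi0.
  apply: (Jq_meet_const Msub JM _ Nu) => e Me; apply/eqP/negPn/negP => e0.
  by apply: H; exists e.
move=> u; have [v ->] := piE u.
exact: (submod_const pullback_irreducible Msub Me e0 v).
Qed.

End Pullback.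

(** The first conjunct gives meaning to the second: [quot_ops] computes on representatives, and its
    operators are induced by those of M once J^q is a submodule. *)
Theorem theorem5p4 (m r n p : nat) (K : fieldType) (xi : K) (c0 ct : nat -> K)
    (d : nat) (tau' : 'M[K]_n -> 'M[K]_d) (J1 : verma K n d -> Prop) :
  (0 < m)%N -> (0 < r)%N -> (0 < n)%N -> (r %| m)%N ->
  p \in [pchar K] -> ~~ (p %| m)%N -> m.-primitive_root xi ->
  alg_indep_prime (param_seq m r n c0 ct) ->
  irreducible_mx_rep (Gmrn r r) tau' ->
  let q := (m %/ r)%N in
  let tau := fun g : 'M[K]_n => tau' (pow_entries q g) in
  max_proper_graded_submod r r (xi ^+ q) c0 ct tau' J1 ->
  let M_ops := verma_ops m r xi c0 ct tau in
  cher_submod m r M_ops (fun v => v \in Jq q J1) /\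
  irreducible_cher_rep m r xi c0 ct (quot_ops (Jq q J1) M_ops).
Proof.
move=> m0 _ _ rm pK pm xiP cP tauI q tau JP M_ops.
have Jsub := Jq_submod m0 rm xiP tauI JP.
split; first exact: Jsub.
split; last exact: Jq_quotient_irreducible m0 rm xiP pK pm cP tauI JP.
apply: (quot_cher_rep _ Jsub.2 m0 rm xiP).
exact: (verma_cher_rep c0 ct m0 rm xiP (pullback_rep m0 rm tauI.1)).
Qed.
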